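(* Let $(A,G,\alpha)$ be a pre-ordered Banach algebra dynamical system with $A$ having a closed cone and a positive bounded approximate left identity. Let $\mathcal{R}$ be a uniformly bounded class of positive non-degenerate continuous covariant representations of $(A,G,\alpha)$ on pre-ordered Banach spaces with closed cones. Let $E$ be a pre-ordered Banach algebra with closed cone and a positive bounded approximate left identity, such that $\lambda:E\to\lambda(E)\subseteq\mathcal{M}_l(E)$ is a bipositive topological embedding. Let $(k_A,k_G)$ be a positive non-degenerate $\mathcal{R}$-continuous covariant representation of $(A,G,\alpha)$ on the pre-ordered Banach space $E$ such that: (1) $k_A(A),k_G(G)\subseteq\mathcal{M}_l(E)$, (2) $(k_A\rtimes k_G)(C_c(G,A))\subseteq\lambda(E)$, (3) $(k_A\rtimes k_G)(C_c(G,A))$ is dense in $\lambda(E)$, (4) $(k_A\rtimes k_G)(C_c(G,A_+))$ is dense in $\lambda(E)\cap\mathcal{M}_l(E)_+$. Suppose that, for every positive non-degenerate $\mathcal{R}$-continuous covariant representation $(\pi,U)$ of $(A,G,\alpha)$ on a pre-ordered Banach space $X$ with a closed cone, there exists a positive non-degenerate bounded representation $T:E\to B(X)$ such that the associated positive non-degenerate bounded representation $\overline T:\mathcal{M}_l(E)\to B(X)$ (the one satisfying $\overline T\circ\lambda=T$) satisfies $\overline T\circ k_A=\pi$ and $\overline T\circ k_G=U$. Then there exists a unique topological isomorphism $\psi:(A\rtimes_\alpha G)^{\mathcal{R}}\to E$ such that the induced topological isomorphism $\psi_l:\mathcal{M}_l((A\rtimes_\alpha G)^{\mathcal{R}})\to\mathcal{M}_l(E)$,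 defined by $\psi_l(L):=\psi L\psi^{-1}$, satisfies $k_A=\psi_l\circ i_A^{\mathcal{R}}$ and $k_G=\psi_l\circ i_G^{\mathcal{R}}$. Moreover, $\psi$ is bipositive.
   Context: All vector spaces are real; algebras are associative and not assumed unital; locally compact groups are Hausdorff. A cone in a vector space $V$ is a subset $C$ with $C+C\subseteq C$ and $\lambda C\subseteq C$ for all $\lambda\ge0$. A pre-ordered vector space is a vector space $V$ with a chosen cone $V_+$; $x\le y$ means $y-x\in V_+$. A linear map $T:V_1\to V_2$ is positive if $T(V_1)_+\subseteq(V_2)_+$, and bipositive if it is injective, positive, and $T^{-1}((V_2)_+)\subseteq(V_1)_+$. A pre-ordered algebra is an algebra and pre-ordered vector space with $V_+\cdot V_+\subseteq V_+$; a pre-ordered normed (Banach) algebra is a pre-ordered algebra that is also a normed (Banach) algebra. For a pre-ordered normed space $X$, $B(X)_+=\{T\in B(X):TX_+\subseteq X_+\}$. The completion of a pre-ordered normed space $V$ is its metric completion $\overline V$ with cone the closure of $V_+$ in $\overline V$. A topological isomorphism of normed algebras is an algebra isomorphism that is a homeomorphism; a topological embedding is a homeomorphism onto its image. $\mathrm{Inv}(X)$ is the group of invertible elements of $B(X)$ and $\mathrm{Inv}_+(X)=\{T\in\mathrm{Inv}(X):T^{\pm1}X_+\subseteq X_+\}$. $\mathrm{Aut}_+(A)$ is the group of bounded automorphisms $\beta$ of $A$ with $\beta^{\pm1}(A_+)\subseteq A_+$. A representation of a normed algebra $A$ on a normed space $X$ is an algebra homomorphism $\pi:A\to B(X)$;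 it is non-degenerate if $\mathrm{span}\{\pi(a)x\}$ is dense in $X$, and positive if $\pi(A_+)\subseteq B(X)_+$. A representation of $G$ on $X$ is a group homomorphism $U:G\to\mathrm{Inv}(X)$, positive if it takes values in $\mathrm{Inv}_+(X)$. A pre-ordered Banach algebra dynamical system $(A,G,\alpha)$ consists of a pre-ordered Banach algebra $A$ with closed cone, a locally compact group $G$ and a strongly continuous homomorphism $\alpha:G\to\mathrm{Aut}_+(A)$. A covariant representation of $(A,G,\alpha)$ on $X$ is a pair $(\pi,U)$ of representations of $A$ and $G$ on $X$ with $\pi(\alpha_s(a))=U_s\pi(a)U_s^{-1}$; it is continuous if $\pi$ is bounded and $U$ strongly continuous, non-degenerate if $\pi$ is, and positive if $\pi$ and $U$ are. An approximate left identity is positive if its elements lie in the cone. $C_c(G,A)$ is an algebra under $(f*g)(s)=\int_G f(r)\alpha_r(g(r^{-1}s))\,dr$ (left Haar measure). The integrated form of a continuous covariant representation on a Banach space $X$ is $\pi\rtimes U(f)x=\int_G\pi(f(r))U_rx\,dr$ ($f\in C_c(G,A)$, $x\in X$). A (non-empty) class $\mathcal{R}$ of continuous covariant representations on Banach spaces is uniformly bounded if there are $C\ge0$ and $\nu:G\to\mathbb{R}_{\ge0}$ bounded on compact sets with $\|\pi\|\le C$, $\|U_r\|\le\nu(r)$ for all $(\pi,U)\in\mathcal{R}$, $r\in G$. Then $\sigma^{\mathcal{R}}(f)=\sup_{(\pi,U)\in\mathcal{R}}\|\pi\rtimes U(f)\|$ is a finite algebra seminorm on $C_c(G,A)$. The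 pre-ordered crossed product $(A\rtimes_\alpha G)^{\mathcal{R}}$ is the completion of $C_c(G,A)/\ker\sigma^{\mathcal{R}}$ with the induced norm and the cone $q^{\mathcal{R}}(C_c(G,A_+))$, $q^{\mathcal{R}}$ being the quotient map; it is a pre-ordered Banach algebra whose cone is the closure of $q^{\mathcal{R}}(C_c(G,A_+))$. A $\sigma^{\mathcal{R}}$-bounded linear operator $S:C_c(G,A)\to C_c(G,A)$ induces $S^{\mathcal{R}}\in B((A\rtimes_\alpha G)^{\mathcal{R}})$. A continuous covariant representation $(\pi,U)$ on a Banach space is $\mathcal{R}$-continuous if $\pi\rtimes U$ is bounded with respect to $\sigma^{\mathcal{R}}$. For $a\in A$, $r\in G$, $f\in C_c(G,A)$ put $(i_A(a)f)(s)=af(s)$, $(i_G(r)f)(s)=\alpha_r(f(r^{-1}s))$; these operators are $\sigma^{\mathcal{R}}$-bounded, and $i_A^{\mathcal{R}}(a):=i_A(a)^{\mathcal{R}}$, $i_G^{\mathcal{R}}(r):=i_G(r)^{\mathcal{R}}$. For a normed algebra $B$, $\mathcal{M}_l(B)$ is the algebra of left centralizers: bounded linear $L:B\to B$ with $L(ab)=(La)b$, with operator norm and, if $B$ is pre-ordered, cone $\mathcal{M}_l(B)_+=\mathcal{M}_l(B)\cap B(B)_+$; $\lambda:B\to\mathcal{M}_l(B)$ is the left regular representation $\lambda(a)b=ab$, and $\lambda(B)$ carries the cone $\lambda(B)\cap\mathcal{M}_l(B)_+$. One has $i_A^{\mathcal{R}}(A),i_G^{\mathcal{R}}(G)\subseteq\mathcal{M}_l((A\rtimes_\alpha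 G)^{\mathcal{R}})$. If $B$ has a bounded approximate left identity $(u_i)$ and $T:B\to B(X)$ is a non-degenerate bounded representation on a Banach space $X$, then $\overline T:\mathcal{M}_l(B)\to B(X)$ denotes the unique representation of $\mathcal{M}_l(B)$ on $X$ with $\overline T\circ\lambda=T$; explicitly $\overline T(L)=\text{SOT-}\lim_iT(Lu_i)$. *)

(* Defs.v *)
From HB Require Import structures.
From mathcomp Require Import all_boot all_order all_algebra.
From mathcomp Require Import generic_quotient.
From mathcomp Require Import all_classical all_reals all_analysis.
From mathcomp Require Import lra.

Set Implicit Arguments.
Unset Strict Implicit.
Unset Printing Implicit Defensive.

Import Order.TTheory GRing.Theory Num.Theory.
Import numFieldNormedType.Exports.

Local Open Scope classical_set_scope.
Local Open Scope ring_scope.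
Local Open Scope quotient_scope.

(* The pre-order is given by its cone only; it need not be proper. *)
HB.mixin Record hasCone (R : realType) V & GRing.Lmodule R V := {
  cone : set V;
  coneD : forall x y : V, cone x -> cone y -> cone (x + y);
  coneZ : forall (l : R) (x : V), 0 <= l -> cone x -> cone (l *: x)
}.

HB.structure Definition PreorderedLmodule (R : realType) :=
  {V of GRing.Lmodule R V & hasCone R V}.

#[short(type="pBanachType")]
HB.structure Definition PBanach (R : realType) :=
  {V of CompleteNormedModule R V & hasCone R V}.

(* MathComp's algebras are unital, so the product is a new operation. The
   partial application [amul a] is the left regular representation of a. *)
HB.mixin Record NormedModule_isNormedAlgebra (R : realType) A
    & NormedModule R A := {
  amul : A -> A -> A;
  amulA : forall a b c, amul a (amul b c) = amul (amul a b) c;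
  amulDl : forall a b c, amul (a + b) c = amul a c + amul b c;
  amulDr : forall a b c, amul a (b + c) = amul a b + amul a c;
  amulZl : forall (l : R) a b, amul (l *: a) b = l *: amul a b;
  amulZr : forall (l : R) a b, amul a (l *: b) = l *: amul a b;
  ler_norm_amul : forall a b, `|amul a b| <= `|a| * `|b|
}.

HB.structure Definition NormedAlgebra (R : realType) :=
  {A of NormedModule R A & NormedModule_isNormedAlgebra R A}.

HB.mixin Record hasMulCone (R : realType) A
    & hasCone R A & NormedAlgebra R A := {
  cone_amul : forall a b : A, cone a -> cone b -> cone (amul a b)
}.

#[short(type="pBanachAlgType")]
HB.structure Definition PBanachAlg (R : realType) :=
  {A of PBanach R A & NormedAlgebra R A & hasMulCone R A}.

(* The base point of [PointedTopological] is only needed for the library's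
   generated sigma-algebras and plays no role. *)
HB.mixin Record isLCGroup G & PointedTopological G & Group G := {
  mulg_continuous : continuous (fun p : G * G => (p.1 * p.2)%g);
  invg_continuous : continuous (fun s : G => (s^-1)%g);
  lcgroup_hausdorff : hausdorff_space G;
  lcgroup_locally_compact : locally_compact [set: G]
}.

#[short(type="lcGroupType")]
HB.structure Definition LCGroup :=
  {G of PointedTopological G & Group G & isLCGroup G}.

(* The pre-ordered Banach algebra obtained from an algebra V with an algebra
   seminorm p and a cone P: Cauchy sequences in V modulo sequences on which
   p tends to 0. This is the metric completion of V / ker p with the induced
   norm; its cone is the closure of the image of P. *)
Section Completion.
Context (R : realType) (V : lmodType R).

Record is_seminormed_algebra (mul : V -> V -> V) (p : V -> R) (P : set V)
    : Prop := {
  sna_mulA : forall u v w, mul u (mul v w) = mul (mul u v) w;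
  sna_mulDl : forall u v w, mul (u + v) w = mul u w + mul v w;
  sna_mulDr : forall u v w, mul u (v + w) = mul u v + mul u w;
  sna_mulZl : forall (l : R) u v, mul (l *: u) v = l *: mul u v;
  sna_mulZr : forall (l : R) u v, mul u (l *: v) = l *: mul u v;
  sna_normD : forall u v, p (u + v) <= p u + p v;
  sna_normZ : forall l u, p (l *: u) = `|l| * p u;
  sna_normM : forall u v, p (mul u v) <= p u * p v;
  sna_coneD : forall u v, P u -> P v -> P (u + v);
  sna_coneZ : forall l u, 0 <= l -> P u -> P (l *: u);
  sna_coneM : forall u v, P u -> P v -> P (mul u v)
}.

Record seminormed_algebra := SeminormedAlgebra {
  sna_mul : V -> V -> V;
  sna_norm : V -> R;
  sna_cone : set V;
  snaP : is_seminormed_algebra sna_mul sna_norm sna_cone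
}.

Lemma trivial_snaP :
  is_seminormed_algebra (fun _ _ => 0) (fun _ => 0) [set 0].
Proof.
split=> //=; rewrite ?addr0 ?mulr0//; do ?by move=> *; rewrite ?addr0 ?scaler0 ?mulr0.
- by move=> u v -> ->; rewrite addr0.
- by move=> l u _ ->; rewrite scaler0.
Qed.

Definition trivial_seminormed_algebra := SeminormedAlgebra trivial_snaP.

(* Total constructor: the given data if they form a seminormed algebra, and
   the zero structure otherwise. *)
Definition seminormed_algebra_of (mul : V -> V -> V) (p : V -> R) (P : set V) : seminormed_algebra :=
  match pselect (is_seminormed_algebra mul p P) with
  | left h => SeminormedAlgebra h
  | right _ => trivial_seminormed_algebra
  end.

Variable d : seminormed_algebra.
Let p := sna_norm d.
Let mul := sna_mul d.
Let P := sna_cone d.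
Let dP := snaP d.

Lemma sna_norm0 : p 0 = 0.
Proof. by rewrite -(scale0r (0 : V)) /p (sna_normZ dP) normr0 mul0r. Qed.

Lemma sna_normN u : p (- u) = p u.
Proof. by rewrite -scaleN1r /p (sna_normZ dP) normrN normr1 mul1r. Qed.

Lemma sna_norm_ge0 u : 0 <= p u.
Proof.
have := sna_normD dP u (- u); rewrite subrr -/p sna_norm0 sna_normN.
by rewrite -mulr2n pmulrn_lge0.
Qed.

Lemma sna_normB u v : p (u - v) = p (v - u).
Proof. by rewrite -sna_normN opprB. Qed.

Lemma sna_norm_tri w u v : p (u - v) <= p (u - w) + p (w - v).
Proof. by have := sna_normD dP (u - w) (w - v); rewrite addrA subrK. Qed.

Lemma sna_dist_norm u v : `|p u - p v| <= p (u - v).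
Proof.
have := sna_normD dP (u - v) v; have := sna_normD dP (v - u) u.
rewrite !subrK -/p (sna_normB v u) => h1 h2.
by rewrite ler_norml lerBlDr h2 andbT lerBrDr addrC lerBlDr addrC.
Qed.

Definition sna_cauchy (u : nat -> V) : Prop := forall e : R, 0 < e ->
  exists N : nat, forall m n, (N <= m)%N -> (N <= n)%N -> p (u m - u n) < e.

Definition cauchy_pred : {pred (nat -> V)} := fun u => `[< sna_cauchy u >].

Lemma cauchy_predP u : reflect (sna_cauchy u) (u \in cauchy_pred).
Proof. exact: asboolP. Qed.

Lemma cauchy_pred_submod : submod_closed cauchy_pred.
Proof.
split; first by apply/cauchy_predP => e e0; exists 0%N => m n _ _; rewrite subrr sna_norm0.
move=> l u v /cauchy_predP hu /cauchy_predP hv; apply/cauchy_predP => e e0.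
have k0 : 0 < `|l| + 1 by rewrite ltr_wpDl.
have e2 : 0 < e / 2 by rewrite divr_gt0.
have [N hN] := hu (e / 2 / (`|l| + 1)) (divr_gt0 e2 k0).
have [M hM] := hv (e / 2) e2.
exists (maxn N M) => m n; rewrite !geq_max => /andP[Nm Mm] /andP[Nn Mn].
have -> : (l *: u + v) m - (l *: u + v) n = l *: (u m - u n) + (v m - v n).
  by rewrite scalerBr opprD addrACA.
apply: le_lt_trans (sna_normD dP _ _) _; rewrite (splitr e) (sna_normZ dP).
apply: ler_ltD (hM _ _ Mm Mn).
have := hN _ _ Nm Nn; rewrite ltr_pdivlMr// mulrC => /ltW.
by apply: le_trans; rewrite ler_wpM2r ?sna_norm_ge0// lerDl.
Qed.

HB.instance Definition _ := GRing.isSubmodClosed.Build R (nat -> V) cauchy_pred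
  cauchy_pred_submod.

Record cseq := CSeq { cseq_val :> nat -> V; _ : cseq_val \in cauchy_pred }.
HB.instance Definition _ := [isSub for cseq_val].
HB.instance Definition _ := [Choice of cseq by <:].
HB.instance Definition _ := [SubChoice_isSubLmodule of cseq by <:].


Lemma cseqP (u : cseq) : sna_cauchy u.
Proof. by case: u => u /= /cauchy_predP. Qed.

Lemma cseqD (u v : cseq) n : (u + v) n = u n + v n. Proof. by []. Qed.
Lemma cseqB (u v : cseq) n : (u - v) n = u n - v n. Proof. by []. Qed.
Lemma cseqZ l (u : cseq) n : (l *: u) n = l *: u n. Proof. by []. Qed.

Definition cnorm (u : cseq) : R := lim (p (u n) @[n --> \oo]).

Lemma cnorm_cvg (u : cseq) : p (u n) @[n --> \oo] --> cnorm u.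
Proof.
apply: cauchy_cvg; apply/cauchy_ballP => e e0.
have [N hN] := cseqP u e0.
exists ((fun n => p (u n)) @` [set n | (N <= n)%N], (fun n => p (u n)) @` [set n | (N <= n)%N]) => /=.
  by split; exists N => // n /= Nn; exists n.
move=> [_ _] /= [[m Nm <-] [n Nn <-]].
by apply: le_lt_trans (hN _ _ Nm Nn); exact: sna_dist_norm.
Qed.

Arguments cnorm_cvg : clear implicits.

Lemma cnorm_eq (u : cseq) l : p (u n) @[n --> \oo] --> l -> cnorm u = l.
Proof. by move=> h; apply: cvg_unique h => //; exact: cnorm_cvg. Qed.

Lemma cnormD (u v : cseq) : cnorm (u + v) <= cnorm u + cnorm v.
Proof.
have h : p (u n) + p (v n) @[n --> \oo] --> cnorm u + cnorm v.
  by apply: cvgD; exact: cnorm_cvg.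
have k := cnorm_cvg (u + v).
refine (ler_cvg_to k h _).
by apply: nearW => n; exact: (sna_normD dP).
Qed.

Lemma cnormZ l (u : cseq) : cnorm (l *: u) = `|l| * cnorm u.
Proof.
apply: cnorm_eq; under eq_fun do rewrite cseqZ /p (sna_normZ dP).
exact: cvgMr (cnorm_cvg u).
Qed.

Lemma cnorm_ge0 u : 0 <= cnorm u.
Proof.
by apply: limr_ge; [exact: cvgP (cnorm_cvg u)|apply: nearW => n; exact: sna_norm_ge0].
Qed.

Lemma cnorm0 : cnorm 0 = 0.
Proof. by rewrite -(scale0r (0 : cseq)) cnormZ normr0 mul0r. Qed.

Lemma cnormN u : cnorm (- u) = cnorm u.
Proof. by rewrite -scaleN1r cnormZ normrN normr1 mul1r. Qed.

Lemma cnorm_eq0D u v : cnorm u = 0 -> cnorm v = 0 -> cnorm (u + v) = 0.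
Proof.
move=> hu hv; apply/eqP; rewrite eq_le cnorm_ge0 andbT.
by apply: le_trans (cnormD _ _) _; rewrite hu hv addr0.
Qed.

Definition cequiv_rel : rel cseq := fun u v => cnorm (u - v) == 0.

Lemma cequiv_equiv : equiv_class_of cequiv_rel.
Proof.
split=> [u|u v|v u w]; rewrite /cequiv_rel ?subrr ?cnorm0//.
  by rewrite -cnormN opprB.
move=> /eqP h1 /eqP h2; apply/eqP.
by rewrite -(subrK v u) -addrA; exact: cnorm_eq0D.
Qed.

Canonical cequiv := EquivRelPack cequiv_equiv.
Canonical cequiv_direct := defaultEncModRel cequiv_rel.

Definition completion := {eq_quot cequiv}.

HB.instance Definition _ := Choice.on completion.
HB.instance Definition _ := EqQuotient.on completion.

Definition cpi (u : cseq) : completion := \pi_completion u.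

Lemma reprK_cpi x : cpi (repr x) = x. Proof. exact: reprK. Qed.

Lemma eq_completion (u v : cseq) :
  (cpi u = cpi v) <-> cnorm (u - v) = 0.
Proof. by rewrite /cpi; split=> [/eqmodP/eqP|/eqP h]//; apply/eqmodP. Qed.

Lemma repr_completion (u : cseq) : cnorm (repr (cpi u) - u) = 0.
Proof. by apply/eq_completion; rewrite reprK_cpi. Qed.

Lemma completionW (Q : completion -> Prop) :
  (forall u : cseq, Q (cpi u)) -> forall x, Q x.
Proof. by move=> h x; rewrite -[x]reprK_cpi. Qed.

Definition cadd (x y : completion) : completion := cpi (repr x + repr y).
Definition copp (x : completion) : completion := cpi (- repr x).
Definition cscale (l : R) (x : completion) : completion := cpi (l *: repr x).
Definition cnrm (x : completion) : R := cnorm (repr x).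

Lemma pi_cadd u v : cadd (cpi u) (cpi v) = cpi (u + v).
Proof.
by apply/eq_completion; rewrite opprD addrACA; apply: cnorm_eq0D; exact: repr_completion.
Qed.

Lemma pi_copp u : copp (cpi u) = cpi (- u).
Proof. by apply/eq_completion; rewrite -opprD cnormN; exact: repr_completion. Qed.

Lemma pi_cscale l u : cscale l (cpi u) = cpi (l *: u).
Proof.
by apply/eq_completion; rewrite -scalerBr cnormZ repr_completion mulr0.
Qed.

Lemma pi_cnrm u : cnrm (cpi u) = cnorm u.
Proof.
apply/eqP; rewrite eq_le; apply/andP; split.
  rewrite /cnrm -[X in cnorm X <= _](subrK u); apply: le_trans (cnormD _ _) _.
  by rewrite repr_completion add0r.
rewrite /cnrm -[X in cnorm X <= _](subrK (repr (cpi u))).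
apply: le_trans (cnormD _ _) _.
by rewrite -cnormN opprB repr_completion add0r.
Qed.

Lemma caddA : associative cadd.
Proof.
by elim/completionW=> u; elim/completionW=> v; elim/completionW=> w; rewrite !pi_cadd addrA.
Qed.

Lemma caddC : commutative cadd.
Proof. by elim/completionW=> u; elim/completionW=> v; rewrite !pi_cadd addrC. Qed.

Lemma cadd0 : left_id (cpi 0) cadd.
Proof. by elim/completionW=> u; rewrite pi_cadd add0r. Qed.

Lemma caddN : left_inverse (cpi 0) copp cadd.
Proof. by elim/completionW=> u; rewrite pi_copp pi_cadd addNr. Qed.

HB.instance Definition _ := GRing.isZmodule.Build completion caddA caddC cadd0 caddN.

Lemma piD u v : cpi (u + v) = cpi u + cpi v.
Proof. by rewrite -pi_cadd. Qed.

Lemma cscaleA l k x : cscale l (cscale k x) = cscale (l * k) x.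
Proof. by elim/completionW: x => u; rewrite !pi_cscale scalerA. Qed.

Lemma cscale1 : left_id 1 cscale.
Proof. by elim/completionW => u; rewrite pi_cscale scale1r. Qed.

Lemma cscaleDr : right_distributive cscale +%R.
Proof.
by move=> l; elim/completionW=> u; elim/completionW=> v; rewrite -piD !pi_cscale -piD scalerDr.
Qed.

Lemma cscaleDl x : {morph cscale^~ x : l k / l + k}.
Proof. by move=> l k; elim/completionW: x => u; rewrite !pi_cscale -piD scalerDl. Qed.

HB.instance Definition _ :=
  GRing.Zmodule_isLmodule.Build R completion cscaleA cscale1 cscaleDr cscaleDl.

Lemma piZ l u : cpi (l *: u) = l *: cpi u.
Proof. by rewrite -pi_cscale. Qed.

Lemma piN u : cpi (- u) = - cpi u.
Proof. by rewrite -pi_copp. Qed.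

Lemma cnrmD x y : cnrm (x + y) <= cnrm x + cnrm y.
Proof.
by elim/completionW: x => u; elim/completionW: y => v; rewrite -piD !pi_cnrm cnormD.
Qed.

Lemma cnrmZ l x : cnrm (l *: x) = `|l| * cnrm x.
Proof. by elim/completionW: x => u; rewrite -piZ !pi_cnrm cnormZ. Qed.

Lemma cnrm_eq0 x : cnrm x = 0 -> x = 0.
Proof.
by elim/completionW: x => u; rewrite pi_cnrm => h; apply/eq_completion; rewrite subr0.
Qed.

HB.instance Definition _ := Lmodule_isNormed.Build R completion cnrmD cnrmZ cnrm_eq0.

Lemma norm_pi u : `|cpi u| = cnorm u.
Proof. exact: pi_cnrm. Qed.

Lemma cseq_cst_subproof (v : V) : (fun=> v) \in cauchy_pred.
Proof. by apply/cauchy_predP => e e0; exists 0%N => m n _ _; rewrite subrr sna_norm0. Qed.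

Definition cseq_cst (v : V) : cseq := CSeq (cseq_cst_subproof v).

Definition completion_map (v : V) : completion := cpi (cseq_cst v).

Lemma completion_map_linear : linear completion_map.
Proof.
move=> l u v; rewrite /completion_map -piZ -piD; congr cpi.
exact: val_inj.
Qed.

Lemma norm_completion_map v : `|completion_map v| = p v.
Proof. by rewrite norm_pi; apply: cnorm_eq; apply: cvg_cst; exact: eventually_filter. Qed.

Lemma completion_mapB u v : completion_map u - completion_map v = completion_map (u - v).
Proof.
by rewrite -[u - v]addrC -scaleN1r completion_map_linear scaleN1r addrC.
Qed.

Lemma cvg_completion_map (u : cseq) :
  completion_map (u n) @[n --> \oo] --> cpi u.
Proof.
apply/cvgrPdist_le => e e0; have [N hN] := cseqP u e0.
exists N => // n /= Nn.
rewrite /completion_map -piN -piD norm_pi.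
apply: (@limr_le _ _ _ _ _ _ (cvgP _ (@cnorm_cvg (u - cseq_cst (u n))))).
by exists N => // m Nm; exact: ltW (hN m n Nm Nn).
Qed.

Lemma completion_map_approx (x : completion) (e : R) : 0 < e ->
  exists v, `|x - completion_map v| < e.
Proof.
elim/completionW: x => u e0.
have /cvgrPdist_lt/(_ e e0) := @cvg_completion_map u.
by move=> [N _ hN]; exists (u N); exact: (hN N (leqnn N)).
Qed.

Lemma completion_complete (F : set_system completion) :
  ProperFilter F -> cauchy F -> cvg F.
Proof.
move=> FF /cauchyP Fc.
have i0 n : 0 < n.+1%:R^-1 :> R by rewrite invr_gt0.
have [x hx] := choice (fun n => Fc _ (i0 n)).
have [v hv] := choice (fun n => completion_map_approx (x n) (i0 n)).
have near_v n : F (ball (completion_map (v n)) (n.+1%:R^-1 + n.+1%:R^-1)).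
  apply: filterS (hx n) => y; apply: ball_triangle.
  by apply: ball_sym; rewrite -ball_normE /ball_/=; exact: hv.
have small (e : R) : 0 < e -> exists N, forall n, (N <= n)%N -> n.+1%:R^-1 < e.
  move=> e0; have [N _ hN] := near_infty_natSinv_lt (PosNum e0).
  by exists N => n /hN.
have vc : v \in cauchy_pred.
  apply/cauchy_predP => e e0.
  have e4 : 0 < e / 4 by rewrite divr_gt0.
  have [N hN] := small _ e4; exists N => m n Nm Nn.
  have [y [ym yn]] := filter_ex (filterI (near_v m) (near_v n)).
  rewrite -norm_completion_map -completion_mapB.
  have : ball (completion_map (v m)) (e / 4 + e / 4 + (e / 4 + e / 4)) (completion_map (v n)).
    apply: (@ball_triangle _ _ y).
      by apply: le_ball ym; rewrite ltW// ltrD// hN.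
    by apply: ball_sym; apply: le_ball yn; rewrite ltW// ltrD// hN.
  rewrite -ball_normE /ball_/= => /lt_le_trans; apply.
  by rewrite -!mulrDl -(mulr1 e) -!mulrDr; lra.
apply/cvg_ex; exists (cpi (CSeq vc)).
apply/cvg_ballP => e e0.
have e4 : 0 < e / 4 by rewrite divr_gt0.
have [N hN] := small _ e4.
have /cvg_ballP/(_ _ e4) [M _ hM] := @cvg_completion_map (CSeq vc).
pose n := maxn N M.
apply: filterS (near_v n) => y ny.
have : ball (cpi (CSeq vc)) (e / 4 + (e / 4 + e / 4)) y.
  apply: (@ball_triangle _ _ (completion_map (v n))).
    by apply: hM; rewrite /= leq_maxr.
  by apply: le_ball ny; rewrite ltW// ltrD// hN// leq_maxl.
by apply: le_ball; lra.
Qed.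

HB.instance Definition _ := Uniform_isComplete.Build completion completion_complete.

Lemma cseq_mul_subproof (u v : cseq) :
  (fun n => mul (u n) (v n)) \in cauchy_pred.
Proof.
have bnd (w : cseq) : exists2 M, 0 < M & exists N, forall n, (N <= n)%N -> p (w n) < M.
  have [N hN] := cseqP w (@ltr01 R).
  exists (p (w N) + 1); first by rewrite ltr_wpDl// sna_norm_ge0.
  exists N => n Nn.
  have := sna_normD dP (w n - w N) (w N); rewrite subrK => /le_lt_trans; apply.
  by rewrite addrC ltrD2l hN.
have [M M0 [m hm]] := bnd u; have [K K0 [k hk]] := bnd v.
apply/cauchy_predP => e e0.
have e2 : 0 < e / 2 by rewrite divr_gt0.
have [N1 h1] := cseqP u (divr_gt0 e2 K0).
have [N2 h2] := cseqP v (divr_gt0 e2 M0).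
exists (maxn (maxn m k) (maxn N1 N2)) => i j.
rewrite !geq_max => /andP[/andP[mi ki] /andP[ai bi]] /andP[/andP[mj kj] /andP[aj bj]].
have mulN a b : mul a (- b) = - mul a b by rewrite -scaleN1r /mul (sna_mulZr dP) scaleN1r.
have mulNl a b : mul (- a) b = - mul a b by rewrite -scaleN1r /mul (sna_mulZl dP) scaleN1r.
have -> : mul (u i) (v i) - mul (u j) (v j) =
    mul (u i - u j) (v i) + mul (u j) (v i - v j).
  rewrite /mul (sna_mulDl dP) (sna_mulDr dP) -/mul mulN mulNl addrA.
  by rewrite subrK.
apply: le_lt_trans (sna_normD dP _ _) _; rewrite (splitr e); apply: ltrD.
  apply: le_lt_trans (sna_normM dP _ _) _.
  have := h1 _ _ ai aj; rewrite ltr_pdivlMr// => /(le_lt_trans _); apply.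
  by rewrite ler_wpM2l ?sna_norm_ge0// ltW// hk.
apply: le_lt_trans (sna_normM dP _ _) _.
have := h2 _ _ bi bj; rewrite ltr_pdivlMr// mulrC => /(le_lt_trans _); apply.
by rewrite ler_wpM2r ?sna_norm_ge0// ltW// hm.
Qed.

Definition cseq_mul (u v : cseq) : cseq := CSeq (cseq_mul_subproof u v).

Definition cmul (x y : completion) : completion :=
  cpi (cseq_mul (repr x) (repr y)).

Lemma cseq_mulDl u v w : cseq_mul (u + v) w = cseq_mul u w + cseq_mul v w.
Proof. by apply/val_inj/funext => n; exact: (sna_mulDl dP). Qed.
Lemma cseq_mulDr u v w : cseq_mul u (v + w) = cseq_mul u v + cseq_mul u w.
Proof. by apply/val_inj/funext => n; exact: (sna_mulDr dP). Qed.
Lemma cseq_mulZl l u v : cseq_mul (l *: u) v = l *: cseq_mul u v.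
Proof. by apply/val_inj/funext => n; exact: (sna_mulZl dP). Qed.
Lemma cseq_mulZr l u v : cseq_mul u (l *: v) = l *: cseq_mul u v.
Proof. by apply/val_inj/funext => n; exact: (sna_mulZr dP). Qed.
Lemma cseq_mulNl u v : cseq_mul (- u) v = - cseq_mul u v.
Proof.
rewrite -[RHS]scaleN1r -cseq_mulZl; congr (cseq_mul _ v); exact: esym (scaleN1r u).
Qed.
Lemma cseq_mulNr u v : cseq_mul u (- v) = - cseq_mul u v.
Proof.
rewrite -[RHS]scaleN1r -cseq_mulZr; congr (cseq_mul u _); exact: esym (scaleN1r v).
Qed.
Lemma cseq_mulA u v w : cseq_mul u (cseq_mul v w) = cseq_mul (cseq_mul u v) w.
Proof. by apply/val_inj/funext => n; exact: (sna_mulA dP). Qed.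

Lemma cnormM u v : cnorm (cseq_mul u v) <= cnorm u * cnorm v.
Proof.
have h : p (u n) * p (v n) @[n --> \oo] --> cnorm u * cnorm v.
  by apply: cvgM; exact: cnorm_cvg.
have k := cnorm_cvg (cseq_mul u v).
refine (ler_cvg_to k h _).
by apply: nearW => n; exact: (sna_normM dP).
Qed.

Lemma cnormM_eq0 u v : cnorm u = 0 \/ cnorm v = 0 -> cnorm (cseq_mul u v) = 0.
Proof.
move=> h; apply/eqP; rewrite eq_le cnorm_ge0 andbT; apply: le_trans (cnormM _ _) _.
by case: h => ->; rewrite ?mul0r ?mulr0.
Qed.

Lemma pi_cmul u v : cmul (cpi u) (cpi v) = cpi (cseq_mul u v).
Proof.
apply/eq_completion.
set a := repr (cpi u); set b := repr (cpi v).
have -> : cseq_mul a b - cseq_mul u v = cseq_mul (a - u) b + cseq_mul u (b - v).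
  by rewrite cseq_mulDl cseq_mulDr cseq_mulNl cseq_mulNr addrA subrK.
apply: cnorm_eq0D; apply: cnormM_eq0; [left|right]; exact: repr_completion.
Qed.

Lemma cmulA x y z : cmul x (cmul y z) = cmul (cmul x y) z.
Proof.
elim/completionW: x => u; elim/completionW: y => v; elim/completionW: z => w.
by rewrite !pi_cmul cseq_mulA.
Qed.

Lemma cmulDl x y z : cmul (x + y) z = cmul x z + cmul y z.
Proof.
elim/completionW: x => u; elim/completionW: y => v; elim/completionW: z => w.
by rewrite -piD !pi_cmul cseq_mulDl piD.
Qed.

Lemma cmulDr x y z : cmul x (y + z) = cmul x y + cmul x z.
Proof.
elim/completionW: x => u; elim/completionW: y => v; elim/completionW: z => w.
by rewrite -piD !pi_cmul cseq_mulDr piD.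
Qed.

Lemma cmulZl l x y : cmul (l *: x) y = l *: cmul x y.
Proof.
by elim/completionW: x => u; elim/completionW: y => v; rewrite -piZ !pi_cmul cseq_mulZl piZ.
Qed.

Lemma cmulZr l x y : cmul x (l *: y) = l *: cmul x y.
Proof.
by elim/completionW: x => u; elim/completionW: y => v; rewrite -piZ !pi_cmul cseq_mulZr piZ.
Qed.

Lemma cmul_norm x y : `|cmul x y| <= `|x| * `|y|.
Proof.
by elim/completionW: x => u; elim/completionW: y => v; rewrite pi_cmul !norm_pi cnormM.
Qed.

HB.instance Definition _ := NormedModule_isNormedAlgebra.Build R completion
  cmulA cmulDl cmulDr cmulZl cmulZr cmul_norm.

Lemma completion_mapM u v :
  completion_map (mul u v) = amul (completion_map u) (completion_map v).
Proof. by rewrite /amul/= pi_cmul; congr cpi; exact: val_inj. Qed.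

Definition completion_cone : set completion := closure (completion_map @` P).

Lemma completion_coneP x : completion_cone x <->
  forall e, 0 < e -> exists2 v, P v & `|x - completion_map v| < e.
Proof.
split=> h.
  move=> e e0; have [_ [[v Pv <-]]] := h _ (nbhsx_ballx x e e0).
  by rewrite -ball_normE; exists v.
move=> B /nbhs_ballP[e /= e0 eB]; have [v Pv ve] := h e e0.
exists (completion_map v); split; first by exists v.
by apply: eB; rewrite -ball_normE.
Qed.

Lemma completion_coneD x y :
  completion_cone x -> completion_cone y -> completion_cone (x + y).
Proof.
move=> /completion_coneP hx /completion_coneP hy; apply/completion_coneP => e e0.
have e2 : 0 < e / 2 by rewrite divr_gt0.
have [u Pu ue] := hx _ e2; have [v Pv ve] := hy _ e2.
exists (u + v); first exact: (sna_coneD dP).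
have -> : completion_map (u + v) = completion_map u + completion_map v.
  by have := completion_map_linear 1 u v; rewrite !scale1r.
by rewrite opprD addrACA (splitr e); apply: le_lt_trans (ler_normD _ _) _; exact: ltrD.
Qed.

Lemma completion_coneZ (l : R) x :
  0 <= l -> completion_cone x -> completion_cone (l *: x).
Proof.
move=> l0 /completion_coneP hx; apply/completion_coneP => e e0.
have l1 : 0 < l + 1 by rewrite ltr_wpDl.
have [u Pu ue] := hx _ (divr_gt0 e0 l1).
exists (l *: u); first exact: (sna_coneZ dP).
have -> : completion_map (l *: u) = l *: completion_map u.
  have z : completion_map 0 = 0 by rewrite -(subrr (0 : V)) -completion_mapB subrr.
  by have := completion_map_linear l u 0; rewrite !addr0 z addr0.
rewrite -scalerBr normrZ ger0_norm//.
have := ue; rewrite ltr_pdivlMr// mulrC; apply: le_lt_trans.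
by rewrite ler_wpM2r// lerDl.
Qed.

HB.instance Definition _ :=
  hasCone.Build R completion completion_coneD completion_coneZ.

Lemma completion_coneM (x y : completion) : cone x -> cone y -> cone (amul x y).
Proof.
rewrite /cone/= => /completion_coneP hx /completion_coneP hy.
apply/completion_coneP => e e0.
have y1 : 0 < `|y| + 1 by rewrite ltr_wpDl.
have [u Pu ue] := hx _ (divr_gt0 (divr_gt0 e0 (ltr0Sn R 1)) y1).
have u1 : 0 < `|completion_map u| + 1 by rewrite ltr_wpDl.
have [v Pv ve] := hy _ (divr_gt0 (divr_gt0 e0 (ltr0Sn R 1)) u1).
exists (mul u v); first exact: (sna_coneM dP).
rewrite completion_mapM.
have mulN (a b : completion) : amul a (- b) = - amul a b by rewrite -scaleN1r amulZr scaleN1r.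
have mulNl (a b : completion) : amul (- a) b = - amul a b by rewrite -scaleN1r amulZl scaleN1r.
have -> : amul x y - amul (completion_map u) (completion_map v) =
  amul (x - completion_map u) y + amul (completion_map u) (y - completion_map v).
  by rewrite amulDl amulDr mulN mulNl addrA subrK.
rewrite (splitr e); apply: le_lt_trans (ler_normD _ _) _; apply: ltrD.
  apply: le_lt_trans (ler_norm_amul _ _) _.
  have := ue; rewrite ltr_pdivlMr//; apply: le_lt_trans.
  by rewrite ler_wpM2l// lerDl.
apply: le_lt_trans (ler_norm_amul _ _) _.
have := ve; rewrite ltr_pdivlMr// mulrC; apply: le_lt_trans.
by rewrite ler_wpM2r// lerDl.
Qed.

HB.instance Definition _ := hasMulCone.Build R completion completion_coneM.

End Completion.

Section Operators.
Context (R : realType).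

Definition linear_span (X : lmodType R) (S : set X) : set X :=
  [set y | exists n (c : 'I_n -> R) (v : 'I_n -> X),
     (forall i, S (v i)) /\ y = \sum_(i < n) c i *: v i].

Definition bounded_operator (X Y : normedModType R) (T : X -> Y) : Prop :=
  linear T /\ exists M : R, forall x, `|T x| <= M * `|x|.

Definition opnorm (X Y : normedModType R) (T : X -> Y) : R :=
  sup [set `|T x| | x in [set x : X | `|x| <= 1]].

Definition op_closure (X Y : normedModType R) (S : set (X -> Y)) : set (X -> Y) :=
  [set T | bounded_operator T /\
    forall e : R, 0 < e -> exists2 S', S S' & opnorm (T \- S') < e].

Definition op_cone (X : pBanachType R) : set (X -> X) :=
  [set T | bounded_operator T /\ forall x, cone x -> cone (T x)].

Definition inverse_operators (X : normedModType R) (T S : X -> X) : Prop :=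
  [/\ bounded_operator T, bounded_operator S, cancel T S & cancel S T].

Definition Inv (X : normedModType R) : set (X -> X) :=
  [set T | exists S, inverse_operators T S].

Definition Inv_pos (X : pBanachType R) : set (X -> X) :=
  [set T | exists S, inverse_operators T S /\
    forall x, cone x -> cone (T x) /\ cone (S x)].

Definition left_centralizer (B : pBanachAlgType R) : set (B -> B) :=
  [set L | bounded_operator L /\ forall a b, L (amul a b) = amul (L a) b].

Definition left_centralizer_cone (B : pBanachAlgType R) : set (B -> B) :=
  @left_centralizer B `&` @op_cone B.

(* Nets are rendered as maps from a type with a proper filter. *)
Definition positive_bounded_approximate_left_identity (A : pBanachAlgType R)
    : Prop :=
  exists (I : Type) (F : set_system I) (u : I -> A),
    [/\ ProperFilter F, exists M : R, forall i, `|u i| <= M,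
        forall i, cone (u i) & forall a, amul (u i) a @[i --> F] --> a].

Definition Aut_pos (A : pBanachAlgType R) : set (A -> A) :=
  [set beta | bounded_operator beta /\
    (forall a b, beta (amul a b) = amul (beta a) (beta b)) /\
    exists gamma, [/\ cancel beta gamma, cancel gamma beta &
      forall a, cone a -> cone (beta a) /\ cone (gamma a)]].

Definition representation (A : pBanachAlgType R) (X : pBanachType R)
    (pi : A -> X -> X) : Prop :=
  [/\ forall a, bounded_operator (pi a), linear pi &
      forall a b, pi (amul a b) = pi a \o pi b].

Definition bounded_representation (A : pBanachAlgType R) (X : pBanachType R)
    (pi : A -> X -> X) : Prop :=
  exists C : R, forall a, opnorm (pi a) <= C * `|a|.

Definition nondegenerate_representation (A : pBanachAlgType R) (X : pBanachType R)
    (pi : A -> X -> X) : Prop :=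
  closure (linear_span [set y | exists a x, y = pi a x]) = setT.

Definition positive_representation (A : pBanachAlgType R) (X : pBanachType R)
    (pi : A -> X -> X) : Prop :=
  forall a, cone a -> op_cone (pi a).

(* Tbar is a representation on X of the algebra of left centralizers of E
   extending T along the left regular representation; its values outside the
   left centralizers are irrelevant. For non-degenerate T and E with a bounded
   approximate left identity it is unique on the left centralizers. *)
Definition centralizer_extension (E : pBanachAlgType R) (X : pBanachType R)
    (T : E -> X -> X) (Tbar : (E -> E) -> (X -> X)) : Prop :=
  [/\ forall L, left_centralizer L -> bounded_operator (Tbar L),
      forall (l : R) L L', left_centralizer L -> left_centralizer L' ->
        Tbar (l *: L + L') = l *: Tbar L + Tbar L',
      forall L L', left_centralizer L -> left_centralizer L' ->
        Tbar (L \o L') = Tbar L \o Tbar L'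
    & forall e, Tbar (amul e) = T e].

Definition bipositive (V W : pBanachType R) (T : V -> W) : Prop :=
  [/\ injective T, forall x, cone x -> cone (T x)
    & forall x, cone (T x) -> cone x].

(* The left regular representation e |-> amul e is a bipositive homeomorphism
   onto its image, which carries the operator norm and the restricted cone. *)
Definition regular_bipositive_embedding (E : pBanachAlgType R) : Prop :=
  [/\ injective (@amul R E),
      forall e : E, cone e -> left_centralizer_cone (amul e),
      forall e : E, left_centralizer_cone (amul e) -> cone e,
      forall (e : E) (eps : R), 0 < eps -> exists2 delta : R, 0 < delta &
        forall e', `|e - e'| < delta -> opnorm (amul e \- amul e') < eps
    & forall (e : E) (eps : R), 0 < eps -> exists2 delta : R, 0 < delta &
        forall e', opnorm (amul e \- amul e') < delta -> `|e - e'| < eps].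

Definition topological_isomorphism (B E : pBanachAlgType R) (psi : B -> E)
    : Prop :=
  [/\ linear psi, forall a b, psi (amul a b) = amul (psi a) (psi b),
      continuous psi &
      exists phi : E -> B, [/\ cancel psi phi, cancel phi psi & continuous phi]].

Definition inverse_function (B E : pBanachAlgType R) (psi : B -> E) (e : E) : B :=
  xget 0 [set b | psi b = e].

Definition induced_on_operators (B E : pBanachAlgType R) (psi : B -> E)
    (L : B -> B) : E -> E :=
  psi \o L \o inverse_function psi.

End Operators.

Section BochnerIntegral.
Context (d : measure_display) (T : measurableType d) (R : realType).
Context (mu : {measure set T -> \bar R}) (X : normedModType R).

(* Bochner integral: y is the limit of the integrals of step functions (lists
   of pairs of a set of finite measure and a vector) converging to F in L1. *)
Definition step_fun (l : seq (set T * X)) (t : T) : X :=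
  \sum_(q <- l) \1_(q.1) t *: q.2.

Definition step_integral (l : seq (set T * X)) : X :=
  \sum_(q <- l) fine (mu q.1) *: q.2.

Definition is_integral (F : T -> X) (y : X) : Prop :=
  exists l : nat -> seq (set T * X),
    [/\ forall n q, q \in l n -> measurable q.1 /\ (mu q.1 < +oo)%E,
        forall n, mu.-integrable setT (fun t => (`|F t - step_fun (l n) t|)%:E),
        (\int[mu]_t (`|F t - step_fun (l n) t|)%:E @[n --> \oo] --> 0)%E &
        step_integral (l n) @[n --> \oo] --> y].

Definition integral_of (F : T -> X) : X := xget 0 [set y | is_integral F y].

End BochnerIntegral.

Definition borel (G : lcGroupType) := g_sigma_algebraType (@open G).

(* A left Haar measure as a left invariant nonzero Radon measure. *)
Record left_haar (R : realType) (G : lcGroupType)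
    (mu : {measure set (borel G) -> \bar R}) : Prop := {
  haar_invariant : forall (s : G) (S : set G),
    measurable (S : set (borel G)) -> mu [set (s * t)%g | t in S] = mu S;
  haar_nonzero : (mu setT != 0)%E;
  haar_compact : forall K : set G, compact K -> (mu K < +oo)%E;
  haar_outer : forall S : set G, measurable (S : set (borel G)) ->
    mu S = ereal_inf [set mu U | U in [set U : set G | open U /\ S `<=` U]];
  haar_inner : forall U : set G, open U ->
    mu U = ereal_sup [set mu K | K in [set K : set G | compact K /\ K `<=` U]]
}.

Section DynamicalSystem.
Context (R : realType) (A : pBanachAlgType R) (G : lcGroupType).
Context (mu : {measure set (borel G) -> \bar R}) (alpha : G -> A -> A).

Record dynamical_system : Prop := {
  dyn_closed_cone : closed (cone : set A);
  dyn_aut : forall s, Aut_pos (alpha s);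
  dyn_hom : forall s t, alpha (s * t)%g = alpha s \o alpha t;
  dyn_continuous : forall a, continuous (fun s => alpha s a)
}.

(* As U is a homomorphism into the invertible operators, the inverse of U s is
   U (s^-1). *)
Record continuous_covariant (X : pBanachType R) (pi : A -> X -> X)
    (U : G -> X -> X) : Prop := {
  cov_pi : representation pi;
  cov_Inv : forall s, Inv (U s);
  cov_hom : forall s t, U (s * t)%g = U s \o U t;
  cov_cov : forall s a, pi (alpha s a) = U s \o pi a \o U (s^-1)%g;
  cov_bounded : bounded_representation pi;
  cov_continuous : forall x, continuous (fun s => U s x)
}.

Definition positive_group_representation (X : pBanachType R) (U : G -> X -> X) : Prop :=
  forall s, Inv_pos (U s).

(* C_c(G, A), as a submodule of the module of all functions G -> A. *)
Definition Cc_pred : {pred (G -> A)} :=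
  fun f => `[< continuous f /\ compact (closure [set s | f s != 0]) >].

Lemma Cc_pred_submod : submod_closed Cc_pred.
Proof.
split.
  apply/asboolP; split; first by move=> s; exact: cvg_cst.
  rewrite (_ : [set s | _] = set0) ?closure0; first exact: compact0.
  by rewrite -subset0 => s /=; rewrite eqxx.
move=> l f g /asboolP[cf kf] /asboolP[cg kg]; apply/asboolP; split.
  by move=> s; apply: cvgD; [apply: cvgZl_tmp; exact: cf|exact: cg].
apply: (@subclosed_compact _ _ _ _ (compactU kf kg)); first exact: closed_closure.
rewrite -closureU; apply: closure_subset => s /= h.
have [fs|fs] := eqVneq (f s) 0; [right|by left].
apply: contra_neq h => gs.
by rewrite /GRing.add/= /GRing.scale/= fs gs scaler0 addr0.
Qed.

HB.instance Definition _ := GRing.isSubmodClosed.Build R (G -> A) Cc_pred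
  Cc_pred_submod.

Record Cc := MkCc { Cc_val :> G -> A; _ : Cc_val \in Cc_pred }.
HB.instance Definition _ := [isSub for Cc_val].
HB.instance Definition _ := [Choice of Cc by <:].
HB.instance Definition _ := [SubChoice_isSubLmodule of Cc by <:].

End DynamicalSystem.

Section CrossedProduct.
Context (R : realType) (A : pBanachAlgType R) (G : lcGroupType).
Context (mu : {measure set (borel G) -> \bar R}) (alpha : G -> A -> A).
Local Notation Cc := (Cc A G).

(* h itself if h is continuous with compact support, and 0 otherwise. *)
Definition to_Cc (h : G -> A) : Cc := insubd (0 : Cc) h.

Definition Cc_cone : set Cc := [set f | forall s, cone (f s)].

Definition convolution (f g : Cc) : Cc :=
  to_Cc (fun s =>
    integral_of mu (fun r => amul (f r) (alpha r (g (r^-1 * s)%g)))).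

Definition left_A (a : A) (f : Cc) : Cc := to_Cc (fun s => amul a (f s)).

Definition left_G (r : G) (f : Cc) : Cc :=
  to_Cc (fun s => alpha r (f (r^-1 * s)%g)).

Definition integrated_form (X : pBanachType R) (pi : A -> X -> X)
    (U : G -> X -> X) (f : Cc) : X -> X :=
  fun x => integral_of mu (fun r => pi (f r) (U r x)).

(* A predicate over all pre-ordered Banach spaces, i.e., possibly a proper
   class of pairs of representations. *)
Definition representation_class :=
  forall X : pBanachType R, (A -> X -> X) -> (G -> X -> X) -> Prop.

Definition uniformly_bounded (Rcl : representation_class) : Prop :=
  exists (C : R) (nu : G -> R),
    [/\ 0 <= C, forall r, 0 <= nu r,
        forall K : set G, compact K -> exists M : R, forall r, K r -> nu r <= M
      & forall X pi U, Rcl X pi U ->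
          (forall a, opnorm (pi a) <= C * `|a|) /\
          (forall r, opnorm (U r) <= nu r)].

Variable Rcl : representation_class.

Definition class_seminorm (f : Cc) : R :=
  sup [set n | exists (X : pBanachType R) pi U,
         @Rcl X pi U /\ n = opnorm (integrated_form pi U f)].

Definition crossed_product : pBanachAlgType R :=
  completion (seminormed_algebra_of convolution class_seminorm Cc_cone).

Definition quotient_map (f : Cc) : crossed_product :=
  completion_map (seminormed_algebra_of convolution class_seminorm Cc_cone) f.

(* The bounded operator on the crossed product induced by S; it is unique
   since the range of quotient_map is dense. *)
Definition extended_operator (S : Cc -> Cc) : crossed_product -> crossed_product :=
  xget (fun=> 0) [set L | bounded_operator L /\
    forall f, L (quotient_map f) = quotient_map (S f)].

Definition i_A (a : A) : crossed_product -> crossed_product :=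
  extended_operator (left_A a).

Definition i_G (r : G) : crossed_product -> crossed_product :=
  extended_operator (left_G r).

(* R-continuity of a covariant representation, for the class R = Rcl. *)
Definition class_continuous (X : pBanachType R) (pi : A -> X -> X)
    (U : G -> X -> X) : Prop :=
  continuous_covariant alpha pi U /\
  exists C : R, forall f, opnorm (integrated_form pi U f) <= C * class_seminorm f.

End CrossedProduct.

Arguments quotient_map {R A G} mu alpha Rcl.
Arguments extended_operator {R A G} mu alpha Rcl.
Arguments i_A {R A G} mu alpha Rcl.
Arguments i_G {R A G} mu alpha Rcl.

(* Main.v *)
Require Import Defs.
From mathcomp Require Import all_boot all_order all_algebra.
From mathcomp Require Import all_classical all_reals all_analysis measurable_realfun.
From mathcomp Require Import ring lra.

(** The isomorphism is forced on the dense image of C_c(G, A). Write [q f] for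
    the class of [f] in the crossed product [B]. By hypothesis the operator
    [kA >< kG (f)] on [E] is left multiplication by a unique element of [E],
    called [lift f]; an isomorphism that intertwines [(iA, iG)] with [(kA, kG)]
    commutes with integrals and [iA >< iG (f)] is left multiplication by [q f],
    so it must send [q f] to [lift f] ([intertwiner_q]). This gives uniqueness.

    For existence, [q f |-> lift f] has to be bounded in both directions; then
    it and its inverse extend by density ([dense_extension]). One bound is the
    continuity of [(kA, kG)] with respect to the class, the regular
    representation of [E] being bounded below ([lift_norm_le]). For the other
    bound, the universal property of [E] is applied to [(iA, iG)] acting on [B]
    itself, which is a positive non-degenerate continuous covariant
    representation ([iAG_covariant], [iAG_integrated], [iA_nondegenerate]). It
    yields a bounded representation [T] of [E] on [B] with
    [T (lift f) = amul (q f)] ([T_lift]), so that the operator norm of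
    [amul (q f)] is at most a multiple of the norm of [lift f]. Finally the
    regular representation of [B] is bounded below as well
    ([norm_le_regular]): every member of the class is non-degenerate, so the
    functions [phi (r) u_i], with [u_i] an approximate left identity of [A] and
    [phi] a bump of integral one near the unit of [G], act on it as
    approximate units with uniformly bounded seminorm.
    Positivity in the two directions follows because the two cones are the
    closures of the images of C_c(G, A_+) under [q] and [lift].

    All of this rests on a theory of vector-valued integrals of compactly
    supported continuous functions. These integrals are limits of Riemann sums
    along fine Borel partitions of the support ([integral_cvg]); linearity,
    positivity, left invariance and Fubini's theorem ([fubini]) are read off
    the sums. The last two are what makes the convolution associative and the
    integrated forms multiplicative, by one and the same computation
    ([integral_conv_action]); hence the seminorm of the class is an algebra
    seminorm ([is_seminormed_algebra_Cc]) and the crossed product is the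
    completion it is meant to be. *)

Set Implicit Arguments.
Unset Strict Implicit.
Unset Printing Implicit Defensive.

Import Order.TTheory GRing.Theory Num.Theory.
Import numFieldNormedType.Exports.

Local Open Scope classical_set_scope.
Local Open Scope ring_scope.

(** * Continuity and locally compact groups *)

Lemma continuous_pair_comp (S T U V : topologicalType) (h : S * T -> V)
  (f : U -> S) (g : U -> T) : continuous h -> continuous f -> continuous g ->
  continuous (fun u => h (f u, g u)).
Proof.
move=> ch cf cg u; apply: (@continuous_comp _ _ _ (fun u => (f u, g u)) h).
  by apply: cvg_pair; [exact: cf|exact: cg].
exact: ch.
Qed.

Lemma continuous_slice (S T V : topologicalType) (h : S -> T -> V) (s : S) :
  continuous (fun p : S * T => h p.1 p.2) -> continuous (h s).
Proof.
move=> ch; apply: (@continuous_pair_comp _ _ _ _ (fun p => h p.1 p.2)) => //.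
  by move=> t; exact: cvg_cst.
by move=> t; exact: cvg_id.
Qed.

Lemma continuous_fst (S T : topologicalType) : continuous (fst : S * T -> S).
Proof. by move=> p; exact: cvg_fst. Qed.

Lemma continuous_snd (S T : topologicalType) : continuous (snd : S * T -> T).
Proof. by move=> p; exact: cvg_snd. Qed.

Lemma continuous_comp_fun (S T U : topologicalType) (f : S -> T) (g : T -> U) :
  continuous f -> continuous g -> continuous (fun x => g (f x)).
Proof. by move=> cf cg x; apply: continuous_comp; [exact: cf|exact: cg]. Qed.

Section TopologicalGroup.
Context (G : lcGroupType).

Lemma compact_nbhs (s : G) : exists C : set G, nbhs s C /\ compact C.
Proof.
have [C] := @lcgroup_locally_compact G s I.
move=> nC [cC _]; exists C; split=> //.
by move: nC; rewrite /within/=; apply: filterS => t; apply.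
Qed.

Lemma continuous_mulgl (s : G) : continuous (fun t : G => (s * t)%g).
Proof. exact: continuous_slice (@mulg_continuous G). Qed.

Lemma translateE (s : G) (S : set G) : [set (s * t)%g | t in S] = [set t | S (s^-1 * t)%g].
Proof.
apply/seteqP; split=> t /=; first by move=> [r Sr <-]; rewrite mulKg.
by move=> St; exists (s^-1 * t)%g => //; rewrite mulVKg.
Qed.

Lemma open_translate (s : G) (S : set G) : open S -> open [set (s * t)%g | t in S].
Proof.
by rewrite translateE => oS; move/continuousP: (@continuous_mulgl s^-1%g); apply.
Qed.

Lemma continuous_mulVg : continuous (fun p : G * G => (p.1^-1 * p.2)%g).
Proof.
apply: (continuous_pair_comp (h := fun p : G * G => (p.1 * p.2)%g)).
- exact: mulg_continuous.
- by move=> p; apply: continuous_comp; [exact: cvg_fst|exact: invg_continuous].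
- by move=> p; exact: cvg_snd.
Qed.

(** Supports of convolutions and translates lie in such products. *)
Definition setM (K L : set G) := [set (p.1 * p.2)%g | p in K `*` L].

Lemma compact_setM K L : compact K -> compact L -> compact (setM K L).
Proof.
move=> cK cL; apply: continuous_compact; last exact: compact_setX.
by apply: continuous_subspaceT; exact: mulg_continuous.
Qed.

Lemma setM_mem K L r s : K r -> L (r^-1 * s)%g -> setM K L s.
Proof. by move=> Kr Ls; exists (r, (r^-1 * s)%g) => //=; rewrite mulVKg. Qed.

End TopologicalGroup.

(** * Linear and bounded operators *)

Section LinearFunctions.
Context (R : realType) (X Y : lmodType R) (T : X -> Y).
Hypothesis lT : linear T.

Lemma lin0 : T 0 = 0.
Proof. by have := lT (-1) 0 0; rewrite scaler0 addr0 scaleN1r addNr. Qed.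

Lemma linD x y : T (x + y) = T x + T y.
Proof. by have := lT 1 x y; rewrite !scale1r. Qed.

Lemma linZ l x : T (l *: x) = l *: T x.
Proof. by have := lT l x 0; rewrite !addr0 lin0 addr0. Qed.

Lemma linB x y : T (x - y) = T x - T y.
Proof. by rewrite linD -scaleN1r linZ scaleN1r. Qed.

Lemma lin_sum I (r : seq I) (P : pred I) (F : I -> X) :
  T (\sum_(i <- r | P i) F i) = \sum_(i <- r | P i) T (F i).
Proof. exact: (big_morph T linD lin0). Qed.

End LinearFunctions.

Lemma bounded_operator_continuous (R : realType) (X Y : normedModType R)
  (T : X -> Y) : bounded_operator T -> continuous T.
Proof.
move=> [lT [M hM]] x; apply/cvgrPdist_le => e e0.
have M1 : 0 < `|M| + 1 by rewrite ltr_wpDl.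
have /cvgrPdist_le/(_ _ (divr_gt0 e0 M1)) : y @[y --> x] --> x by exact: cvg_id.
apply: filterS => y xy; rewrite -(linB lT); apply: le_trans (hM _) _.
apply: le_trans (_ : (`|M| + 1) * `|x - y| <= e).
  by rewrite ler_wpM2r// (le_trans (ler_norm M))// lerDl.
by rewrite mulrC -ler_pdivlMr.
Qed.

Lemma bounded_operator_scale (R : realType) (V : normedModType R) (l : R) :
  bounded_operator (fun x : V => l *: x).
Proof.
split; last by exists `|l| => x; rewrite normrZ.
by move=> k x y; rewrite scalerDr !scalerA mulrC.
Qed.

(** Used whenever two integrals are both within [e] times a fixed measure of the
    same Riemann sum. *)
Lemma eq_dist_le (R : realType) (X : normedModType R) (x y : X) (c : R) :
  0 <= c -> (forall e, 0 < e -> `|x - y| <= e * c) -> x = y.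
Proof.
move=> c0 xy; apply/eqP; rewrite -subr_eq0 -normr_le0; apply/ler_addgt0Pr => e e0.
have c1 : 0 < c + 1 by rewrite ltr_wpDl.
rewrite add0r; apply: le_trans (xy _ (divr_gt0 e0 c1)) _.
by rewrite mulrAC ler_pdivrMr// ler_pM2l// lerDl.
Qed.

Section OperatorNorm.
Context (R : realType) (X Y : normedModType R).
Implicit Types T : X -> Y.

Lemma opnorm_le T (M : R) : 0 <= M -> (forall x, `|T x| <= M * `|x|) ->
  opnorm T <= M.
Proof.
move=> M0 TM; apply: ge_sup; first by exists `|T 0|; exists 0 => //=; rewrite normr0.
move=> _ [x /= x1 <-]; apply: le_trans (TM x) _.
by rewrite -[leRHS]mulr1 ler_wpM2l.
Qed.

Lemma le_opnorm T x : bounded_operator T -> `|T x| <= opnorm T * `|x|.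
Proof.
move=> [lT [M TM]]; have [->|x0] := eqVneq x 0.
  by rewrite (lin0 lT) !normr0 mulr0.
have nx : 0 < `|x| by rewrite normr_gt0.
rewrite -ler_pdivrMr//.
have -> : `|T x| / `|x| = `|T (`|x|^-1 *: x)|.
  by rewrite (linZ lT) normrZ gtr0_norm ?invr_gt0// mulrC.
apply: ub_le_sup; last first.
  by exists (`|x|^-1 *: x) => //=; rewrite normrZ gtr0_norm ?invr_gt0// mulVf// gt_eqF.
exists `|M| => _ [y /= y1 <-]; apply: le_trans (TM y) _.
apply: (@le_trans _ _ (`|M| * `|y|)); first by rewrite ler_wpM2r// ler_norm.
by rewrite -[leRHS]mulr1 ler_wpM2l.
Qed.

Lemma opnorm_ge0 T : bounded_operator T -> 0 <= opnorm T.
Proof.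
move=> bT; have [x0|] := pselect (exists x : X, x != 0).
  have [x xn0] := x0; have := le_opnorm x bT => /(le_trans (normr_ge0 _)).
  by rewrite pmulr_lge0// normr_gt0.
move=> /forallNP X0; rewrite /opnorm (_ : [set _ | _ in _] = [set 0]) ?sup1//.
have T0 x : T x = 0.
  by have /negP := X0 x; rewrite negbK => /eqP->; rewrite (lin0 bT.1).
apply/seteqP; split=> y /= [].
  by move=> x _ <-; rewrite T0 normr0.
by exists 0; rewrite ?normr0// T0 normr0.
Qed.

End OperatorNorm.

Lemma bounded_operator_bound (R : realType) (X Y : normedModType R) (T : X -> Y) :
  bounded_operator T -> exists2 M, 0 <= M & forall x, `|T x| <= M * `|x|.
Proof.
move=> bT; exists (opnorm T); first exact: opnorm_ge0.
by move=> x; exact: le_opnorm.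
Qed.

Lemma bounded_operator_comp (R : realType) (X Y Z : normedModType R)
  (S : Y -> Z) (T : X -> Y) :
  bounded_operator S -> bounded_operator T -> bounded_operator (S \o T).
Proof.
move=> bS bT; split; first by move=> l x y; rewrite /= bT.1 bS.1.
have [M M0 SM] := bounded_operator_bound bS.
have [N N0 TN] := bounded_operator_bound bT.
exists (M * N) => x /=; apply: le_trans (SM _) _.
by rewrite -mulrA ler_wpM2l.
Qed.

Lemma bounded_operator_lin (R : realType) (X Y : normedModType R) (l : R) (S T : X -> Y) :
  bounded_operator S -> bounded_operator T ->
  bounded_operator (fun x => l *: S x + T x).
Proof.
move=> bS bT; split.
  move=> k x y; rewrite bS.1 bT.1.
  by rewrite scalerDr scalerDr !scalerA (mulrC l) addrACA.
have [M M0 SM] := bounded_operator_bound bS.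
have [N N0 TN] := bounded_operator_bound bT.
exists (`|l| * M + N) => x; apply: le_trans (ler_normD _ _) _.
by rewrite mulrDl normrZ -mulrA; apply: lerD => //; rewrite ler_wpM2l.
Qed.

Lemma continuous_linear_bounded_operator (R : realType) (X Y : normedModType R)
  (T : X -> Y) : linear T -> continuous T -> bounded_operator T.
Proof.
move=> lT cT; split=> //; have := cT 0; rewrite /continuous_at (lin0 lT) => cT0.
have /nbhs_ballP[d /= d0 dT] : \forall x \near (0 : X), `|T x| < 1.
  by move/cvgr0Pnorm_lt: cT0; apply.
exists (2 / d) => x; have [->|x0] := eqVneq x 0.
  by rewrite (lin0 lT) !normr0 mulr0.
have nx : 0 < `|x| by rewrite normr_gt0.
pose c := d / (2 * `|x|); have c0 : 0 < c by rewrite divr_gt0// mulr_gt0.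
have : `|T (c *: x)| < 1.
  apply: dT; rewrite -ball_normE/= sub0r normrN normrZ (gtr0_norm c0) /c.
  by rewrite invfM mulrA divfK ?gt_eqF// ltr_pdivrMr// ltr_pMr// ltr1n.
rewrite (linZ lT) normrZ (gtr0_norm c0) -ltr_pdivlMl// => /ltW/le_trans; apply.
by rewrite mulr1 /c invf_div mulrAC.
Qed.

Section Bilinear.
Context (R : realType) (X Y Z : normedModType R) (B : X -> Y -> Z) (C : R).
Hypothesis lBl : forall y, linear (B^~ y).
Hypothesis lBr : forall x, linear (B x).
Hypothesis BC : forall x y, `|B x y| <= C * `|x| * `|y|.

(** Around [(x0, y0)], [B x y] is a sum of [B (x - x0) (y - y0)], which is small
    by the norm bound, and of two terms that are linear in one variable. *)
Lemma continuous_bilinear : continuous (fun p : X * Y => B p.1 p.2).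
Proof.
have BC' x y : `|B x y| <= `|C| * `|x| * `|y|.
  by apply: le_trans (BC x y) _; rewrite -!mulrA ler_wpM2r ?mulr_ge0// ler_norm.
have BB x x' y : B (x - x') y = B x y - B x' y by exact: (linB (lBl y)).
move=> [x0 y0]; rewrite /continuous_at/=.
have -> : (fun p : X * Y => B p.1 p.2) = fun p =>
    B (p.1 - x0) (p.2 - y0) + (B (p.1 - x0) y0 + B x0 p.2).
  apply/funext => -[x y] /=; rewrite (linB (lBr _)).
  by rewrite !BB addrA subrK subrK.
have c1 : (p.1 - x0) @[p --> nbhs (x0, y0)] --> (0 : X).
  by rewrite -(subrr x0); apply: cvgB; [exact: cvg_fst|exact: cvg_cst].
have c2 : (p.2 - y0) @[p --> nbhs (x0, y0)] --> (0 : Y).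
  by rewrite -(subrr y0); apply: cvgB; [exact: cvg_snd|exact: cvg_cst].
rewrite -[X in _ --> X]add0r; apply: cvgD.
  apply/cvgr0Pnorm_le => e e0.
  have n1 := cvg_norm c1; have n2 := cvg_norm c2.
  have : `|C| * `|(p : X * Y).1 - x0| * `|p.2 - y0| @[p --> nbhs (x0, y0)] --> `|C| * `|0 : X| * `|0 : Y|.
    by apply: cvgM; [apply: cvgM; [exact: cvg_cst|exact: n1]|exact: n2].
  rewrite !normr0 mulr0 => /cvgr0Pnorm_le/(_ _ e0); apply: filterS => p.
  by rewrite ger0_norm ?mulr_ge0//; apply: le_trans; exact: BC'.
rewrite -[X in _ --> X]add0r; apply: cvgD.
  have : continuous (B^~ y0).
    apply: bounded_operator_continuous; split=> //; exists (C * `|y0|) => x.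
    by rewrite mulrAC.
  move=> /(_ 0); rewrite /continuous_at (lin0 (lBl _)) => h.
  exact: (@cvg_comp _ _ _ (fun p : X * Y => p.1 - x0) (B^~ y0) _ _ _ c1 h).
have : continuous (B x0) by apply: bounded_operator_continuous; split=> //; exists (C * `|x0|).
move=> /(_ y0) h.
exact: (@cvg_comp _ _ _ (fun p : X * Y => p.2) (B x0) _ _ _ cvg_snd h).
Qed.

End Bilinear.

Section StrongContinuity.
Context (R : realType) (G : topologicalType) (X : completeNormedModType R).
Variable U : G -> X -> X.
Hypothesis bU : forall s, bounded_operator (U s).
Hypothesis cU : forall x, continuous (fun s => U s x).

Lemma compact_norm_bounded (Y : normedModType R) (F : G -> Y) (K : set G) :
  compact K -> continuous F -> exists2 M, 0 <= M & forall t, K t -> `|F t| <= M.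
Proof.
move=> cK cF; have : compact (F @` K).
  by apply: continuous_compact => //; exact: continuous_subspaceT.
move=> /compact_bounded[M [_ /(_ (`|M| + 1))]].
rewrite (le_lt_trans (ler_norm M)) ?ltrDl// => /(_ isT) FM.
by exists (`|M| + 1); [rewrite addr_ge0|move=> t Kt; apply: FM; exists t].
Qed.

(** By the uniform boundedness principle: orbits of points are bounded on
    compact sets, because they are continuous. *)
Lemma locally_bounded (K : set G) : compact K ->
  exists2 M, 0 <= M & forall s x, K s -> `|U s x| <= M * `|x|.
Proof.
move=> cK; have := @Banach_Steinhauss R X X [set U s | s in K].
move=> /(_ _ _ 1) [||M hM].
- move=> _ [s _ <-]; split; last by have [] := bU s.
  move=> r; have [M M0 UM] := bounded_operator_bound (bU s).
  by exists (M * r) => x xr; apply: le_trans (UM x) _; rewrite ler_wpM2l.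
- move=> x; have [M _ UM] := compact_norm_bounded cK (@cU x).
  by exists M => _ [s Ks <-]; exact: UM.
exists `|M| => // s x Ks; have [->|x0] := eqVneq x 0.
  by rewrite (lin0 (bU s).1) !normr0 mulr0.
have nx : 0 < `|x| by rewrite normr_gt0.
have := hM (U s) (ex_intro2 _ _ s Ks erefl) (`|x|^-1 *: x).
rewrite normrZ gtr0_norm ?invr_gt0// mulVf ?gt_eqF// (linZ (bU s).1) normrZ.
rewrite gtr0_norm ?invr_gt0// mulrC ler_pdivrMr// => /(_ (lexx _)) /le_trans; apply.
by rewrite ler_wpM2r// ler_norm.
Qed.

(** Joint continuity needs the local bound on the norms, hence local compactness
    of [G] and completeness of [X]. *)
Lemma strongly_continuous_joint :
  (forall s : G, exists C, nbhs s C /\ compact C) ->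
  continuous (fun p : G * X => U p.1 p.2).
Proof.
move=> lcG [s0 x0]; apply/cvgrPdist_le => e e0.
have [C [nC cC]] := lcG s0; have [M M0 UM] := locally_bounded cC.
have e2 : 0 < e / 2 by rewrite divr_gt0.
have M1 : 0 < M + 1 by rewrite ltr_wpDl.
have n1 : \forall s \near s0, C s /\ `|U s0 x0 - U s x0| <= e / 2.
  apply: filterI => //; exact: (iffLR (cvgrPdist_le _ _) (@cU x0 s0)).
have n2 : \forall x \near x0, `|x0 - x| <= e / 2 / (M + 1).
  have /cvgrPdist_le := @cvg_id _ (nbhs x0); apply; exact: divr_gt0.
exists ([set s | C s /\ `|U s0 x0 - U s x0| <= e / 2],
  [set x | `|x0 - x| <= e / 2 / (M + 1)]) => // -[s x] /= [[Cs sx0] x0x].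
rewrite (splitr e) -(subrK (U s x0) (U s0 x0)) -addrA.
apply: le_trans (ler_normD _ _) _; apply: lerD => //.
rewrite -(linB (bU s).1); apply: le_trans (UM _ _ Cs) _.
apply: (@le_trans _ _ ((M + 1) * `|x0 - x|)).
  by rewrite ler_wpM2r// lerDl.
by rewrite mulrC -ler_pdivlMr.
Qed.

End StrongContinuity.

Lemma linear_span_sub (R : realType) (V : lmodType R) (S P : set V) : P 0 ->
  (forall l x y, P x -> P y -> P (l *: x + y)) -> S `<=` P ->
  linear_span S `<=` P.
Proof.
move=> P0 PD SP _ [n [c [v [hv ->]]]]; apply: big_rec => // i x _ Px.
by apply: PD => //; apply: SP; exact: hv.
Qed.

(** The points where [S] and [T] agree form a closed subspace. *)
Lemma nondegenerate_eq (R : realType) (A : pBanachAlgType R) (X : pBanachType R)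
  (Y : normedModType R) (pi : A -> X -> X) (S T : X -> Y) :
  nondegenerate_representation pi -> bounded_operator S -> bounded_operator T ->
  (forall a x, S (pi a x) = T (pi a x)) -> forall x, S x = T x.
Proof.
move=> nd bS bT ST x; apply/eqP; rewrite -subr_eq0; apply/eqP.
pose D z := S z - T z.
have cD : continuous D.
  by move=> z; apply: cvgB; apply: bounded_operator_continuous.
have Dcl : closed (D @^-1` [set 0]).
  move/continuous_closedP: cD; apply; apply: compact_closed.
    exact: norm_hausdorff.
  exact: compact_set1.
have Dspan : linear_span [set y | exists a x, y = pi a x] `<=` D @^-1` [set 0].
  apply: linear_span_sub.
  - by rewrite /= /D (lin0 bS.1) (lin0 bT.1) subrr.
  - move=> l y z; rewrite /= /D bS.1 bT.1 => Dy Dz.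
    by rewrite opprD addrACA Dz addr0 -scalerBr Dy scaler0.
  - by move=> _ [a [y ->]]; rewrite /= /D ST subrr.
have xcl : closure (linear_span [set y | exists a x, y = pi a x]) x by rewrite nd.
by have := closureS Dspan xcl; move: (Dcl x); apply.
Qed.

(** * Uniqueness of the Bochner integral *)

Section BochnerUniqueness.
Context d (T : measurableType d) (R : realType).
Context (mu : {measure set T -> \bar R}) (X : normedModType R).
Implicit Types (F : T -> X) (l : seq (set T * X)).

(** Measurability of all the distances to fixed vectors: a property that
    continuous functions have and that subtracting a step function preserves. *)
Definition dist_measurable F :=
  forall c : X, measurable_fun setT (fun t => `|F t - c|).

Definition integrable_steps l :=
  forall q, q \in l -> measurable q.1 /\ (mu q.1 < +oo)%E.

Lemma integrable_steps_cons q l : integrable_steps (q :: l) ->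
  [/\ measurable q.1, (mu q.1 < +oo)%E & integrable_steps l].
Proof.
move=> h; have [] := h q (mem_head _ _); split=> // p pl.
by apply: h; rewrite inE pl orbT.
Qed.

Lemma step_fun_cons q l t :
  step_fun (q :: l) t = \1_(q.1) t *: q.2 + step_fun l t.
Proof. by rewrite /step_fun big_cons. Qed.

Lemma dist_measurable_subr_indic F (B : set T) (x : X) : measurable B ->
  dist_measurable F -> dist_measurable (fun t => F t - \1_B t *: x).
Proof.
move=> mB mF c; have -> : (fun t => `|F t - \1_B t *: x - c|) =
    (fun t => if t \in B then `|F t - (x + c)| else `|F t - c|).
  apply/funext => t; rewrite indicE.
  by case: ifP => _; rewrite ?scale1r ?scale0r ?subr0// opprD addrA.
apply: measurable_fun_ifT; [|exact: mF|exact: mF].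
by apply: (measurable_fun_bool true); rewrite setTI (_ : _ @^-1` _ = B)//;
  apply/seteqP; split=> t /= => [/set_mem|/mem_set].
Qed.

Lemma dist_measurable_subr_step F l : integrable_steps l ->
  dist_measurable F -> dist_measurable (fun t => F t - step_fun l t).
Proof.
elim: l F => [F _ mF|q l ih F /integrable_steps_cons[mq _ hl] mF].
  by rewrite (_ : (fun _ => _) = F)//; apply/funext => t;
    rewrite /step_fun big_nil subr0.
rewrite (_ : (fun _ => _) = fun t => F t - \1_(q.1) t *: q.2 - step_fun l t).
  exact: (ih _ hl (dist_measurable_subr_indic _ mq mF)).
by apply/funext => t; rewrite step_fun_cons opprD addrA.
Qed.

Lemma measurable_norm_subr_step F l : integrable_steps l ->
  dist_measurable F ->
  measurable_fun setT (fun t => (`|F t - step_fun l t|)%:E).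
Proof.
move=> hl mF; apply/measurable_EFinP.
rewrite (_ : (fun _ => _) = fun t => `|F t - step_fun l t - 0|).
  exact: dist_measurable_subr_step.
by apply/funext => t; rewrite subr0.
Qed.

Lemma measurable_norm_step l (c : X) : integrable_steps l ->
  measurable_fun setT (fun t => (`|c - step_fun l t|)%:E).
Proof. by move=> hl; apply: measurable_norm_subr_step. Qed.

Lemma measurable_norm_step0 l : integrable_steps l ->
  measurable_fun setT (fun t => (`|step_fun l t|)%:E).
Proof.
move=> hl; have := measurable_norm_step 0 hl.
by under eq_fun do rewrite sub0r normrN.
Qed.

(** Splitting off one set of the list at a time, with the constant [c]
    collecting the vectors met so far, avoids making the sets disjoint. *)
Lemma norm_sum_measure_le_integral l (B : set T) (c : X) : measurable B ->
  (mu B < +oo)%E -> integrable_steps l ->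
  ((`|fine (mu B) *: c - \sum_(q <- l) fine (mu (B `&` q.1)) *: q.2|)%:E <=
    \int[mu]_(t in B) (`|c - step_fun l t|)%:E)%E.
Proof.
elim: l B c => [B c mB fB _|q l ih B c mB fB /integrable_steps_cons[mq fq hl]].
  rewrite big_nil subr0 (_ : (fun _ => _) = cst (`|c|)%:E); last first.
    by apply/funext => t; rewrite /step_fun big_nil subr0.
  rewrite (@integral_cst _ _ _ mu B mB (`|c|)%:E) normrZ ger0_norm ?fine_ge0//.
  by rewrite EFinM fineK ?ge0_fin_numE// muleC.
have mBI : measurable (B `&` q.1) by exact: measurableI.
have mBD : measurable (B `\` q.1) by exact: measurableD.
have fin S : measurable S -> S `<=` B -> mu S \is a fin_num.
  move=> mS SB; rewrite ge0_fin_numE//; apply: le_lt_trans fB.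
  by apply: le_measure; rewrite ?inE.
have fBI : mu (B `&` q.1) \is a fin_num by apply: fin => // t [].
have fBD : mu (B `\` q.1) \is a fin_num by apply: fin => // t [].
have split S : measurable S -> S `<=` B ->
    fine (mu S) = fine (mu ((B `&` q.1) `&` S)) + fine (mu ((B `\` q.1) `&` S)).
  move=> mS SB; rewrite -fineD; last 2 first.
    by apply: fin => [|t [[]]//]; exact: measurableI.
    by apply: fin => [|t [[]]//]; exact: measurableI.
  rewrite -measureU; [|exact: measurableI|exact: measurableI|].
    by rewrite -setIUl setUIDK setIidr.
  by apply/seteqP; split=> t //= -[[[_ ?] _] [[_ ?] _]].
have -> : fine (mu B) *: c - \sum_(p <- q :: l) fine (mu (B `&` p.1)) *: p.2 =
    (fine (mu (B `&` q.1)) *: (c - q.2) -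
       \sum_(p <- l) fine (mu ((B `&` q.1) `&` p.1)) *: p.2) +
    (fine (mu (B `\` q.1)) *: c -
       \sum_(p <- l) fine (mu ((B `\` q.1) `&` p.1)) *: p.2).
  rewrite big_cons [in LHS](split B)// (setIidl _); last by move=> t [].
  rewrite (setIidl (_ : B `\` q.1 `<=` B)); last by move=> t [].
  under eq_big_seq => p pl.
    rewrite (split (B `&` p.1)); [|by apply: measurableI => //; have [] := hl p pl|by move=> t []].
    rewrite !setIA (setIidl (_ : B `&` q.1 `<=` B)); last by move=> t [].
    rewrite (setIidl (_ : B `\` q.1 `<=` B)); last by move=> t [].
    rewrite scalerDl; over.
  rewrite big_split/= scalerBr scalerDl 2!opprD [RHS]addrACA [LHS]addrA; congr (_ + _).
  by rewrite addrAC.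
have -> : (\int[mu]_(t in B) (`|c - step_fun (q :: l) t|)%:E =
  \int[mu]_(t in B `&` q.1) (`|c - q.2 - step_fun l t|)%:E +
  \int[mu]_(t in B `\` q.1) (`|c - step_fun l t|)%:E)%E.
  rewrite -{1}(setUIDK B q.1) ge0_integral_setU//.
  - congr (_ + _)%E; apply: eq_integral => t; rewrite inE => -[_ qt].
      by rewrite step_fun_cons indicE mem_set// scale1r opprD addrA.
    by rewrite step_fun_cons indicE memNset// scale0r add0r.
  - apply: measurable_funTS; apply: measurable_norm_step => p.
    by rewrite inE => /orP[/eqP->|/hl].
  - by apply/disj_setPS => t [[_ ?] []].
apply: (@le_trans _ _ (_ + _)%E); last first.
  by apply: leeD; apply: ih => //; rewrite -ge0_fin_numE.
by rewrite -EFinD lee_fin; exact: ler_normD.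
Qed.

Lemma integrable_steps_bounded l : integrable_steps l ->
  exists B : set T, [/\ measurable B, (mu B < +oo)%E &
    forall q, q \in l -> q.1 `<=` B].
Proof.
elim: l => [_|q l ih /integrable_steps_cons[mq fq /ih[B [mB fB lB]]]].
  by exists set0; split=> //; rewrite measure0.
exists (q.1 `|` B); split.
- exact: measurableU.
- apply: le_lt_trans (lte_add_pinfty fq fB).
  exact: measureU2.
- move=> p; rewrite inE => /orP[/eqP->|/lB pB]; first exact: subsetUl.
  by apply: subset_trans pB _; exact: subsetUr.
Qed.

Lemma norm_step_integral_le l : integrable_steps l ->
  ((`|step_integral mu l|)%:E <= \int[mu]_t (`|step_fun l t|)%:E)%E.
Proof.
move=> hl; have [B [mB fB lB]] := integrable_steps_bounded hl.
have := norm_sum_measure_le_integral 0 mB fB hl.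
rewrite scaler0 sub0r normrN.
under eq_big_seq => q ql do rewrite (setIidr (lB q ql)).
move=> /le_trans; apply.
have -> : (\int[mu]_(t in B) (`|0 - step_fun l t|)%:E =
    \int[mu]_(t in B) (`|step_fun l t|)%:E)%E.
  by apply: eq_integral => t _; rewrite sub0r normrN.
apply: ge0_subset_integral => //.
exact: measurable_norm_step0.
Qed.

Definition opp_steps l := [seq (q.1, - q.2) | q <- l].

Lemma integrable_steps_sub l l' : integrable_steps l -> integrable_steps l' ->
  integrable_steps (l ++ opp_steps l').
Proof.
move=> hl hl' q; rewrite mem_cat => /orP[/hl//|/mapP[p /hl' ? ->]//].
Qed.

Lemma step_integral_sub l l' : step_integral mu (l ++ opp_steps l') =
  step_integral mu l - step_integral mu l'.
Proof.
rewrite /step_integral big_cat big_map -sumrN; congr (_ + _).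
by apply: eq_bigr => q _; rewrite scalerN.
Qed.

Lemma step_fun_sub l l' t :
  step_fun (l ++ opp_steps l') t = step_fun l t - step_fun l' t.
Proof.
rewrite /step_fun big_cat big_map -sumrN; congr (_ + _).
by apply: eq_bigr => q _; rewrite scalerN.
Qed.

(** The difference of the two integrals is the integral of a step function whose
    norm is at most the sum of the two integrands on the right. *)
Lemma dist_step_integral_le F l l' : dist_measurable F ->
  integrable_steps l -> integrable_steps l' ->
  ((`|step_integral mu l - step_integral mu l'|)%:E <=
    \int[mu]_t (`|F t - step_fun l t|)%:E +
    \int[mu]_t (`|F t - step_fun l' t|)%:E)%E.
Proof.
move=> mF hl hl'; rewrite -step_integral_sub.
apply: le_trans (norm_step_integral_le (integrable_steps_sub hl hl')) _.
have ml := measurable_norm_subr_step hl mF.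
have ml' := measurable_norm_subr_step hl' mF.
rewrite -ge0_integralD//.
apply: ge0_le_integral => //.
- by apply: measurable_norm_step0; exact: integrable_steps_sub.
- exact: emeasurable_funD.
- move=> t _; rewrite -EFinD lee_fin step_fun_sub.
  rewrite (_ : _ - _ = (step_fun l t - F t) + (F t - step_fun l' t)).
    by rewrite (distrC (F t) (step_fun l t)); exact: ler_normD.
  by rewrite addrA subrK.
Qed.

Lemma near_lt_of_cvge0 (f : nat -> \bar R) (e : R) : 0 < e ->
  (f n @[n --> \oo] --> 0)%E -> \forall n \near \oo, (f n < e%:E)%E.
Proof.
move=> e0 f0; apply: (f0 [set y | (y < e%:E)%E]); apply: open_nbhs_nbhs.
by split; [exact: open_ereal_lt_ereal|rewrite /= lte_fin].
Qed.

(** Every step function, not only those of an approximating sequence, controls the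
    integral; both the uniqueness of the integral and the error of Riemann sums
    follow. *)
Lemma is_integral_dist_le F y l : dist_measurable F -> is_integral mu F y ->
  integrable_steps l ->
  ((`|y - step_integral mu l|)%:E <= \int[mu]_t (`|F t - step_fun l t|)%:E)%E.
Proof.
move=> mF [l' [hl' il' cl' cy]] hl.
apply/lee_addgt0Pr => e e0.
have e2 : 0 < e / 2 by rewrite divr_gt0.
have /cvgrPdist_lt/(_ _ e2) near_y := cy.
have near_0 : \forall n \near \oo,
    (\int[mu]_t (`|F t - step_fun (l' n) t|)%:E < (e / 2)%:E)%E.
  exact: near_lt_of_cvge0.
have [n [ny n0]] := filter_ex (filterI near_y near_0).
rewrite -(subrK (step_integral mu (l' n)) y) -addrA.
apply: (@le_trans _ _ ((`|y - step_integral mu (l' n)|)%:E +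
    (`|step_integral mu (l' n) - step_integral mu l|)%:E)%E).
  by rewrite -EFinD lee_fin; exact: ler_normD.
rewrite [in leRHS](splitr e) EFinD addeA [leRHS]addeC; apply: leeD.
  by rewrite lee_fin ltW.
apply: le_trans (dist_step_integral_le mF (hl' n) hl) _.
by rewrite addeC; apply: leeD => //; exact: ltW.
Qed.

Lemma is_integral_unique F y y' : dist_measurable F ->
  is_integral mu F y -> is_integral mu F y' -> y = y'.
Proof.
move=> mF hy [l [hl _ cl cy']]; apply/eqP; rewrite -subr_eq0 -normr_le0.
rewrite -lee_fin; apply/lee_addgt0Pr => e e0; rewrite add0e.
have e2 : 0 < e / 2 by rewrite divr_gt0.
have /cvgrPdist_lt/(_ _ e2) near_y := cy'.
have near_0 : \forall n \near \oo,
    (\int[mu]_t (`|F t - step_fun (l n) t|)%:E < (e / 2)%:E)%E.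
  exact: near_lt_of_cvge0.
have [n [ny n0]] := filter_ex (filterI near_y near_0).
rewrite lee_fin -(subrK (step_integral mu (l n)) y) -addrA (splitr e).
apply: le_trans (ler_normD _ _) _; apply: lerD; last by rewrite distrC ltW.
by rewrite -lee_fin; apply: le_trans (is_integral_dist_le mF hy (hl n)) (ltW n0).
Qed.

Lemma integral_ofE F y : dist_measurable F -> is_integral mu F y ->
  integral_of mu F = y.
Proof.
move=> mF hy; apply: (is_integral_unique mF _ hy).
by rewrite /integral_of; apply: xgetPex; exists y.
Qed.

End BochnerUniqueness.

(** * Riemann sums over partitions of a compact set *)

Section RiemannSums.
Context (R : realType) (G : lcGroupType) (mu : {measure set (borel G) -> \bar R}).
Hypothesis haar_mu : left_haar mu.
Implicit Types (K S : set G) (P : seq (set G * G)) (D : G -> set G).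

Lemma measurable_open (U : set G) : open U -> measurable (U : set (borel G)).
Proof. exact: sub_sigma_algebra. Qed.

Lemma measurable_compact K : compact K -> measurable (K : set (borel G)).
Proof.
move=> /(compact_closed (@lcgroup_hausdorff G)) cK.
rewrite -[K]setCK; apply: measurableC; apply: measurable_open.
exact: closed_openC.
Qed.

Lemma measurable_continuous (h : G -> R) : continuous h ->
  measurable_fun setT (h : borel G -> R).
Proof.
move=> /continuousP ch; apply: (measurability _ (RGenOpens.measurableE R)).
move=> _ [_ [a [b ->]] <-]; rewrite setTI; apply: measurable_open.
by apply: ch; exact: interval_open.
Qed.

Lemma dist_measurable_continuous (X : normedModType R) (F : G -> X) :
  continuous F -> dist_measurable (F : borel G -> X).
Proof.
move=> cF c; apply: measurable_continuous => t.
by apply: cvg_norm; apply: cvgB; [exact: cF|exact: cvg_cst].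
Qed.

(** A partition of [K] into Borel sets is encoded by its indicators summing
    to that of [K]; empty pieces may occur. *)
Record tagged_partition K P : Prop := {
  partition_measurable : forall q, q \in P -> measurable (q.1 : set (borel G));
  partition_sub : forall q, q \in P -> q.1 `<=` K;
  partition_sum : forall t, \sum_(q <- P) \1_(q.1) t = \1_K t :> R
}.

Definition fine_partition K D P :=
  forall q, q \in P -> K q.2 /\ q.1 `<=` D q.2.

(** Intersect with the sets of the cover one after another, removing what has
    already been covered. *)
Lemma tagged_partition_cover K D (s : seq G) S :
  measurable (S : set (borel G)) -> (forall u, u \in s -> K u) ->
  S `<=` [set t | exists2 u, u \in s & (D u)^° t] ->
  exists P, tagged_partition S P /\ fine_partition K D P.
Proof.
elim: s S => [S _ _ S0|u s ih S mS sK SD].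
  exists [::]; split=> //; split=> // t; rewrite big_nil indicE memNset//.
  by move=> St; have [u] := S0 t St; rewrite in_nil.
have mD : measurable ((D u)^° : set (borel G)).
  by apply: measurable_open; exact: open_interior.
have [||t [St nDt]|P [[mP PS sumP] fP]] := ih (S `\` (D u)^°).
- exact: measurableD.
- by move=> v vs; apply: sK; rewrite inE vs orbT.
- have [v] := SD _ St; rewrite inE => /orP[/eqP->//|vs Dv].
  by exists v.
exists ((S `&` (D u)^°, u) :: P); split; first split.
- by move=> q; rewrite inE => /orP[/eqP->|/mP//]; exact: measurableI.
- by move=> q; rewrite inE => /orP[/eqP->|/PS qS t /qS[]//] t [].
- move=> t; rewrite big_cons sumP/= !indicE in_setI in_setD.
  by case: (t \in S); case: (t \in ((D u)^° : set G)); rewrite /= ?addr0 ?add0r.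
- move=> q; rewrite inE => /orP[/eqP->|/fP//]; split=> /=.
    by apply: sK; rewrite mem_head.
  by move=> t [_]; exact: interior_subset.
Qed.

Lemma exists_fine_partition K D : compact K ->
  (forall t, K t -> nbhs t (D t)) ->
  exists P, tagged_partition K P /\ fine_partition K D P.
Proof.
move=> cK KD; have := cK; rewrite compact_cover.
move=> /(_ G K (fun t => (D t)^°)) [|t Kt|s sK Ks].
- by move=> t _; exact: open_interior.
- by exists t => //; exact: KD.
apply: (@tagged_partition_cover K D (finmap.enum_fset s) K).
- exact: measurable_compact.
- by move=> u us; have := sK u us; rewrite in_setE.
- by move=> t /Ks[u us Du]; exists u.
Qed.

(** Tagged partitions of [K], directed by fineness. The size of the pieces is
    prescribed by a neighbourhood [D t] of every point [t]: a piece with tag [t]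
    has to be contained in it. *)
Definition riemann K : set_system (seq (set G * G)) :=
  [set Q | exists D, (forall t, K t -> nbhs t (D t)) /\
    forall P, tagged_partition K P -> fine_partition K D P -> Q P].

Lemma riemann_filter K : Filter (riemann K).
Proof.
split.
- by exists (fun=> setT); split=> // t _; exact: filterT.
- move=> Q Q' [D [KD DQ]] [D' [KD' DQ']].
  exists (fun t => D t `&` D' t); split=> [t Kt|P KP fP].
    by apply: filterI; [exact: KD|exact: KD'].
  by split; [apply: DQ|apply: DQ'] => // q /fP[? qD]; split=> // t /qD[].
- move=> Q Q' QQ' [D [KD DQ]]; exists D; split=> // P KP fP.
  by apply/QQ'/DQ.
Qed.
Existing Instance riemann_filter.

Lemma riemann_proper K : compact K -> ProperFilter (riemann K).
Proof.
move=> cK; apply: Build_ProperFilter_ex => Q [D [KD DQ]].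
have [P [KP fP]] := exists_fine_partition cK KD.
by exists P; exact: DQ.
Qed.

Lemma near_riemann_tagged K : \forall P \near riemann K, tagged_partition K P.
Proof. by exists (fun=> setT); split=> // t _; exact: filterT. Qed.

Lemma near_riemann_fine K D : (forall t, K t -> nbhs t (D t)) ->
  \forall P \near riemann K, fine_partition K D P.
Proof. by move=> KD; exists D. Qed.

Lemma near_riemann_tags K : \forall P \near riemann K,
  forall q, q \in P -> K q.2.
Proof.
by exists (fun=> setT); split=> [t _|P _ fP q /fP[]//]; exact: filterT.
Qed.

Section Vector.
Context (X : normedModType R).
Implicit Types F : G -> X.

Definition riemann_sum F P : X := \sum_(q <- P) fine (mu q.1) *: F q.2.

Definition riemann_steps F P : seq (set (borel G) * X) :=
  [seq (q.1, F q.2) | q <- P].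

Definition osc_le F (e : R) P :=
  forall q, q \in P -> forall t, q.1 t -> `|F t - F q.2| <= e.

Lemma step_integral_riemann F P :
  step_integral mu (riemann_steps F P) = riemann_sum F P.
Proof. by rewrite /step_integral big_map. Qed.

Lemma integrable_riemann_steps K F P : compact K -> tagged_partition K P ->
  integrable_steps mu (riemann_steps F P).
Proof.
move=> cK KP _ /mapP[q qP ->]/=; split; first exact: (partition_measurable KP).
apply: le_lt_trans (haar_compact haar_mu cK); apply: le_measure.
- by rewrite inE; exact: (partition_measurable KP).
- by rewrite inE; exact: measurable_compact.
- exact: (partition_sub KP).
Qed.

Lemma fin_num_compact K : compact K -> mu K \is a fin_num.
Proof. by move=> cK; rewrite ge0_fin_numE//; exact: haar_compact. Qed.

Lemma le_integral_indic_compact (h : G -> R) K (M : R) : compact K -> 0 <= M ->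
  measurable_fun setT (fun t : borel G => (h t)%:E) ->
  (forall t, 0 <= h t) -> (forall t, h t <= M * \1_K t) ->
  (\int[mu]_t (h t)%:E <= (M * fine (mu K))%:E)%E.
Proof.
move=> cK M0 mh h0 hM; have mK := measurable_compact cK.
rewrite EFinM fineK ?fin_num_compact//.
rewrite -[mu K](_ : \int[mu]_t (\1_K t)%:E = _)%E; last first.
  by rewrite integral_indic// setIT.
rewrite -ge0_integralZl//; last first.
  by apply/measurable_EFinP; exact: measurable_indic.
apply: ge0_le_integral => //.
- by move=> t _; rewrite lee_fin.
- by apply/measurable_EFinP/measurable_funM => //; exact: measurable_indic.
- by move=> t _; rewrite -EFinM lee_fin.
Qed.

(** Since the indicators of the pieces sum to that of [K], the difference is an
    average of the oscillations of [F] on the pieces. *)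
Lemma riemann_steps_error K F P (e : R) t : tagged_partition K P ->
  (forall t, ~ K t -> F t = 0) ->
  osc_le F e P ->
  `|F t - step_fun (riemann_steps F P) t| <= e * \1_K t.
Proof.
move=> KP F0 Fe; rewrite /step_fun big_map.
have -> : F t = \sum_(q <- P) \1_(q.1) t *: F t.
  rewrite -scaler_suml (partition_sum KP) indicE.
  have [Kt|Kt] := pselect (K t); first by rewrite mem_set// scale1r.
  by rewrite memNset// scale0r F0.
rewrite -sumrB -(partition_sum KP) mulr_sumr.
apply: le_trans (ler_norm_sum _ _ _) _.
rewrite big_seq [leRHS]big_seq; apply: ler_sum => q qP.
rewrite -scalerBr normrZ indicE; have [qt|qt] := pselect (q.1 t).
  by rewrite mem_set// normr1 mul1r mulr1; exact: Fe.
by rewrite memNset// normr0 mul0r mulr0.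
Qed.

Lemma integral_riemann_error K F P (e : R) : compact K -> continuous F ->
  (forall t, ~ K t -> F t = 0) -> tagged_partition K P -> 0 <= e ->
  osc_le F e P ->
  (\int[mu]_t (`|F t - step_fun (riemann_steps F P) t|)%:E <=
     (e * fine (mu K))%:E)%E.
Proof.
move=> cK cF F0 KP e0 Fe; apply: le_integral_indic_compact => //.
- apply: measurable_norm_subr_step; first exact: integrable_riemann_steps KP.
  exact: dist_measurable_continuous.
- by move=> t; exact: riemann_steps_error.
Qed.

Lemma norm_riemann_sum_le K F P (M : R) : compact K -> tagged_partition K P ->
  0 <= M -> (forall q, q \in P -> `|F q.2| <= M) ->
  `|riemann_sum F P| <= M * fine (mu K).
Proof.
move=> cK KP M0 FM; rewrite -lee_fin -step_integral_riemann.
have iP := @integrable_riemann_steps K F P cK KP.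
apply: le_trans (norm_step_integral_le iP) _.
apply: le_integral_indic_compact => //; first exact: measurable_norm_step0 iP.
move=> t; rewrite /step_fun big_map -(partition_sum KP) mulr_sumr.
apply: le_trans (ler_norm_sum _ _ _) _.
rewrite big_seq [leRHS]big_seq; apply: ler_sum => q qP.
by rewrite normrZ ger0_norm// mulrC ler_wpM2r// FM.
Qed.

Lemma near_riemann_osc K F (e : R) : continuous F -> 0 < e ->
  \forall P \near riemann K, osc_le F e P.
Proof.
move=> cF e0.
have : \forall P \near riemann K,
    fine_partition K (fun s => [set t | `|F t - F s| <= e]) P.
  apply: near_riemann_fine => t _.
  have /cvgrPdist_le/(_ e e0) := cF t.
  by apply: filterS => s /=; rewrite distrC.
by apply: filterS => P fP q /fP[].
Qed.

End Vector.

Section Banach.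
Context (X : completeNormedModType R) (K : set G) (F : G -> X).
Hypothesis cK : compact K.
Hypothesis cF : continuous F.
Hypothesis F0 : forall t, ~ K t -> F t = 0.
Let m := fine (mu K).

Let m0 : 0 <= m. Proof. exact: fine_ge0. Qed.

Lemma riemann_sum_dist_le P P' (e : R) : tagged_partition K P ->
  tagged_partition K P' -> 0 <= e ->
  osc_le F e P -> osc_le F e P' ->
  `|riemann_sum F P - riemann_sum F P'| <= e * m + e * m.
Proof.
move=> KP KP' e0 Fe Fe'; rewrite -lee_fin -!step_integral_riemann.
have := dist_step_integral_le (dist_measurable_continuous cF)
  (integrable_riemann_steps (F := F) cK KP) (integrable_riemann_steps (F := F) cK KP').
by move=> /le_trans; apply; rewrite EFinD; apply: leeD;
  exact: integral_riemann_error.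
Qed.

(** Two fine partitions have Riemann sums that are both close, in mean, to [F]. *)
Lemma is_cvg_riemann_sum : cvg (riemann_sum F P @[P --> riemann K]).
Proof.
have pK := riemann_proper cK.
apply: cauchy_cvg; apply/cauchyP => _/posnumP[e].
have m1 : 0 < 4 * (m + 1) by rewrite mulr_gt0// ltr_wpDl.
pose c := e%:num / (4 * (m + 1)).
have c0 : 0 < c by rewrite divr_gt0.
have near_c : \forall P \near riemann K,
      tagged_partition K P /\ osc_le F c P.
  by apply: filterI; [exact: near_riemann_tagged|exact: near_riemann_osc].
have [P0 [KP0 osc0]] := filter_ex near_c.
exists (riemann_sum F P0); apply: filterS near_c => P [KP oscP].
rewrite /= -ball_normE/=.
apply: le_lt_trans (riemann_sum_dist_le KP0 KP (ltW c0) osc0 oscP) _.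
rewrite -mulrDr /c mulrAC ltr_pdivrMr// ltr_pM2l//.
by move: m0; rewrite -/m; lra.
Qed.

End Banach.
End RiemannSums.

#[local] Existing Instance riemann_filter.

(** * Integration of compactly supported continuous functions *)

Section CompactlySupported.
Context (R : realType) (G : lcGroupType).

Definition supported_on (X : zmodType) (K : set G) (F : G -> X) :=
  forall t, ~ K t -> F t = 0.

(** A chosen compact set [K] containing the support makes it possible to compare
    the integrals of several functions on common partitions. *)
Definition cc_on (X : normedModType R) (K : set G) (F : G -> X) :=
  [/\ compact K, continuous F & supported_on K F].

Lemma cc_onD (X : normedModType R) K (F H : G -> X) :
  cc_on K F -> cc_on K H -> cc_on K (fun t => F t + H t).
Proof.
move=> [cK cF F0] [_ cH H0]; split=> //.
  by move=> t; apply: cvgD; [exact: cF|exact: cH].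
by move=> t Kt; rewrite F0// H0// addr0.
Qed.

Lemma cc_onZ (X : normedModType R) K (l : R) (F : G -> X) :
  cc_on K F -> cc_on K (fun t => l *: F t).
Proof.
move=> [cK cF F0]; split=> //; first by move=> t; apply: cvgZl_tmp; exact: cF.
by move=> t Kt; rewrite F0// scaler0.
Qed.

Lemma cc_on_comp (X Y : normedModType R) K (T : X -> Y) (F : G -> X) :
  bounded_operator T -> cc_on K F -> cc_on K (T \o F).
Proof.
move=> bT [cK cF F0]; split=> //.
  by move=> t; apply: continuous_comp; [exact: cF|exact: bounded_operator_continuous].
by move=> t Kt; rewrite /= F0// (lin0 bT.1).
Qed.

End CompactlySupported.

Section Integral.
Context (R : realType) (G : lcGroupType) (mu : {measure set (borel G) -> \bar R}).
Hypothesis haar_mu : left_haar mu.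
Local Notation integral F := (integral_of mu F).
Local Notation riemann := (riemann R).
Local Notation riemann_sum := (riemann_sum mu).

Section OneSpace.
Context (X : completeNormedModType R).
Implicit Types (K : set G) (F H : G -> X).

(** Riemann sums over sufficiently fine partitions are integrals of step functions
    converging to [F] in mean. *)
Lemma is_integral_cc_on K F : cc_on K F ->
  exists y, is_integral mu F y /\ riemann_sum F P @[P --> riemann K] --> y.
Proof.
move=> [cK cF F0].
have pK := riemann_proper R cK.
have /cvg_ex[y Fy] := is_cvg_riemann_sum haar_mu cK cF F0.
exists y; split=> //.
have approx n : exists P, [/\ tagged_partition R K P, osc_le F n.+1%:R^-1 P &
    `|y - riemann_sum F P| <= n.+1%:R^-1].
  have n0 : 0 < n.+1%:R^-1 :> R by rewrite invr_gt0.
  have := filter_ex (filterI (near_riemann_tagged R K)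
    (filterI (near_riemann_osc K cF n0) (iffLR (cvgrPdist_le _ _) Fy _ n0))).
  by move=> [P [? [? ?]]]; exists P.
have [P hP] := choice approx.
have iP n : integrable_steps mu (riemann_steps F (P n)).
  by have [KP _ _] := hP n; exact: (integrable_riemann_steps haar_mu cK KP).
have err n : (\int[mu]_t (`|F t - step_fun (riemann_steps F (P n)) t|)%:E <=
     (n.+1%:R^-1 * fine (mu K))%:E)%E.
  by have [KP oP _] := hP n; exact: integral_riemann_error.
have inv0 : (n.+1%:R^-1 : R) @[n --> \oo] --> 0 by exact: cvg_harmonic.
exists (fun n => riemann_steps F (P n)); split.
- by move=> n q; exact: iP.
- move=> n; apply/integrableP; split.
    by apply: measurable_norm_subr_step => //; exact: dist_measurable_continuous.
  apply: le_lt_trans (ltry (n.+1%:R^-1 * fine (mu K))).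
  by apply: le_trans (err n); under eq_integral do rewrite gee0_abs//.
- apply: (@squeeze_cvge _ _ _ _ (cst 0%E) _ (fun n => (n.+1%:R^-1 * fine (mu K))%:E)).
  + by apply: nearW => n; rewrite err integral_ge0.
  + exact: cvg_cst.
  + apply: cvg_EFin; first exact: nearW.
    by rewrite -[0](mul0r (fine (mu K))); apply: cvgMl.
- apply/cvgrPdist_le => e e0.
  have /cvgrPdist_le/(_ _ e0) := inv0; apply: filterS => n.
  rewrite sub0r normrN ger0_norm ?invr_ge0// => ne.
  rewrite step_integral_riemann.
  by apply: le_trans ne; have [] := hP n.
Qed.

Lemma integral_cvg K F : cc_on K F ->
  riemann_sum F P @[P --> riemann K] --> integral F.
Proof.
move=> FK; have [y [iy Fy]] := is_integral_cc_on FK.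
by rewrite (integral_ofE _ iy)//; apply: dist_measurable_continuous; case: FK.
Qed.

Lemma integral_unique K F y : cc_on K F ->
  riemann_sum F P @[P --> riemann K] --> y -> integral F = y.
Proof.
move=> FK Fy; have pK : ProperFilter (riemann K).
  by apply: (riemann_proper R); case: FK.
by apply: cvg_unique Fy => //; exact: integral_cvg.
Qed.

Lemma integral_riemann_dist_le K F P (e : R) : cc_on K F ->
  tagged_partition R K P -> 0 <= e -> osc_le F e P ->
  `|integral F - riemann_sum F P| <= e * fine (mu K).
Proof.
move=> FK KP e0 oP; have [cK cF F0] := FK.
have [y [iy Fy]] := is_integral_cc_on FK.
have mF := dist_measurable_continuous cF.
rewrite (integral_ofE mF iy) -lee_fin -step_integral_riemann.
apply: le_trans (is_integral_dist_le mF iy _) _.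
  exact: (integrable_riemann_steps haar_mu cK KP).
exact: integral_riemann_error.
Qed.

Lemma integral_ofD K F H : cc_on K F -> cc_on K H ->
  integral (fun t => F t + H t) = integral F + integral H.
Proof.
move=> FK HK; apply: (integral_unique (cc_onD FK HK)).
rewrite (_ : riemann_sum _ = fun P => riemann_sum F P + riemann_sum H P).
  by apply: cvgD; exact: integral_cvg.
apply/funext => P; rewrite -big_split; apply: eq_bigr => q _ /=.
by rewrite scalerDr.
Qed.

Lemma integral_norm_le K F (M : R) : cc_on K F -> 0 <= M ->
  (forall t, K t -> `|F t| <= M) -> `|integral F| <= M * fine (mu K).
Proof.
move=> FK M0 FM; have [cK cF _] := FK.
have pK := riemann_proper R cK.
apply: (closed_cvg (fun x : R => x <= M * fine (mu K)) (@closed_le _ _) _ _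
  (cvg_norm (integral_cvg FK))).
apply: (filterS _ (filterI (near_riemann_tagged R K) (near_riemann_tags R K))).
move=> P [KP PK].
by apply: norm_riemann_sum_le => // q qP; apply/FM/PK.
Qed.

Lemma integral_closed_cone (C : set X) F K : cc_on K F -> closed C -> C 0 ->
  (forall x y, C x -> C y -> C (x + y)) ->
  (forall (l : R) x, 0 <= l -> C x -> C (l *: x)) ->
  (forall t, C (F t)) -> C (integral F).
Proof.
move=> FK Ccl C0 CD CZ CF; have [cK _ _] := FK.
have pK := riemann_proper R cK.
apply: (closed_cvg C Ccl _ _ (integral_cvg FK)); apply: nearW => P.
by apply: big_ind => // q _; apply: CZ => //; exact: fine_ge0.
Qed.

(** Translating a partition of [K] gives a partition of the translated set with
    the same Riemann sum, by invariance of the measure. *)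
Lemma integral_translate K F (s : G) : cc_on K F ->
  integral (fun t => F (s * t)%g) = integral F.
Proof.
move=> FK; have [cK cF F0] := FK; have pK := riemann_proper R cK.
pose sK := [set (s^-1 * t)%g | t in K].
have FsK : cc_on sK (fun t => F (s * t)%g).
  split.
  - apply: continuous_compact => //; apply: continuous_subspaceT; exact: continuous_mulgl.
  - by move=> t; apply: continuous_comp; [exact: continuous_mulgl|exact: cF].
  - by move=> t sKt; apply: F0 => Kst; apply: sKt; exists (s * t)%g => //; rewrite mulKg.
have msK (S : set G) : measurable (S : set (borel G)) ->
    measurable ([set (s^-1 * t)%g | t in S] : set (borel G)).
  move=> mS; rewrite translateE invgK.
  suff : measurable_fun setT ((fun t => (s * t)%g) : borel G -> borel G).
    by move=> /(_ measurableT _ mS); rewrite setTI.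
  apply: measurability; first by reflexivity.
  move=> _ [U oU <-]; rewrite setTI; apply: measurable_open.
  by move/continuousP: (@continuous_mulgl G s); apply.
pose sP P : seq (set G * G) := [seq ([set (s^-1 * t)%g | t in q.1], (s^-1 * q.2)%g) | q <- P].
apply: (@eq_dist_le _ _ _ _ (fine (mu sK) + fine (mu K))).
  by rewrite addr_ge0// fine_ge0.
move=> e e0.
have [P [KP oP]] := filter_ex (filterI (near_riemann_tagged R K)
  (near_riemann_osc K cF e0)).
have sKP : tagged_partition R sK (sP P).
  split.
  - by move=> _ /mapP[q qP ->]; apply: msK; exact: (partition_measurable KP).
  - move=> _ /mapP[q qP ->] _ [t qt <-]; exists t => //.
    exact: (partition_sub KP qP).
  - move=> t; rewrite big_map/= /sK translateE invgK; under eq_bigr do rewrite translateE invgK.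
    exact: (partition_sum KP).
have osP : osc_le (fun t => F (s * t)%g) e (sP P).
  move=> _ /mapP[q qP ->] _ [t qt <-] /=; rewrite !mulVKg; exact: oP.
have sumE : riemann_sum (fun t => F (s * t)%g) (sP P) = riemann_sum F P.
  rewrite /riemann_sum big_map; apply: eq_big_seq => q qP /=.
  by rewrite mulVKg (haar_invariant haar_mu)//; exact: (partition_measurable KP).
rewrite mulrDr -(subrK (riemann_sum F P) (integral _)) -addrA.
apply: le_trans (ler_normD _ _) _; apply: lerD.
  by rewrite -sumE; apply: integral_riemann_dist_le => //; exact: ltW.
by rewrite distrC; apply: integral_riemann_dist_le => //; exact: ltW.
Qed.

(** The tube lemma. *)
Lemma near_uniform_on_compact (T : topologicalType) (H : T -> G -> X) K (t0 : T) (e : R) :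
  compact K -> continuous (fun p : T * G => H p.1 p.2) -> 0 < e ->
  \forall t \near t0, forall r, K r -> `|H t r - H t0 r| <= e.
Proof.
move=> cK cH e0.
apply: (iffLR (compact_near_coveringP K) cK _ _ (fun t r => `|H t r - H t0 r| <= e)) => r _.
have e2 : 0 < e / 2 by rewrite divr_gt0.
have /cvgrPdist_le/(_ _ e2) [[A B] /= [A0 B0] AB] := cH (t0, r).
exists (B, A) => // -[r' t] /= [Br At].
have h1 := AB (t, r') (conj At Br).
have h2 := AB (t0, r') (conj (nbhs_singleton A0) Br).
rewrite (splitr e) -(subrK (H t0 r) (H t r')) -addrA.
by apply: le_trans (ler_normD _ _) _; apply: lerD => //; rewrite distrC.
Qed.

End OneSpace.

(** A bounded operator maps Riemann sums to Riemann sums. *)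
Lemma integral_comp (X Y : completeNormedModType R) (T : X -> Y) K (F : G -> X) :
  bounded_operator T -> cc_on K F -> integral (T \o F) = T (integral F).
Proof.
move=> bT FK; have [cK _ _] := FK; have pK := riemann_proper R cK.
apply: (integral_unique (cc_on_comp bT FK)).
rewrite (_ : riemann_sum _ = T \o riemann_sum F).
  apply: continuous_cvg; last exact: integral_cvg.
  exact: bounded_operator_continuous.
apply/funext => P; rewrite /= /riemann_sum (lin_sum bT.1).
by apply: eq_bigr => q _ /=; rewrite (linZ bT.1).
Qed.

Section ParametricIntegrals.
Context (X : completeNormedModType R).
Implicit Types (K L : set G) (F H : G -> X).

Lemma integral_ofZ K (l : R) F : cc_on K F ->
  integral (fun t => l *: F t) = l *: integral F.
Proof. exact: (integral_comp (bounded_operator_scale X l)). Qed.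

Lemma cc_onB K F H : cc_on K F -> cc_on K H -> cc_on K (fun t => F t - H t).
Proof.
move=> FK HK; have := cc_onD FK (cc_onZ (-1) HK).
by under eq_fun do rewrite scaleN1r.
Qed.

Lemma integral_ofB K F H : cc_on K F -> cc_on K H ->
  integral (fun t => F t - H t) = integral F - integral H.
Proof.
move=> FK HK; rewrite -scaleN1r -(integral_ofZ _ HK) -(integral_ofD FK (cc_onZ _ HK)).
by congr integral_of; apply/funext => t; rewrite scaleN1r.
Qed.

Lemma integral_dist_le K F H (e : R) : cc_on K F -> cc_on K H -> 0 <= e ->
  (forall t, K t -> `|F t - H t| <= e) ->
  `|integral F - integral H| <= e * fine (mu K).
Proof.
move=> FK HK e0 FH; rewrite -(integral_ofB FK HK).
by apply: integral_norm_le => //; exact: cc_onB.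
Qed.

Lemma integral_norm_le_integral K F (g : G -> R) : cc_on K F -> cc_on K g ->
  (forall t, `|F t| <= g t) -> `|integral F| <= integral g.
Proof.
move=> FK gK Fg; have [cK _ _] := FK; have pK := riemann_proper R cK.
rewrite -subr_ge0.
apply: (closed_cvg (fun x : R => 0 <= x) (@closed_ge _ _) _ _
  (cvgB (integral_cvg gK) (cvg_norm (integral_cvg FK)))).
apply: nearW => P; rewrite /= subr_ge0; apply: le_trans (ler_norm_sum _ _ _) _.
by apply: ler_sum => q _; rewrite normrZ ger0_norm ?fine_ge0// ler_wpM2l// fine_ge0.
Qed.

Lemma continuous_integral (T : topologicalType) (H : T -> G -> X) K : compact K ->
  continuous (fun p : T * G => H p.1 p.2) ->
  (forall t, supported_on K (H t)) -> continuous (fun t => integral (H t)).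
Proof.
move=> cK cH H0 t0; apply/cvgrPdist_le => e e0.
have HK t : cc_on K (H t) by split=> //; exact: continuous_slice.
have m1 : 0 < fine (mu K) + 1 by rewrite ltr_wpDl// fine_ge0.
have := near_uniform_on_compact t0 cK cH (divr_gt0 e0 m1).
apply: filterS => t tH; rewrite distrC.
apply: le_trans (integral_dist_le (HK t) (HK t0) _ tH) _.
  by rewrite ltW// divr_gt0.
by rewrite mulrAC ler_pdivrMr// ler_pM2l// lerDl.
Qed.

Lemma cc_on0 K : compact K -> cc_on K (fun=> 0 : X).
Proof. by move=> cK; split=> // t; exact: cvg_cst. Qed.

Lemma integral_eq0 F : (forall t, F t = 0) -> integral F = 0.
Proof.
move=> /funext->; have z := cc_on0 (@compact0 G).
apply/eqP; rewrite -normr_le0 -[leRHS](mul0r (fine (mu set0))).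
by apply: (integral_norm_le z) => // t _; rewrite normr0.
Qed.

Lemma cc_on_riemann_sum (H : G -> G -> X) L P : compact L ->
  (forall t, cc_on L (H t)) -> cc_on L (fun r => riemann_sum (H^~ r) P) /\
  riemann_sum (fun t => integral (H t)) P =
    integral (fun r => riemann_sum (H^~ r) P).
Proof.
move=> cL HL; elim: P => [|q P [ccP ihP]].
  have z : cc_on L (fun=> 0 : X) by exact: cc_on0.
  rewrite (_ : (fun _ => _) = fun=> 0); last first.
    by apply/funext => r; rewrite /riemann_sum big_nil.
  by split=> //; rewrite /riemann_sum big_nil integral_eq0.
have qL : cc_on L (fun r => fine (mu q.1) *: H q.2 r) by exact: cc_onZ.
rewrite (_ : (fun r => _) =
    fun r => fine (mu q.1) *: H q.2 r + riemann_sum (H^~ r) P); last first.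
  by apply/funext => r; rewrite /riemann_sum big_cons.
split; first exact: cc_onD.
by rewrite (integral_ofD qL ccP) (integral_ofZ _ (HL _)) -ihP /riemann_sum big_cons.
Qed.

(** Both sides are approximated by the integral over [L] of the Riemann sums
    of the slices, uniformly for the partitions on whose pieces all slices
    oscillate little; compactness of [L] provides those. *)
Lemma fubini (H : G -> G -> X) K L : compact K -> compact L ->
  continuous (fun p : G * G => H p.1 p.2) ->
  (forall t r, ~ K t -> H t r = 0) -> (forall t r, ~ L r -> H t r = 0) ->
  integral (fun t => integral (H t)) = integral (fun r => integral (H^~ r)).
Proof.
move=> cK cL cH HK HL; have pK := riemann_proper R cK.
have cH' : continuous (fun p : G * G => H p.2 p.1).
  move=> p; apply: (@continuous_comp _ _ _ (fun p : G * G => (p.2, p.1)) (fun p => H p.1 p.2)).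
    by apply: cvg_pair; [exact: cvg_snd|exact: cvg_fst].
  exact: cH.
have ccL t : cc_on L (H t) by split=> //; [exact: continuous_slice|move=> r; exact: HL].
have ccK r : cc_on K (H^~ r).
  by split=> //; [exact: (continuous_slice (h := fun r t => H t r))|move=> t; exact: HK].
have IK : cc_on K (fun t => integral (H t)).
  split=> //; first by apply: (continuous_integral cL cH) => t r; exact: HL.
  by move=> t Kt; apply: integral_eq0 => r; exact: HK.
have IL : cc_on L (fun r => integral (H^~ r)).
  split=> //; first by apply: (@continuous_integral _ (fun r t => H t r) _ cK cH') => r t; exact: HK.
  by move=> r Lr; apply: integral_eq0 => t; exact: HL.
apply: (integral_unique IK); apply/cvgrPdist_le => e e0.
have m0 : 0 <= fine (mu K) * fine (mu L) by rewrite mulr_ge0 ?fine_ge0.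
have m1 : 0 < fine (mu K) * fine (mu L) + 1 by rewrite ltr_wpDl.
pose e' := e / (fine (mu K) * fine (mu L) + 1).
have e'0 : 0 < e' by rewrite divr_gt0.
have fineP : \forall P \near riemann K, fine_partition K
    (fun s => [set t | forall r, L r -> `|H t r - H s r| <= e']) P.
  by apply: near_riemann_fine => t _; exact: near_uniform_on_compact.
apply: (filterS _ (filterI (near_riemann_tagged R K) fineP)) => P [KP fP].
have [ccP ->] := cc_on_riemann_sum P cL ccL.
apply: le_trans (integral_dist_le IL ccP (_ : 0 <= e' * fine (mu K)) _) _.
- by rewrite mulr_ge0 ?fine_ge0// ltW.
- move=> r Lr; apply: integral_riemann_dist_le => //; first exact: ltW.
  by move=> q qP t qt; have [_ /(_ _ qt)] := fP q qP; exact.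
- by rewrite -mulrA /e' mulrAC ler_pdivrMr// ler_pM2l// lerDl.
Qed.

End ParametricIntegrals.

End Integral.

(** * Positivity of the Haar measure and bump functions *)

Section Bumps.
Context (R : realType) (G : lcGroupType) (mu : {measure set (borel G) -> \bar R}).
Hypothesis haar_mu : left_haar mu.
Local Notation integral F := (integral_of mu F).
Implicit Types K S : set G.

(** The step function with value one on the pieces of [S] and minus one on [S]
    vanishes identically, hence so does its integral. *)
Lemma sum_measure_partition K P S : compact K -> tagged_partition R K P ->
  measurable (S : set (borel G)) -> S `<=` K ->
  \sum_(q <- P) fine (mu (q.1 `&` S)) = fine (mu S).
Proof.
move=> cK KP mS SK; apply/eqP; rewrite -subr_eq0 -normr_le0 -lee_fin.
pose l : seq (set (borel G) * R^o) := (S, -1) :: [seq (q.1 `&` S, 1) | q <- P].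
have fin (B : set (borel G)) : measurable B -> B `<=` K -> (mu B < +oo)%E.
  move=> mB BK; apply: le_lt_trans (haar_compact haar_mu cK).
  by apply: le_measure; rewrite ?inE//; exact: measurable_compact.
have il : integrable_steps mu l.
  move=> q; rewrite inE => /orP[/eqP->/=|]; first by split=> //; exact: fin.
  move=> /mapP[p pP ->]/=; have mp := partition_measurable KP pP.
  have mI : measurable (p.1 `&` S : set (borel G)) by exact: measurableI.
  by split=> //; apply: fin => // t [_ /SK].
have := norm_step_integral_le il.
rewrite /step_integral big_cons big_map/=.
under eq_bigr do rewrite /GRing.scale/= mulr1.
have -> : (\int[mu]_t (`|step_fun l t|)%:E = 0)%E.
  apply: integral0_eq => t _; rewrite /step_fun big_cons big_map/=.
  under eq_bigr => q _ do rewrite indicI /GRing.scale/= mulr1.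
  rewrite -mulr_suml (partition_sum KP) /GRing.scale/= mulrN1 !indicE.
  have [St|St] := pselect (S t).
    by rewrite !mem_set//= ?mulr1 ?addNr ?normr0//; exact: SK.
  by rewrite (memNset St) mulr0 oppr0 addr0 normr0.
by apply: le_trans; rewrite lee_fin addrC /GRing.scale/= mulrN1.
Qed.

(** On a fine partition, [g] exceeds [c - e'] at the tag of every piece that meets
    [S]. *)
Lemma measure_le_integral K S (g : G -> R) (c : R) : cc_on K g ->
  measurable (S : set (borel G)) -> S `<=` K -> (forall t, 0 <= g t) ->
  (forall t, S t -> c <= g t) -> c * fine (mu S) <= integral g.
Proof.
move=> gK mS SK g0 gS; have [cK cg _] := gK; have pK := riemann_proper R cK.
apply/ler_addgt0Pr => e e0.
have m1 : 0 < fine (mu S) + 1 by rewrite ltr_wpDl// fine_ge0.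
pose e' := e / (fine (mu S) + 1).
have e'0 : 0 < e' by rewrite divr_gt0.
rewrite -lerBlDr.
apply: (closed_cvg (fun x : R => c * fine (mu S) - e <= x) (@closed_ge _ _) _ _
  (integral_cvg haar_mu gK)).
apply: (filterS _ (filterI (near_riemann_tagged R K) (near_riemann_osc K cg e'0))).
move=> P [KP oP].
apply: (@le_trans _ _ ((c - e') * fine (mu S))).
  rewrite mulrBl lerB// /e' mulrAC ler_pdivrMr// ler_pM2l// lerDl//.
rewrite -(sum_measure_partition cK KP mS SK) mulr_sumr /riemann_sum.
rewrite big_seq [leRHS]big_seq; apply: ler_sum => q qP.
have mq := partition_measurable KP qP.
rewrite /GRing.scale/= mulrC.
have [[t [qt St]]|/set0P/negP/negPn/eqP->] := pselect (q.1 `&` S !=set0); last first.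
  by rewrite measure0 mul0r mulr_ge0// fine_ge0.
have fq (B : set (borel G)) : measurable B -> B `<=` K -> mu B \is a fin_num.
  move=> mB BK; rewrite ge0_fin_numE//; apply: le_lt_trans (haar_compact haar_mu cK).
  by apply: le_measure; rewrite ?inE//; exact: measurable_compact.
apply: (@le_trans _ _ (fine (mu (q.1 `&` S)) * g q.2)).
  rewrite ler_wpM2l ?fine_ge0//.
  have := oP q qP t qt; rewrite ler_norml => /andP[_].
  by have := gS t St; lra.
rewrite ler_wpM2r// fine_le//.
- by apply: fq; [exact: measurableI|move=> u [_ /SK]].
- by apply: fq => //; exact: (partition_sub KP).
- apply: le_measure; rewrite ?inE//; first exact: measurableI.
Qed.

(** If a nonempty open set were null, then every compact set, being covered by
    finitely many translates of it, would be null, and so would [G] by inner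
    regularity. *)
Lemma haar_open_gt0 S : open S -> S !=set0 -> (0 < mu S)%E.
Proof.
move=> oS [s Ss]; rewrite lt0e measure_ge0 andbT; apply/negP => /eqP S0.
have mS := measurable_open oS.
have K0 K : compact K -> mu K = 0%E.
  move=> cK; have := cK; rewrite compact_cover.
  move=> /(_ G setT (fun u => [set (u * t)%g | t in S])) [u _|t _|F _ KF].
  - exact: open_translate.
  - by exists (t * s^-1)%g => //; exists s => //; rewrite mulgVK.
  apply/eqP; rewrite eq_le measure_ge0 andbT.
  pose T u : set (borel G) := [set (u * t)%g | t in S].
  have mT u : measurable (T u) by apply: measurable_open; exact: open_translate.
  have KU : K `<=` \big[setU/set0]_(u <- finmap.enum_fset F) T u.
    by move=> t /KF[u uF Tt]; rewrite -bigcup_seq; exists u.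
  have mU : measurable (\big[setU/set0]_(u <- finmap.enum_fset F) T u).
    exact: bigsetU_measurable.
  apply: le_trans (_ : (mu (\big[setU/set0]_(u <- finmap.enum_fset F) T u) <= 0)%E).
    by apply: le_measure; rewrite ?inE//; exact: measurable_compact.
  elim: (finmap.enum_fset F) => [|u r ih]; first by rewrite big_nil measure0.
  rewrite big_cons; apply: (le_trans (measureU2 mu (mT u) _)).
    exact: bigsetU_measurable.
  rewrite -[leRHS]adde0; apply: leeD => //.
  have := haar_invariant haar_mu u mS; rewrite S0 => Tu0.
  by rewrite -[leRHS]Tu0.
have := haar_nonzero haar_mu; rewrite (haar_inner haar_mu openT) => /eqP; apply.
apply/eqP; rewrite eq_le; apply/andP; split.
  by apply: ub_ereal_sup => _ [K [cK _] <-]; rewrite K0.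
apply: ereal_sup_ubound; exists set0; last by rewrite measure0.
by split=> //; exact: compact0.
Qed.

(** Complete regularity of [G] provides a function supported near the unit; its
    integral is positive because nonempty open sets have positive measure. *)
Lemma exists_bump (V : set G) : nbhs 1%g V ->
  exists K (phi : G -> R), [/\ cc_on K phi, forall t, 0 <= phi t,
    forall t, ~ V t -> phi t = 0 & integral phi = 1].
Proof.
move=> nV; have [C [nC cC]] := compact_nbhs (1%g : G).
have nW : nbhs 1%g (V `&` C)^° by apply: nbhs_interior; exact: filterI.
have oW : open (V `&` C)^° by exact: open_interior.
have WVC : (V `&` C)^° `<=` V `&` C by exact: interior_subset.
have := locally_compact_completely_regular (R := R)
  (@lcgroup_locally_compact G) (@lcgroup_hausdorff G).
move=> /(_ 1%g (~` (V `&` C)^°)) [].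
- exact: open_closedC.
- by move=> /=; apply; exact: (nbhs_singleton nW).
move=> uT hu; have /(uniform_separatorP (R := R)) : uniform_separator [set 1%g] (~` (V `&` C)^°).
  by exists uT.
move=> [f [cf f01 f1 fB]].
pose g t := 1 - f t.
have g0 t : 0 <= g t.
  have /= := f01 (f t) (ex_intro2 _ _ t I erefl); rewrite in_itv/= => /andP[_].
  by rewrite subr_ge0.
have gW t : ~ (V `&` C)^° t -> g t = 0.
  by move=> Wt; rewrite /g (fB (f t)) ?subrr//; exists t.
have cg : continuous g by move=> t; apply: cvgB; [exact: cvg_cst|exact: cf].
have gC : cc_on C g by split=> // t Ct; apply: gW => /WVC[].
have gV t : ~ V t -> g t = 0 by move=> Vt; apply: gW => /WVC[].
pose S := g @^-1` [set x | 1 / 2 < x].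
have oS : open S by move/continuousP: cg; apply; exact: open_gt.
have S1 : S 1%g by rewrite /S/= /g (f1 (f 1%g)) ?subr0; [lra|exists 1%g].
have SC : S `<=` C.
  move=> t St; apply: contrapT => Ct; have : 1 / 2 < g t := St.
  by rewrite gW; [lra|move=> /WVC[]].
have mS := measurable_open oS.
have muS : 0 < fine (mu S).
  apply: fine_gt0; rewrite haar_open_gt0//; last by exists 1%g.
  apply: le_lt_trans (haar_compact haar_mu cC).
  by apply: le_measure; rewrite ?inE//; exact: measurable_compact.
have Ig : 0 < integral g.
  apply: lt_le_trans (measure_le_integral gC mS SC g0 (_ : forall t, S t -> 1 / 2 <= g t)).
    by rewrite mulr_gt0.
  by move=> t /ltW.
exists C, (fun t => (integral g)^-1 *: g t); split.
- exact: cc_onZ.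
- by move=> t; rewrite mulr_ge0// invr_ge0 ltW.
- by move=> t /gV ->; rewrite scaler0.
- by rewrite (integral_ofZ haar_mu _ gC) /GRing.scale/= mulVf// gt_eqF.
Qed.

End Bumps.

(** * The convolution algebra *)

Section AlgebraMul.
Context (R : realType) (A : pBanachAlgType R).
Implicit Types a b : A.

Lemma linear_amul a : linear (amul a).
Proof. by move=> l b c; rewrite amulDr amulZr. Qed.

Lemma linear_amulr b : linear (amul^~ b).
Proof. by move=> l a c; rewrite amulDl amulZl. Qed.

Lemma amul0 a : amul a 0 = 0. Proof. exact: lin0 (linear_amul a). Qed.
Lemma mul0a a : amul 0 a = 0. Proof. exact: lin0 (linear_amulr a). Qed.

Lemma bounded_amul a : bounded_operator (amul a).
Proof. by split; [exact: linear_amul|exists `|a| => b; exact: ler_norm_amul]. Qed.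

Lemma bounded_amulr b : bounded_operator (amul^~ b).
Proof.
split; first exact: linear_amulr.
by exists `|b| => a; rewrite mulrC; exact: ler_norm_amul.
Qed.

Lemma continuous_amul : continuous (fun p : A * A => amul p.1 p.2).
Proof.
apply: (@continuous_bilinear _ _ _ _ _ 1); [exact: linear_amulr|exact: linear_amul|].
by move=> a b; rewrite mul1r ler_norm_amul.
Qed.

End AlgebraMul.

Section CcFunctions.
Context (R : realType) (A : pBanachAlgType R) (G : lcGroupType).
Implicit Types f g : Cc A G.

Definition tsupport f : set G := closure [set s | f s != 0].

Lemma Cc_on_tsupport f : cc_on (tsupport f) (f : G -> A).
Proof.
have /asboolP[cf kf] := valP f; split=> // t Kt.
by apply/eqP; apply: contrapT => /negP ft; apply: Kt; exact: subset_closure.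
Qed.

(** Through this lemma the convolution and the left actions are given by their
    formulas. *)
Lemma to_CcE K (h : G -> A) : cc_on K h -> to_Cc h = h :> (G -> A).
Proof.
move=> [cK ch h0]; apply: insubdK; apply/asboolP; split=> //.
apply: (subclosed_compact _ cK); first exact: closed_closure.
have Kcl : closed K := compact_closed (@lcgroup_hausdorff G) cK.
rewrite [X in _ `<=` X](closure_id K).1//; apply: closureS => t /= ht.
by apply: contrapT => Kt; move: ht; rewrite h0// eqxx.
Qed.

Lemma CcP f g : (forall s, f s = g s) -> f = g.
Proof. by move=> fg; apply/val_inj/funext. Qed.

Lemma CcD f g s : (f + g) s = f s + g s. Proof. by []. Qed.
Lemma CcZ l f s : (l *: f) s = l *: f s. Proof. by []. Qed.

Lemma Cc_continuous f : continuous (f : G -> A).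
Proof. by case: (Cc_on_tsupport f). Qed.

Lemma compact_tsupport f : compact (tsupport f).
Proof. by case: (Cc_on_tsupport f). Qed.

Lemma Cc_norm_bounded f : exists2 M, 0 <= M & forall s, `|f s| <= M.
Proof.
have [cK cf f0] := Cc_on_tsupport f.
have [M M0 fM] := compact_norm_bounded cK cf; exists M => // s.
by have [/fM//|/f0->] := pselect (tsupport f s); rewrite normr0.
Qed.

End CcFunctions.

Section Convolution.
Context (R : realType) (A : pBanachAlgType R) (G : lcGroupType).
Context (mu : {measure set (borel G) -> \bar R}) (alpha : G -> A -> A).
Hypothesis haar_mu : left_haar mu.
Hypothesis dyn : dynamical_system alpha.
Local Notation integral F := (integral_of mu F).
Local Notation conv := (convolution mu alpha).
Implicit Types f g h : Cc A G.

Lemma bounded_alpha s : bounded_operator (alpha s).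
Proof. by have [] := dyn_aut dyn s. Qed.

Lemma alphaM s a b : alpha s (amul a b) = amul (alpha s a) (alpha s b).
Proof. by have [_ []] := dyn_aut dyn s. Qed.

Lemma alpha_mul s t a : alpha (s * t)%g a = alpha s (alpha t a).
Proof. by rewrite (dyn_hom dyn). Qed.

Lemma alpha1 a : alpha 1%g a = a.
Proof.
have [_ [_ [gamma [ag ga _]]]] := dyn_aut dyn 1%g.
by apply: (can_inj ag); rewrite -alpha_mul mulg1.
Qed.

Lemma alpha_cone s a : cone a -> cone (alpha s a).
Proof. by have [_ [_ [gamma [_ _ h]]]] := dyn_aut dyn s => /h[]. Qed.

Lemma continuous_alpha : continuous (fun p : G * A => alpha p.1 p.2).
Proof.
apply: strongly_continuous_joint.
- exact: bounded_alpha.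
- exact: (dyn_continuous dyn).
- exact: compact_nbhs.
Qed.

(** [alpha_r (g (r^-1 s))] as a function of [(r, s)]. *)
Lemma continuous_shifted g :
  continuous (fun p : G * G => alpha p.1 (g (p.1^-1 * p.2)%g)).
Proof.
apply: (continuous_pair_comp continuous_alpha); first exact: continuous_fst.
by apply: continuous_comp_fun (@Cc_continuous _ _ _ g); exact: continuous_mulVg.
Qed.

Definition conv_integrand f g s r := amul (f r) (alpha r (g (r^-1 * s)%g)).

Lemma continuous_conv_integrand f g :
  continuous (fun p : G * G => conv_integrand f g p.1 p.2).
Proof.
apply: (continuous_pair_comp (@continuous_amul R A)).
  by apply: continuous_comp_fun (@Cc_continuous _ _ _ f); exact: continuous_snd.
apply: (@continuous_comp_fun _ _ _ (fun p : G * G => (p.2, p.1))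
  (fun p : G * G => alpha p.1 (g (p.1^-1 * p.2)%g))).
  by move=> p; apply: cvg_pair; [exact: cvg_snd|exact: cvg_fst].
exact: continuous_shifted.
Qed.

Lemma conv_integrand0l f g s : supported_on (tsupport f) (conv_integrand f g s).
Proof.
by move=> r; have [_ _ f0] := Cc_on_tsupport f => /f0 fr; rewrite /conv_integrand fr mul0a.
Qed.

(** A product [r * (r^-1 * s)] with factors in the two supports lies in the product
    of the supports. *)
Lemma conv_integrand0r f g s r : ~ setM (tsupport f) (tsupport g) s ->
  conv_integrand f g s r = 0.
Proof.
move=> Ks; have [fr|/conv_integrand0l//] := pselect (tsupport f r).
have [_ _ g0] := Cc_on_tsupport g; rewrite /conv_integrand g0.
  by rewrite (lin0 (bounded_alpha r).1) amul0.
by move=> gr; apply: Ks; exact: setM_mem fr gr.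
Qed.

Lemma cc_on_conv_integrand f g s : cc_on (tsupport f) (conv_integrand f g s).
Proof.
split; [exact: compact_tsupport| |exact: conv_integrand0l].
exact: continuous_slice (@continuous_conv_integrand f g).
Qed.

Lemma cc_on_conv f g : cc_on (setM (tsupport f) (tsupport g))
  (fun s => integral (conv_integrand f g s)).
Proof.
split.
- by apply: compact_setM; exact: compact_tsupport.
- apply: (continuous_integral haar_mu (@compact_tsupport _ _ _ f)).
    exact: continuous_conv_integrand.
  by move=> s; exact: conv_integrand0l.
- by move=> s Ks; apply: (integral_eq0 haar_mu) => r; exact: conv_integrand0r.
Qed.

Lemma convolutionE f g s : conv f g s = integral (conv_integrand f g s).
Proof. by rewrite /convolution (to_CcE (cc_on_conv f g)). Qed.

Lemma convolutionDl f g h : conv (f + g) h = conv f h + conv g h.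
Proof.
apply: CcP => s; apply: etrans (convolutionE _ _ _) _.
rewrite [RHS](CcD (conv f h) (conv g h)).
rewrite [X in _ = X + _]convolutionE [X in _ = _ + X]convolutionE.
have K : compact (tsupport f `|` tsupport g).
  by apply: compactU; exact: compact_tsupport.
have cc u : tsupport u `<=` tsupport f `|` tsupport g ->
    cc_on (tsupport f `|` tsupport g) (conv_integrand u h s).
  move=> uK; have [_ cu u0] := cc_on_conv_integrand u h s.
  by split=> // t Kt; apply: u0 => /uK.
rewrite -(integral_ofD haar_mu (cc f _) (cc g _)); [|exact: subsetUl|exact: subsetUr].
by congr integral_of; apply/funext => r; rewrite /conv_integrand CcD amulDl.
Qed.

Lemma convolutionDr f g h : conv f (g + h) = conv f g + conv f h.
Proof.
apply: CcP => s; apply: etrans (convolutionE _ _ _) _.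
rewrite [RHS](CcD (conv f g) (conv f h)).
rewrite [X in _ = X + _]convolutionE [X in _ = _ + X]convolutionE.
rewrite -(integral_ofD haar_mu (cc_on_conv_integrand f g s) (cc_on_conv_integrand f h s)).
congr integral_of; apply/funext => r.
by rewrite /conv_integrand CcD (linD (bounded_alpha r).1) amulDr.
Qed.

Lemma convolutionZl l f g : conv (l *: f) g = l *: conv f g.
Proof.
apply: CcP => s; apply: etrans (convolutionE _ _ _) _.
rewrite [RHS](CcZ l (conv f g)) [X in _ = _ *: X]convolutionE.
rewrite -(integral_ofZ haar_mu _ (cc_on_conv_integrand f g s)).
by congr integral_of; apply/funext => r; rewrite /conv_integrand CcZ amulZl.
Qed.

Lemma convolutionZr l f g : conv f (l *: g) = l *: conv f g.
Proof.
apply: CcP => s; apply: etrans (convolutionE _ _ _) _.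
rewrite [RHS](CcZ l (conv f g)) [X in _ = _ *: X]convolutionE.
rewrite -(integral_ofZ haar_mu _ (cc_on_conv_integrand f g s)).
congr integral_of; apply/funext => r.
by rewrite /conv_integrand CcZ (linZ (bounded_alpha r).1) amulZr.
Qed.

Lemma convolution_cone f g : Cc_cone f -> Cc_cone g -> Cc_cone (conv f g).
Proof.
move=> f0 g0 s; rewrite convolutionE.
apply: (integral_closed_cone haar_mu (cc_on_conv_integrand f g s)).
- exact: (dyn_closed_cone dyn).
- by rewrite -(scale0r (f 1%g)); apply: coneZ => //; exact: f0.
- exact: coneD.
- exact: coneZ.
- by move=> t; apply: cone_amul; [exact: f0|apply: alpha_cone; exact: g0].
Qed.

(** The computation common to the associativity of the convolution and to the
    multiplicativity of the integrated forms: [A] acts on [X] and [Phi] is any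
    continuous function; Fubini's theorem and left invariance. *)
Lemma integral_conv_action (X : completeNormedModType R) (B : A -> X -> X) (C : R)
  (Phi : G -> X) f g :
  (forall x, linear (B^~ x)) -> (forall a, linear (B a)) ->
  (forall a x, `|B a x| <= C * `|a| * `|x|) ->
  (forall a b x, B (amul a b) x = B a (B b x)) -> continuous Phi ->
  integral (fun r => B (conv f g r) (Phi r)) =
  integral (fun t => B (f t)
    (integral (fun r => B (alpha t (g r)) (Phi (t * r)%g)))).
Proof.
move=> lBl lBr BC BM cPhi.
have bBl x : bounded_operator (B^~ x).
  by split=> //; exists (C * `|x|) => a; rewrite mulrAC.
have bBr a : bounded_operator (B a) by split=> //; exists (C * `|a|).
have cB := continuous_bilinear lBl lBr BC.
(* The variable [t] of the convolution integral and the outer variable [r] are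
   exchanged; then [r] is replaced by [t * r]. *)
pose H r t := B (conv_integrand f g r t) (Phi r).
transitivity (integral (fun r => integral (H r))).
  congr integral_of; apply/funext => r; rewrite convolutionE.
  by rewrite -(integral_comp haar_mu (bBl _) (cc_on_conv_integrand f g r)).
have cH : continuous (fun p : G * G => H p.1 p.2).
  apply: (continuous_pair_comp cB); first exact: continuous_conv_integrand.
  exact: continuous_comp_fun (@continuous_fst _ _) cPhi.
have BB0 x : B 0 x = 0 by exact: (lin0 (lBl x)).
apply: etrans (fubini haar_mu (K := setM (tsupport f) (tsupport g)) (L := tsupport f) _ _ cH _ _) _.
- by apply: compact_setM; exact: compact_tsupport.
- exact: compact_tsupport.
- by move=> r t Kr; rewrite /H conv_integrand0r// BB0.
- by move=> r t Kt; rewrite /H conv_integrand0l// BB0.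
- congr integral_of; apply/funext => t.
  pose J r := B (alpha t (g (t^-1 * r)%g)) (Phi r).
  have JK : cc_on (setM [set t] (tsupport g)) J.
    split.
    - by apply: compact_setM; [exact: compact_set1|exact: compact_tsupport].
    - apply: (continuous_pair_comp cB _ cPhi).
      exact: (continuous_slice (h := fun r s => alpha r (g (r^-1 * s)%g))
        (@continuous_shifted g)).
    - move=> r Kr; have [_ _ g0] := Cc_on_tsupport g.
      rewrite /J g0 ?(lin0 (bounded_alpha t).1) ?BB0// => gr.
      by apply: Kr; exact: setM_mem gr.
  transitivity (integral (B (f t) \o J)).
    by congr integral_of; apply/funext => r; rewrite /H /conv_integrand BM.
  rewrite (integral_comp haar_mu (bBr _) JK) -(integral_translate haar_mu t JK).
  by congr (B _ (integral_of _ _)); apply/funext => r; rewrite /J mulKg.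
Qed.

(** At a fixed point [s], [A] acts on itself by left multiplication and the
    function to integrate against is [r |-> alpha_r (h (r^-1 s))]. *)
Lemma convolutionA f g h : conv f (conv g h) = conv (conv f g) h.
Proof.
apply: CcP => s; rewrite [RHS]convolutionE /conv_integrand.
rewrite (@integral_conv_action A (@amul R A) 1 (fun r => alpha r (h (r^-1 * s)%g))).
- rewrite convolutionE; congr integral_of; apply/funext => t.
  rewrite /conv_integrand convolutionE.
  rewrite -(integral_comp haar_mu (bounded_alpha t) (cc_on_conv_integrand g h _)).
  congr (amul _ (integral_of _ _)); apply/funext => r.
  by rewrite /= /conv_integrand alphaM -alpha_mul invgM mulgA.
- exact: linear_amulr.
- exact: linear_amul.
- by move=> a b; rewrite mul1r ler_norm_amul.
- by move=> a b c; rewrite amulA.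
- apply: (@continuous_comp_fun _ _ _ (fun r : G => (r, s))
    (fun p : G * G => alpha p.1 (h (p.1^-1 * p.2)%g))).
    by move=> r; apply: cvg_pair; [exact: cvg_id|exact: cvg_cst].
  exact: continuous_shifted.
Qed.

End Convolution.

(** * Integrated forms and the seminorm of a class *)

Section Covariant.
Context (R : realType) (A : pBanachAlgType R) (G : lcGroupType).
Context (mu : {measure set (borel G) -> \bar R}) (alpha : G -> A -> A).
Hypothesis haar_mu : left_haar mu.
Hypothesis dyn : dynamical_system alpha.
Local Notation integral F := (integral_of mu F).
Implicit Types f g : Cc A G.

Lemma left_AE a f s : left_A a f s = amul a (f s).
Proof.
by rewrite /left_A (to_CcE (cc_on_comp (bounded_amul a) (Cc_on_tsupport f))).
Qed.

Lemma cc_on_left_G r f : cc_on (setM [set r] (tsupport f))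
  (fun s => alpha r (f (r^-1 * s)%g)).
Proof.
split.
- by apply: compact_setM; [exact: compact_set1|exact: compact_tsupport].
- exact: (continuous_slice (h := fun r s => alpha r (f (r^-1 * s)%g))
    (@continuous_shifted _ _ _ _ dyn f)).
- move=> s Ks; have [_ _ f0] := Cc_on_tsupport f.
  rewrite f0 ?(lin0 (bounded_alpha dyn r).1)// => fs.
  by apply: Ks; exact: setM_mem fs.
Qed.

Lemma left_GE r f s : left_G alpha r f s = alpha r (f (r^-1 * s)%g).
Proof. by rewrite /left_G (to_CcE (cc_on_left_G r f)). Qed.

Context (X : pBanachType R) (pi : A -> X -> X) (U : G -> X -> X).
Hypothesis cov : continuous_covariant alpha pi U.
Local Notation II := (integrated_form mu pi U).

Lemma covariant_bounded_pi a : bounded_operator (pi a).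
Proof. by have [] := cov_pi cov. Qed.

Lemma covariant_linear_pi x : linear (pi^~ x).
Proof. by have [_ h _] := cov_pi cov => l a b; rewrite h. Qed.

Lemma covariant_piM a b x : pi (amul a b) x = pi a (pi b x).
Proof. by have [_ _ ->] := cov_pi cov. Qed.

Lemma covariant_pi_norm_le C a x : (forall a, opnorm (pi a) <= C * `|a|) ->
  `|pi a x| <= C * `|a| * `|x|.
Proof.
by move=> hC; apply: le_trans (le_opnorm x (covariant_bounded_pi a)) _; rewrite ler_wpM2r.
Qed.

Lemma covariant_bounded_U s : bounded_operator (U s).
Proof. by have [S []] := cov_Inv cov s. Qed.

Lemma covariant_UM s t x : U (s * t)%g x = U s (U t x).
Proof. by rewrite (cov_hom cov). Qed.

Lemma covariant_U1 x : U 1%g x = x.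
Proof.
have [S [_ _ US _]] := cov_Inv cov 1%g.
by apply: (can_inj US); rewrite -covariant_UM mulg1.
Qed.

Lemma covariant_pi_alpha_U s a x : pi (alpha s a) (U s x) = U s (pi a x).
Proof. by rewrite (cov_cov cov) /= -covariant_UM mulVg covariant_U1. Qed.

Lemma covariant_continuous_pi : continuous (fun p : A * X => pi p.1 p.2).
Proof.
have [C hC] := cov_bounded cov.
apply: (@continuous_bilinear _ _ _ _ _ C).
- exact: covariant_linear_pi.
- by move=> a; have [] := covariant_bounded_pi a.
- by move=> a x; exact: covariant_pi_norm_le.
Qed.

Lemma cc_on_form_integrand f K x : cc_on K (f : G -> A) ->
  cc_on K (fun r => pi (f r) (U r x)).
Proof.
move=> [cK cf f0]; split=> //.
  exact: (continuous_pair_comp covariant_continuous_pi cf (@cov_continuous _ _ _ _ _ _ _ cov x)).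
by move=> t Kt; rewrite f0//; exact: lin0 (covariant_linear_pi _).
Qed.

Local Notation cc f x := (cc_on_form_integrand x (Cc_on_tsupport f)).

Lemma linear_form f : linear (II f).
Proof.
move=> l x y; rewrite /integrated_form.
rewrite -(integral_ofZ haar_mu l (cc f x)) -(integral_ofD haar_mu (cc_onZ l (cc f x)) (cc f y)).
by congr integral_of; apply/funext => r; rewrite (covariant_bounded_U r).1 (covariant_bounded_pi _).1.
Qed.

Lemma form_norm_le f K x (C M N : R) : cc_on K (f : G -> A) -> 0 <= C ->
  0 <= M -> 0 <= N -> (forall a y, `|pi a y| <= C * `|a| * `|y|) ->
  (forall t, `|f t| <= M) -> (forall t, K t -> `|U t x| <= N * `|x|) ->
  `|II f x| <= C * M * N * fine (mu K) * `|x|.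
Proof.
move=> fK C0 M0 N0 hC fM UN.
rewrite mulrAC; apply: (integral_norm_le haar_mu (cc_on_form_integrand x fK)).
  by rewrite !mulr_ge0.
move=> t Kt; apply: le_trans (hC _ _) _.
rewrite -!mulrA ler_wpM2l// ler_pM//; exact: UN.
Qed.

Lemma bounded_form f : bounded_operator (II f).
Proof.
split; first exact: linear_form.
have [C hC] := cov_bounded cov; have [M M0 fM] := Cc_norm_bounded f.
have [N N0 UN] := locally_bounded covariant_bounded_U (@cov_continuous _ _ _ _ _ _ _ cov)
  (@compact_tsupport _ _ _ f).
exists (`|C| * M * N * fine (mu (tsupport f))) => x.
apply: form_norm_le => //; first exact: Cc_on_tsupport.
  move=> a y; apply: le_trans (covariant_pi_norm_le a y hC) _.
  by rewrite -!mulrA ler_wpM2r ?mulr_ge0// ler_norm.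
by move=> t Kt; exact: UN.
Qed.

Lemma integrated_formD f g x : II (f + g) x = II f x + II g x.
Proof.
have cU : compact (tsupport f `|` tsupport g).
  by apply: compactU; exact: compact_tsupport.
have ccU u : tsupport u `<=` tsupport f `|` tsupport g ->
    cc_on (tsupport f `|` tsupport g) (fun r => pi (u r) (U r x)).
  move=> uK; have [_ cu u0] := cc u x.
  by split=> // t Kt; apply: u0 => /uK.
rewrite /integrated_form -(integral_ofD haar_mu (ccU f _) (ccU g _)).
- by congr integral_of; apply/funext => r; rewrite CcD (linD (covariant_linear_pi _)).
- exact: subsetUl.
- exact: subsetUr.
Qed.

Lemma integrated_formZ l f x : II (l *: f) x = l *: II f x.
Proof.
rewrite /integrated_form -(integral_ofZ haar_mu l (cc f x)).
by congr integral_of; apply/funext => r; rewrite CcZ (linZ (covariant_linear_pi _)).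
Qed.

(** Here [A] acts on [X] through [pi] and the function to integrate against is the
    orbit of [x]. *)
Lemma form_conv f g x : II (convolution mu alpha f g) x = II f (II g x).
Proof.
have [C hC] := cov_bounded cov.
rewrite /integrated_form (integral_conv_action haar_mu dyn (B := pi) (C := C)).
- congr integral_of; apply/funext => t; congr pi.
  rewrite -(integral_comp haar_mu (covariant_bounded_U t) (cc g x)).
  by congr integral_of; apply/funext => r; rewrite /= covariant_UM covariant_pi_alpha_U.
- exact: covariant_linear_pi.
- by move=> a; have [] := covariant_bounded_pi a.
- by move=> a y; exact: covariant_pi_norm_le.
- exact: covariant_piM.
- exact: (cov_continuous cov).
Qed.

Lemma form_left_A a f x : II (left_A a f) x = pi a (II f x).
Proof.
rewrite /integrated_form -(integral_comp haar_mu (covariant_bounded_pi a) (cc f x)).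
by congr integral_of; apply/funext => r; rewrite left_AE covariant_piM.
Qed.

(** Translate the variable by [s] and use covariance. *)
Lemma form_left_G s f x : II (left_G alpha s f) x = U s (II f x).
Proof.
rewrite /integrated_form -(integral_comp haar_mu (covariant_bounded_U s) (cc f x)).
rewrite -(integral_translate haar_mu s (cc (left_G alpha s f) x)).
congr integral_of; apply/funext => r.
by rewrite left_GE mulKg /= covariant_UM covariant_pi_alpha_U.
Qed.

Lemma form_cone f x : closed (cone : set X) -> positive_representation pi ->
  positive_group_representation U -> Cc_cone f -> cone x -> cone (II f x).
Proof.
move=> Xcl pi0 U0 f0 x0; apply: (integral_closed_cone haar_mu (cc f x) Xcl).
- by rewrite -(scale0r x); exact: coneZ.
- exact: coneD.
- exact: coneZ.
- move=> r; have [_ +] := pi0 _ (f0 r); apply.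
  by have [S [_ h]] := U0 r; have [] := h x x0.
Qed.

End Covariant.

Section ClassSeminorm.
Context (R : realType) (A : pBanachAlgType R) (G : lcGroupType).
Context (mu : {measure set (borel G) -> \bar R}) (alpha : G -> A -> A).
Hypothesis haar_mu : left_haar mu.
Hypothesis dyn : dynamical_system alpha.
Variable Rcl : representation_class A G.
Hypothesis Rcl_nonempty : exists (X : pBanachType R) pi U, @Rcl X pi U.
Hypothesis Rcl_cov : forall (X : pBanachType R) pi U, @Rcl X pi U ->
  continuous_covariant alpha pi U.
Hypothesis Rcl_bounded : uniformly_bounded Rcl.
Implicit Types f g : Cc A G.
Local Notation sigma := (class_seminorm mu Rcl).

Lemma class_pi_bound : exists2 C, 0 <= C & forall (X : pBanachType R) pi U,
  @Rcl X pi U -> forall a x, `|pi a x| <= C * `|a| * `|x|.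
Proof.
have [C [nu [C0 _ _ hC]]] := Rcl_bounded; exists C => // X pi U RX a x.
by apply: (covariant_pi_norm_le (Rcl_cov RX)); have [] := hC _ _ _ RX.
Qed.

Lemma class_U_bound K : compact K ->
  exists2 N, 0 <= N & forall (X : pBanachType R) pi U,
  @Rcl X pi U -> forall r x, K r -> `|U r x| <= N * `|x|.
Proof.
move=> cK; have [C [nu [_ _ nuK hU]]] := Rcl_bounded; have [N nuN] := nuK K cK.
exists `|N| => // X pi U RX r x Kr.
apply: le_trans (le_opnorm x (covariant_bounded_U (Rcl_cov RX) r)) _.
rewrite ler_wpM2r//; apply: le_trans (ler_norm N).
by apply: le_trans (nuN r Kr); have [_] := hU _ _ _ RX.
Qed.

(** On functions supported in a fixed compact set all the integrated forms are
    bounded by a multiple of the supremum norm. *)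
Lemma form_le_sup K : compact K -> exists2 c, 0 <= c &
  forall (f : Cc A G) (M : R), cc_on K (f : G -> A) -> 0 <= M ->
  (forall t, `|f t| <= M) -> forall (X : pBanachType R) pi U, @Rcl X pi U ->
  forall x, `|integrated_form mu pi U f x| <= c * M * `|x|.
Proof.
move=> cK; have [C C0 hC] := class_pi_bound; have [N N0 hN] := class_U_bound cK.
exists (C * N * fine (mu K)); first by rewrite !mulr_ge0// fine_ge0.
move=> f M fK M0 fM X pi U RX x.
rewrite -(mulrAC _ M) -(mulrAC _ M); apply: (form_norm_le haar_mu (Rcl_cov RX)) => //.
  exact: hC RX.
by move=> t Kt; exact: (hN _ _ _ RX).
Qed.

Lemma form_opnorm_ub f : exists M, forall X pi U, @Rcl X pi U ->
  opnorm (integrated_form mu pi U f) <= M.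
Proof.
have [M M0 fM] := Cc_norm_bounded f.
have [c c0 hc] := form_le_sup (@compact_tsupport _ _ _ f).
exists (c * M) => X pi U RX; apply: opnorm_le; first by rewrite mulr_ge0.
by move=> x; apply: (hc _ _ (Cc_on_tsupport f) M0 fM _ _ _ RX).
Qed.

(** The supremum defining the seminorm is that of a bounded set. *)
Lemma sigma_ub f X pi U : @Rcl X pi U -> opnorm (integrated_form mu pi U f) <= sigma f.
Proof.
move=> RX; apply: ub_le_sup; last by exists X, pi, U.
by have [M hM] := form_opnorm_ub f; exists M => _ [Y [rho [V [RY ->]]]]; exact: hM.
Qed.

Lemma sigma_le f (M : R) : (forall X pi U, @Rcl X pi U ->
  opnorm (integrated_form mu pi U f) <= M) -> sigma f <= M.
Proof.
move=> hM; apply: ge_sup.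
  by have [X [pi [U RX]]] := Rcl_nonempty; exists (opnorm (integrated_form mu pi U f)), X, pi, U.
by move=> _ [X [pi [U [RX ->]]]]; exact: hM.
Qed.

Lemma sigma_ge0 f : 0 <= sigma f.
Proof.
have [X [pi [U RX]]] := Rcl_nonempty.
apply: le_trans (sigma_ub f RX); apply: opnorm_ge0.
exact: (bounded_form haar_mu (Rcl_cov RX)).
Qed.

Lemma form_le_sigma f X pi U x : @Rcl X pi U ->
  `|integrated_form mu pi U f x| <= sigma f * `|x|.
Proof.
move=> RX; apply: le_trans (le_opnorm x (bounded_form haar_mu (Rcl_cov RX) f)) _.
by rewrite ler_wpM2r//; exact: sigma_ub.
Qed.

Lemma sigma_le_pointwise f (M : R) : 0 <= M -> (forall X pi U, @Rcl X pi U ->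
  forall x, `|integrated_form mu pi U f x| <= M * `|x|) -> sigma f <= M.
Proof. by move=> M0 hM; apply: sigma_le => X pi U /hM; exact: opnorm_le. Qed.

Lemma sigma_le_sup K : compact K -> exists2 c, 0 <= c &
  forall (f : Cc A G) (M : R), cc_on K (f : G -> A) -> 0 <= M ->
  (forall t, `|f t| <= M) -> sigma f <= c * M.
Proof.
move=> /form_le_sup[c c0 hc]; exists c => // f M fK M0 fM.
by apply: sigma_le_pointwise; [rewrite mulr_ge0|exact: hc].
Qed.

Lemma sigmaZ_le l f : sigma (l *: f) <= `|l| * sigma f.
Proof.
apply: sigma_le_pointwise; first by rewrite mulr_ge0// sigma_ge0.
move=> X pi U RX x; rewrite (integrated_formZ haar_mu (Rcl_cov RX)) normrZ -mulrA ler_wpM2l//.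
exact: form_le_sigma.
Qed.

Lemma is_seminormed_algebra_Cc :
  is_seminormed_algebra (convolution mu alpha) sigma (@Cc_cone R A G).
Proof.
split.
- exact: (convolutionA haar_mu dyn).
- exact: (convolutionDl haar_mu dyn).
- exact: (convolutionDr haar_mu dyn).
- exact: (convolutionZl haar_mu dyn).
- exact: (convolutionZr haar_mu dyn).
- move=> f g; apply: sigma_le_pointwise; first by rewrite addr_ge0// sigma_ge0.
  move=> X pi U RX x; rewrite (integrated_formD haar_mu (Rcl_cov RX)) mulrDl.
  by apply: le_trans (ler_normD _ _) _; apply: lerD; exact: form_le_sigma.
- move=> l f; apply/eqP; rewrite eq_le sigmaZ_le/=.
  have [->|l0] := eqVneq l 0; first by rewrite normr0 mul0r sigma_ge0.
  have := sigmaZ_le l^-1 (l *: f); rewrite scalerA mulVf// scale1r normfV.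
  by rewrite ler_pdivlMl ?normr_gt0.
- move=> f g; apply: sigma_le_pointwise; first by rewrite mulr_ge0// sigma_ge0.
  move=> X pi U RX x; rewrite (form_conv haar_mu dyn (Rcl_cov RX)).
  apply: le_trans (form_le_sigma _ _ RX) _; rewrite -mulrA ler_wpM2l ?sigma_ge0//.
  exact: form_le_sigma.
- by move=> f g f0 g0 s; apply: coneD; [exact: f0|exact: g0].
- by move=> l f l0 f0 s; apply: coneZ => //; exact: f0.
- exact: (convolution_cone haar_mu dyn).
Qed.

End ClassSeminorm.

(** * Extension by density and the crossed product *)

Section Density.
Context (R : realType) (V : lmodType R) (B : normedModType R) (q : V -> B).

Definition dense_range := forall x (e : R), 0 < e -> exists v, `|x - q v| < e.

Hypothesis dq : dense_range.

Lemma dense_range_seq (x : B) : exists v : nat -> V, q (v n) @[n --> \oo] --> x.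
Proof.
have n0 n : 0 < n.+1%:R^-1 :> R by rewrite invr_gt0.
have [v hv] := choice (fun n => dq x (n0 n)); exists v.
apply/cvgrPdist_le => e e0.
have /cvgrPdist_le/(_ _ e0) := @cvg_harmonic R; apply: filterS => n.
rewrite sub0r normrN ger0_norm ?invr_ge0//; apply: le_trans.
exact: ltW.
Qed.

Lemma dense_range_eq (Y : normedModType R) (S T : B -> Y) : continuous S ->
  continuous T -> (forall v, S (q v) = T (q v)) -> forall x, S x = T x.
Proof.
move=> cS cT ST x; have [v vx] := dense_range_seq x.
have Sv : S (q (v n)) @[n --> \oo] --> S x by exact: cvg_comp vx (cS x).
have Tv : T (q (v n)) @[n --> \oo] --> T x by exact: cvg_comp vx (cT x).
apply: cvg_unique Sv _ => //.
by rewrite (_ : (fun n => S (q (v n))) = fun n => T (q (v n)))//; apply/funext.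
Qed.

Lemma dense_range_norm_le (Y : normedModType R) (S : B -> Y) (c : R) :
  continuous S -> (forall v, `|S (q v)| <= c * `|q v|) ->
  forall x, `|S x| <= c * `|x|.
Proof.
move=> cS Sq x; have [v vx] := dense_range_seq x; rewrite -subr_ge0.
have Sv : S (q (v n)) @[n --> \oo] --> S x by exact: cvg_comp vx (cS x).
have h : c * `|q (v n)| - `|S (q (v n))| @[n --> \oo] --> c * `|x| - `|S x|.
  apply: cvgB; last exact: cvg_norm Sv.
  by apply: cvgM; [exact: cvg_cst|apply: cvg_norm; exact: vx].
apply: (closed_cvg (fun y : R => 0 <= y) (@closed_ge _ _) _ _ h).
by apply: nearW => n; rewrite /= subr_ge0.
Qed.

Hypothesis lq : linear q.

(** The images under [phi] of approximants of [x] form a Cauchy sequence, with a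
    limit that depends on [x] only. *)
Lemma dense_extension (Y : completeNormedModType R) (phi : V -> Y) (c : R) :
  linear phi -> 0 <= c -> (forall v, `|phi v| <= c * `|q v|) ->
  exists T : B -> Y, [/\ linear T, forall x, `|T x| <= c * `|x| &
    forall v, T (q v) = phi v].
Proof.
move=> lphi c0 phic.
have c1 : 0 < c + 1 by rewrite ltr_wpDl.
have phi_dist v w : `|phi v - phi w| <= c * `|q v - q w|.
  by rewrite -(linB lphi) -(linB lq).
have cvg_phi (v : nat -> V) (x : B) : q (v n) @[n --> \oo] --> x -> cvg (phi (v n) @[n --> \oo]).
  move=> vx; apply: cauchy_cvg; apply/cauchyP => _/posnumP[e].
  have e0 : 0 < e%:num / 2 / (c + 1) by rewrite !divr_gt0.
  have /cvgrPdist_lt/(_ _ e0) near_x := vx.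
  have [m xm] := filter_ex near_x; exists (phi (v m)).
  apply: filterS near_x => n xn; rewrite /= -ball_normE/=.
  apply: le_lt_trans (phi_dist _ _) _.
  apply: (@le_lt_trans _ _ ((c + 1) * `|q (v m) - q (v n)|)).
    by rewrite ler_wpM2r// lerDl.
  rewrite mulrC -ltr_pdivlMr// -(subrK x (q (v m))) -addrA.
  apply: le_lt_trans (ler_normD _ _) _; rewrite distrC.
  by apply: lt_le_trans (ltrD xm xn) _; rewrite -mulrDl -splitr.
have [s hs] := choice dense_range_seq.
pose T x := lim (phi (s x n) @[n --> \oo]).
have TE (v : nat -> V) (x : B) : q (v n) @[n --> \oo] --> x ->
    phi (v n) @[n --> \oo] --> T x.
  move=> vx; have sx : phi (s x n) @[n --> \oo] --> T x by exact: (cvg_phi _ _ (hs x)).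
  have d0 : q (v n) - q (s x n) @[n --> \oo] --> (0 : B).
    by rewrite -(subrr x); apply: cvgB; [exact: vx|exact: hs].
  have p0 : phi (v n) - phi (s x n) @[n --> \oo] --> (0 : Y).
    apply/cvgr0Pnorm_le => e e0.
    have /cvgr0Pnorm_le/(_ _ (divr_gt0 e0 c1)) := d0; apply: filterS => n dn.
    apply: le_trans (phi_dist _ _) _.
    apply: (@le_trans _ _ ((c + 1) * `|q (v n) - q (s x n)|)).
      by rewrite ler_wpM2r// lerDl.
    by rewrite mulrC -ler_pdivlMr.
  rewrite -[T x]add0r (_ : (fun n => phi (v n)) =
    fun n => (phi (v n) - phi (s x n)) + phi (s x n)); first exact: cvgD.
  by apply/funext => n; rewrite subrK.
exists T; split.
- move=> l x y.
  have h : phi (l *: s x n + s y n) @[n --> \oo] --> T (l *: x + y).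
    apply: (TE (fun n => l *: s x n + s y n)); under eq_fun do rewrite lq.
    by apply: cvgD; [apply: cvgZl_tmp; exact: hs|exact: hs].
  move: h; under eq_fun do rewrite lphi.
  move=> h; apply: cvg_unique h _ => //.
  by apply: cvgD; [apply: cvgZl_tmp; apply: TE; exact: hs|apply: TE; exact: hs].
- move=> x; rewrite -subr_ge0.
  have h : c * `|q (s x n)| - `|phi (s x n)| @[n --> \oo] --> c * `|x| - `|T x|.
    apply: cvgB; last by apply: cvg_norm; apply: TE; exact: hs.
    by apply: cvgM; [exact: cvg_cst|apply: cvg_norm; exact: hs].
  apply: (closed_cvg (fun y : R => 0 <= y) (@closed_ge _ _) _ _ h).
  by apply: nearW => n; rewrite /= subr_ge0.
- move=> v; have k : phi v @[_ --> \oo] --> phi v by exact: cvg_cst.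
  have h : phi v @[_ --> \oo] --> T (q v).
    by apply: (TE (fun=> v)); exact: cvg_cst.
  by apply: cvg_unique h k.
Qed.

End Density.

Section CrossedMap.
Context (R : realType) (A : pBanachAlgType R) (G : lcGroupType).
Context (mu : {measure set (borel G) -> \bar R}) (alpha : G -> A -> A).
Context (Rcl : representation_class A G).
Local Notation sigma := (class_seminorm mu Rcl).

(** The properties of the quotient map into the crossed product that determine
    it; the arguments below use nothing else about the completion. *)
Record crossed_map (B : pBanachAlgType R) (q : Cc A G -> B) : Prop := {
  crossed_linear : linear q;
  crossed_norm : forall f, `|q f| = sigma f;
  crossed_mul : forall f g, q (convolution mu alpha f g) = amul (q f) (q g);
  crossed_dense : dense_range q;
  crossed_cone : cone = closure (q @` @Cc_cone R A G)
}.

Lemma seminormed_algebra_ofE (V : lmodType R) (m : V -> V -> V) (p : V -> R)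
    (P : set V) (h : is_seminormed_algebra m p P) :
  exists h', seminormed_algebra_of m p P = @SeminormedAlgebra R V m p P h'.
Proof. by rewrite /seminormed_algebra_of; case: pselect => // h'; exists h'. Qed.

(** The completion is formed from the intended data as soon as these form a
    seminormed algebra; otherwise it would be formed from the zero structure. *)
Lemma crossed_map_quotient :
  is_seminormed_algebra (convolution mu alpha) sigma (@Cc_cone R A G) ->
  crossed_map (quotient_map mu alpha Rcl).
Proof.
move=> /seminormed_algebra_ofE[h dE].
rewrite /quotient_map /crossed_product dE.
split.
- exact: completion_map_linear.
- exact: norm_completion_map.
- exact: completion_mapM.
- exact: completion_map_approx.
- by [].
Qed.

End CrossedMap.

(** * The canonical covariant representation on the crossed product *)

Section LeftOperators.
Context (R : realType) (A : pBanachAlgType R) (G : lcGroupType).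
Context (mu : {measure set (borel G) -> \bar R}) (alpha : G -> A -> A).
Hypothesis haar_mu : left_haar mu.
Hypothesis dyn : dynamical_system alpha.
Implicit Types f g : Cc A G.

Lemma left_A_linear a : linear (left_A a : Cc A G -> Cc A G).
Proof.
move=> l f g; apply: CcP => s; apply: etrans (left_AE _ _ _) _.
apply: etrans (linear_amul a l (f s) (g s)) _.
by congr (_ *: _ + _); apply: esym; exact: left_AE.
Qed.

Lemma left_A_linearl l a b f : left_A (l *: a + b) f = l *: left_A a f + left_A b f.
Proof.
apply: CcP => s; apply: etrans (left_AE _ _ _) _.
apply: etrans (linear_amulr (f s) l a b) _.
by congr (_ *: _ + _); apply: esym; exact: left_AE.
Qed.

Lemma left_A_mul a b f : left_A (amul a b) f = left_A a (left_A b f).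
Proof.
apply: CcP => s; apply: etrans (left_AE _ _ _) _.
apply: etrans _ (esym (left_AE _ _ _)).
by rewrite -amulA; congr amul; apply: esym; exact: left_AE.
Qed.

Lemma left_G_linear r : linear (left_G alpha r : Cc A G -> Cc A G).
Proof.
move=> l f g; apply: CcP => s; apply: etrans (left_GE dyn _ _ _) _.
apply: etrans ((bounded_alpha dyn r).1 l (f _) (g _)) _.
by congr (_ *: _ + _); apply: esym; exact: left_GE.
Qed.

Lemma left_G_mul r s f : left_G alpha (r * s)%g f = left_G alpha r (left_G alpha s f).
Proof.
apply: CcP => t; apply: etrans (left_GE dyn _ _ _) _.
apply: etrans _ (esym (left_GE dyn _ _ _)).
rewrite (alpha_mul dyn); congr alpha; apply: etrans _ (esym (left_GE dyn _ _ _)).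
by rewrite invgM mulgA.
Qed.

Lemma left_G1 f : left_G alpha 1%g f = f.
Proof.
apply: CcP => t; apply: etrans (left_GE dyn _ _ _) _.
by rewrite (alpha1 dyn) invg1 mul1g.
Qed.

Lemma left_A_alpha s a f : left_A (alpha s a) (left_G alpha s f) =
  left_G alpha s (left_A a f).
Proof.
apply: CcP => t; apply: etrans (left_AE _ _ _) _.
apply: etrans _ (esym (left_GE dyn _ _ _)).
apply: etrans (congr1 _ (left_GE dyn _ _ _)) _.
by rewrite -(alphaM dyn); congr alpha; apply: esym; exact: left_AE.
Qed.

Lemma left_A_cone a f : cone a -> Cc_cone f -> Cc_cone (left_A a f).
Proof.
move=> a0 f0 s; rewrite /mkset (left_AE a f s); apply: cone_amul => //; exact: f0.
Qed.

Lemma left_G_cone s f : Cc_cone f -> Cc_cone (left_G alpha s f).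
Proof.
move=> f0 t; rewrite (left_GE dyn s f t); apply: (alpha_cone dyn); exact: f0.
Qed.

Context (Rcl : representation_class A G).
Hypothesis Rcl_nonempty : exists (X : pBanachType R) pi U, @Rcl X pi U.
Hypothesis Rcl_cov : forall (X : pBanachType R) pi U, @Rcl X pi U ->
  continuous_covariant alpha pi U.
Hypothesis Rcl_bounded : uniformly_bounded Rcl.
Local Notation sigma := (class_seminorm mu Rcl).

Let sigma0 := sigma_ge0 haar_mu Rcl_nonempty Rcl_cov Rcl_bounded.
Let form_sigma := form_le_sigma haar_mu Rcl_cov Rcl_bounded.

Lemma sigma_left_A_le : exists2 C, 0 <= C &
  forall a f, sigma (left_A a f) <= C * `|a| * sigma f.
Proof.
have [C C0 hC] := class_pi_bound Rcl_cov Rcl_bounded; exists C => // a f.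
apply: (sigma_le_pointwise Rcl_nonempty); first by rewrite !mulr_ge0.
move=> X pi U RX x; rewrite (form_left_A haar_mu (Rcl_cov RX)).
apply: le_trans (hC _ _ _ RX _ _) _; rewrite -[leRHS]mulrA ler_wpM2l ?mulr_ge0//.
exact: form_sigma.
Qed.

Lemma sigma_left_G_le K : compact K -> exists2 N, 0 <= N &
  forall r f, K r -> sigma (left_G alpha r f) <= N * sigma f.
Proof.
move=> cK; have [N N0 hN] := class_U_bound Rcl_cov Rcl_bounded cK; exists N => // r f Kr.
apply: (sigma_le_pointwise Rcl_nonempty); first by rewrite !mulr_ge0.
move=> X pi U RX x; rewrite (form_left_G haar_mu dyn (Rcl_cov RX)).
apply: le_trans (hN _ _ _ RX _ _ Kr) _; rewrite -[leRHS]mulrA ler_wpM2l//.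
exact: form_sigma.
Qed.

Context (B : pBanachAlgType R) (q : Cc A G -> B).
Hypothesis hq : crossed_map mu alpha Rcl q.
Let lq := crossed_linear hq.
Let dq := crossed_dense hq.

(** This is how operators on C_c(G, A) that are bounded for the seminorm act on the
    crossed product. *)
Lemma crossed_extension (S : Cc A G -> Cc A G) (c : R) : linear S -> 0 <= c ->
  (forall f, sigma (S f) <= c * sigma f) ->
  exists L : B -> B, bounded_operator L /\ forall f, L (q f) = q (S f).
Proof.
move=> lS c0 hS; have [|//|f|L [lL bL Lq]] := @dense_extension _ _ _ _ dq lq B (q \o S) c.
- by move=> l f g; rewrite /= lS lq.
- by rewrite /= !(crossed_norm hq); exact: hS.
by exists L; split=> //; split=> //; exists c.
Qed.

Lemma exists_left_A a : exists L : B -> B,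
  bounded_operator L /\ forall f, L (q f) = q (left_A a f).
Proof.
have [C C0 hC] := sigma_left_A_le.
apply: (@crossed_extension _ (C * `|a|)); [exact: left_A_linear|by rewrite mulr_ge0|].
exact: hC.
Qed.

Lemma exists_left_G r : exists L : B -> B,
  bounded_operator L /\ forall f, L (q f) = q (left_G alpha r f).
Proof.
have [N N0 hN] := sigma_left_G_le (@compact_set1 _ r).
apply: (@crossed_extension _ N) => //; first exact: left_G_linear.
by move=> f; exact: hN.
Qed.

(** The norm of the crossed product is the supremum of the norms of the
    integrated forms, which therefore separate its points. *)
Lemma forms_separate (b b' : B) :
  (forall (X : pBanachType R) pi U (RX : @Rcl X pi U) x (Phi : B -> X),
    bounded_operator Phi -> (forall f, Phi (q f) = integrated_form mu pi U f x) ->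
    Phi b = Phi b') -> b = b'.
Proof.
move=> bb'; apply: (@eq_dist_le _ _ _ _ 2) => // e e0.
have [f fe] := dq (b - b') e0.
(* All forms vanish on [b - b'], so they are small on its approximant [q f]. *)
have sf : sigma f <= e.
  apply: (sigma_le_pointwise Rcl_nonempty); first exact: ltW.
  move=> X pi U RX x.
  have [||g|Phi [lPhi bPhi Phiq]] := @dense_extension _ _ _ _ dq lq X
      (fun f => integrated_form mu pi U f x) `|x|.
  - by move=> l g h; rewrite (integrated_formD haar_mu (Rcl_cov RX)) (integrated_formZ haar_mu (Rcl_cov RX)).
  - by [].
  - by rewrite mulrC (crossed_norm hq); exact: form_sigma.
  have bP : bounded_operator Phi by split=> //; exists `|x|.
  have E : Phi (b - b') = 0.
    by rewrite (linB lPhi) (bb' _ _ _ RX x Phi bP Phiq) subrr.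
  rewrite -Phiq -[Phi _]subr0 -E -(linB lPhi) mulrC.
  apply: le_trans (bPhi _) _; rewrite ler_wpM2l// distrC; exact: ltW.
rewrite -(subrK (q f) (b - b')); apply: le_trans (ler_normD _ _) _.
by rewrite (crossed_norm hq) mulrDr mulr1; apply: lerD => //; exact: ltW.
Qed.

Context (iA : A -> B -> B) (iG : G -> B -> B).
Hypothesis biA : forall a, bounded_operator (iA a).
Hypothesis biG : forall r, bounded_operator (iG r).
Hypothesis iAq : forall a f, iA a (q f) = q (left_A a f).
Hypothesis iGq : forall r f, iG r (q f) = q (left_G alpha r f).

Lemma iA_norm_le : exists2 C, 0 <= C & forall a b, `|iA a b| <= C * `|a| * `|b|.
Proof.
have [C C0 hC] := sigma_left_A_le; exists C => // a.
apply: (dense_range_norm_le dq) => [|f]; first exact: bounded_operator_continuous.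
by rewrite iAq !(crossed_norm hq); exact: hC.
Qed.

Lemma iG_norm_le K : compact K -> exists2 N, 0 <= N &
  forall r b, K r -> `|iG r b| <= N * `|b|.
Proof.
move=> cK; have [N N0 hN] := sigma_left_G_le cK; exists N => // r b Kr; move: b.
apply: (dense_range_norm_le dq) => [|f]; first exact: bounded_operator_continuous.
by rewrite iGq !(crossed_norm hq); exact: hN.
Qed.

(** Operators on [B] need only be compared on the range of [q]. *)
Lemma crossed_eq (Y : normedModType R) (S T : B -> Y) : bounded_operator S ->
  bounded_operator T -> (forall f, S (q f) = T (q f)) -> S = T.
Proof.
move=> bS bT ST; apply/funext; apply: (dense_range_eq dq) => //;
  exact: bounded_operator_continuous.
Qed.

Lemma iA_linear : linear iA.
Proof.
move=> l a b; apply: crossed_eq => // [|f]; first exact: bounded_operator_lin.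
by rewrite iAq left_A_linearl lq -!iAq.
Qed.

Lemma iA_mul a b : iA (amul a b) = iA a \o iA b.
Proof.
apply: crossed_eq => // [|f]; first exact: bounded_operator_comp.
by rewrite /= !iAq left_A_mul.
Qed.

Lemma iG_mul r s : iG (r * s)%g = iG r \o iG s.
Proof.
apply: crossed_eq => // [|f]; first exact: bounded_operator_comp.
by rewrite /= !iGq left_G_mul.
Qed.

Lemma iG1 b : iG 1%g b = b.
Proof.
rewrite (_ : iG 1%g = id)//; apply: crossed_eq => // [|f].
  by split=> //; exists 1 => x; rewrite mul1r.
by rewrite iGq left_G1.
Qed.

Lemma iG_inverse r : inverse_operators (iG r) (iG r^-1%g).
Proof.
split=> // b.
  by have := iG_mul r^-1%g r; rewrite mulVg => /(congr1 (@^~ b))/=; rewrite iG1.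
by have := iG_mul r r^-1%g; rewrite mulgV => /(congr1 (@^~ b))/=; rewrite iG1.
Qed.

Lemma iA_alpha s a : iA (alpha s a) = iG s \o iA a \o iG s^-1%g.
Proof.
have [_ _ _ GK] := iG_inverse s.
have E : iA (alpha s a) \o iG s = iG s \o iA a.
  apply: crossed_eq => [||f]; [exact: bounded_operator_comp..|].
  by rewrite /= iGq !iAq left_A_alpha iGq.
by apply/funext => b; rewrite -E /= GK.
Qed.

(** For [s] near [s0] the translates are supported in a common compact set, on
    which they converge uniformly. *)
Lemma sigma_left_G_continuous f (s0 : G) (e : R) : 0 < e ->
  \forall s \near s0, sigma (left_G alpha s f - left_G alpha s0 f) <= e.
Proof.
move=> e0; have [C [nC cC]] := compact_nbhs s0.
pose K := setM C (tsupport f).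
have cK : compact K by apply: compact_setM => //; exact: compact_tsupport.
have [c c0 hc] := sigma_le_sup haar_mu Rcl_nonempty Rcl_cov Rcl_bounded cK.
have c1 : 0 < c + 1 by rewrite ltr_wpDl.
have := near_uniform_on_compact (H := fun r t => alpha r (f (r^-1 * t)%g)) s0 cK
  (@continuous_shifted _ _ _ _ dyn f) (divr_gt0 e0 c1).
move=> near_s0; apply: filterS (filterI nC near_s0) => s [Cs sK].
have ccK r : C r -> cc_on K (left_G alpha r f : G -> A).
  move=> Cr; split=> //; first exact: Cc_continuous.
  move=> t Kt; rewrite (left_GE dyn r f t).
  have [_ _ f0] := Cc_on_tsupport f.
  rewrite f0 ?(lin0 (bounded_alpha dyn r).1)// => ft.
  by apply: Kt; exact: setM_mem Cr ft.
have Cs0 : C s0 := nbhs_singleton nC.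
apply: le_trans (hc _ (e / (c + 1)) _ _ _) _.
- have := cc_onB (ccK s Cs) (ccK s0 Cs0); exact.
- by rewrite ltW// divr_gt0.
- move=> t; have [Kt|Kt] := pselect (K t).
    by have := sK t Kt; rewrite -(left_GE dyn s f t) -(left_GE dyn s0 f t).
  have [_ _ z] := ccK s Cs; have [_ _ z0] := ccK s0 Cs0.
  apply: (@le_trans _ _ `|left_G alpha s f t - left_G alpha s0 f t|) => //.
  by rewrite z// z0// subrr normr0 divr_ge0// ltW.
- by rewrite mulrA ler_pdivrMr// mulrC ler_pM2l// lerDl.
Qed.

(** Strong continuity passes from the dense range of [q] to [B] because [iG] is
    locally bounded. *)
Lemma iG_continuous b : continuous (fun s => iG s b).
Proof.
move=> s0; apply/cvgrPdist_le => e e0; have [C [nC cC]] := compact_nbhs s0.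
have [N N0 hN] := iG_norm_le cC.
have e3 : 0 < e / 3 by rewrite divr_gt0.
have N1 : 0 < N + 1 by rewrite ltr_wpDl.
have [f fb] := dq b (divr_gt0 e3 N1).
have Nf : N * `|b - q f| <= e / 3.
  apply: (@le_trans _ _ ((N + 1) * `|b - q f|)); first by rewrite ler_wpM2r// lerDl.
  by rewrite mulrC -ler_pdivlMr// ltW.
apply: filterS (filterI nC (sigma_left_G_continuous f s0 e3)) => s [Cs sf].
have Cs0 : C s0 := nbhs_singleton nC.
have -> : iG s0 b - iG s b = iG s0 (b - q f) - (iG s (b - q f) +
    q (left_G alpha s f - left_G alpha s0 f)).
  rewrite (linB (biG s0).1) (linB (biG s).1) (linB lq) -!iGq.
  by rewrite addrA subrK opprB addrA subrK.
apply: le_trans (ler_normB _ _) _.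
have -> : e = e / 3 + (e / 3 + e / 3) by lra.
apply: lerD; first exact: le_trans (hN _ _ Cs0) Nf.
apply: le_trans (ler_normD _ _) _.
apply: lerD; first exact: le_trans (hN _ _ Cs) Nf.
by rewrite (crossed_norm hq).
Qed.

Lemma iAG_covariant : continuous_covariant alpha iA iG.
Proof.
split.
- by split; [exact: biA|exact: iA_linear|exact: iA_mul].
- by move=> s; exists (iG s^-1%g); exact: iG_inverse.
- exact: iG_mul.
- exact: iA_alpha.
- have [C C0 hC] := iA_norm_le; exists C => a; apply: opnorm_le.
    by rewrite mulr_ge0.
  exact: hC.
- exact: iG_continuous.
Qed.

(** Tested with the integrated form of a member of the class, both sides
    become the product of the integrated forms of [f] and [g]. *)
Lemma iAG_integrated f b : integrated_form mu iA iG f b = amul (q f) b.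
Proof.
move: b; apply: (dense_range_eq dq).
- exact/bounded_operator_continuous/(bounded_form haar_mu iAG_covariant).
- exact/bounded_operator_continuous/bounded_amul.
move=> g; apply: forms_separate => X pi U RX x Phi bPhi Phiq.
have cov := Rcl_cov RX.
have cc := cc_on_form_integrand iAG_covariant (q g) (Cc_on_tsupport f).
rewrite -(crossed_mul hq) Phiq (form_conv haar_mu dyn cov).
rewrite /integrated_form -(integral_comp haar_mu bPhi cc).
congr integral_of; apply/funext => r /=.
by rewrite iGq iAq Phiq (form_left_A haar_mu cov) (form_left_G haar_mu dyn cov).
Qed.

(** The norm of left multiplication by [q f] is at most that of [q f], which is
    the seminorm of [f]. *)
Lemma iAG_class_continuous : class_continuous mu alpha Rcl iA iG.
Proof.
split; first exact: iAG_covariant.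
exists 1 => f; apply: opnorm_le; first by rewrite mul1r sigma0.
by move=> b; rewrite iAG_integrated mul1r -(crossed_norm hq); exact: ler_norm_amul.
Qed.

Lemma crossed_cone_map (S : B -> B) (T : Cc A G -> Cc A G) : continuous S ->
  (forall f, S (q f) = q (T f)) -> (forall f, Cc_cone f -> Cc_cone (T f)) ->
  forall b, cone b -> cone (S b).
Proof.
move=> cS ST T0 b; rewrite (crossed_cone hq) => b0.
move=> V /(cS b)/b0[_ [[f f0 <-] SV]].
by exists (S (q f)); split=> //; rewrite ST; exists (T f) => //; exact: T0.
Qed.

Lemma iA_positive : positive_representation iA.
Proof.
move=> a a0; split=> //; apply: (@crossed_cone_map _ (left_A a)).
- exact: bounded_operator_continuous.
- exact: iAq.
- by move=> f; exact: left_A_cone.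
Qed.

Lemma iG_positive : positive_group_representation iG.
Proof.
have h s b : cone b -> cone (iG s b).
  apply: (@crossed_cone_map _ (left_G alpha s)).
  - exact: bounded_operator_continuous.
  - exact: iGq.
  - by move=> f; exact: left_G_cone.
by move=> s; exists (iG s^-1%g); split; [exact: iG_inverse|move=> b b0; split; exact: h].
Qed.

(** The approximate left identity converges uniformly on the compact image of [f],
    being bounded. *)
Lemma left_A_approximate (I : Type) (F : set_system I) (u : I -> A) (M : R)
  f (e : R) : ProperFilter F -> (forall i, `|u i| <= M) ->
  (forall a, amul (u i) a @[i --> F] --> a) -> 0 < e ->
  exists i, sigma (left_A (u i) f - f) <= e.
Proof.
move=> FF uM ua e0; have [cK cf f0] := Cc_on_tsupport f.
have [c c0 hc] := sigma_le_sup haar_mu Rcl_nonempty Rcl_cov Rcl_bounded cK.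
have c1 : 0 < c + 1 by rewrite ltr_wpDl.
pose d := e / (c + 1); have d0 : 0 < d by rewrite divr_gt0.
have M0 : 0 <= M by have [i _] := filter_ex (@filterT _ F _); exact: le_trans (uM i).
have near_u : \forall i \near F, forall t, tsupport f t -> `|amul (u i) (f t) - f t| <= d.
  apply: (iffLR (compact_near_coveringP _) cK _ _
    (fun i t => `|amul (u i) (f t) - f t| <= d)) => t _.
  have d3 : 0 < d / 3 by rewrite divr_gt0.
  have M1 : 0 < M + 1 by rewrite ltr_wpDl.
  have near_t : \forall t' \near t, `|f t - f t'| <= d / 3 /\ `|f t - f t'| <= d / 3 / (M + 1).
    have h := iffLR (cvgrPdist_le _ _) (cf t).
    by apply: filterI; apply: h; rewrite ?divr_gt0.
  have near_i : \forall i \near F, `|f t - amul (u i) (f t)| <= d / 3.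
    exact: (iffLR (cvgrPdist_le _ _) (ua (f t))).
  exists ([set t' | `|f t - f t'| <= d / 3 /\ `|f t - f t'| <= d / 3 / (M + 1)],
    [set i | `|f t - amul (u i) (f t)| <= d / 3]) => // -[t' i] /= [[h1 h2] h3].
  have -> : amul (u i) (f t') - f t' = (f t - f t') -
      (amul (u i) (f t - f t') + (f t - amul (u i) (f t))).
    rewrite (linB (linear_amul (u i))) [X in _ = _ - X]addrC [X in _ = _ - X]addrA subrK.
    by rewrite opprB [RHS]addrC addrA subrK.
  apply: le_trans (ler_normB _ _) _.
  have -> : d = d / 3 + (d / 3 + d / 3) by lra.
  apply: lerD => //; apply: le_trans (ler_normD _ _) _; apply: lerD => //.
  apply: le_trans (ler_norm_amul _ _) _.
  apply: (@le_trans _ _ ((M + 1) * `|f t - f t'|)).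
    by rewrite ler_wpM2r// (le_trans (uM i))// lerDl.
  by rewrite mulrC -ler_pdivlMr.
have [i ui] := filter_ex near_u; exists i.
apply: le_trans (hc _ d _ _ _) _.
- have ccu : cc_on (tsupport f) (left_A (u i) f : G -> A).
    split=> //; first exact: Cc_continuous.
    by move=> t Kt; rewrite (left_AE (u i) f t) f0// amul0.
  exact: cc_onB ccu (Cc_on_tsupport f).
- exact: ltW.
- move=> t; apply: (@le_trans _ _ `|amul (u i) (f t) - f t|).
    by rewrite -(left_AE (u i) f t).
  have [Kt|Kt] := pselect (tsupport f t); first exact: ui.
  by rewrite f0// amul0 subrr normr0 ltW.
- by rewrite /d mulrA ler_pdivrMr// mulrC ler_pM2l// lerDl.
Qed.

Lemma iA_nondegenerate : positive_bounded_approximate_left_identity A ->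
  nondegenerate_representation iA.
Proof.
move=> [I [F [u [FF [M uM] _ ua]]]]; apply/seteqP; split=> // b _ V /nbhs_ballP[e /= e0 eV].
have e2 : 0 < e / 2 by rewrite divr_gt0.
have [f fb] := dq b e2.
have [i ui] := left_A_approximate f FF uM ua e2.
exists (iA (u i) (q f)); split.
  exists 1%N, (fun=> 1), (fun=> iA (u i) (q f)); split.
    by move=> _; exists (u i), (q f).
  by rewrite big_ord_recl big_ord0 scale1r addr0.
apply: eV; rewrite -ball_normE /=.
rewrite -(subrK (q f) b) -addrA (splitr e); apply: le_lt_trans (ler_normD _ _) _.
apply: ltr_leD => //; rewrite iAq distrC -(linB lq) (crossed_norm hq).
exact: ui.
Qed.

End LeftOperators.

(** * The regular representation of the crossed product *)

Section RegularNorm.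
Context (R : realType) (A : pBanachAlgType R) (G : lcGroupType).
Context (mu : {measure set (borel G) -> \bar R}) (alpha : G -> A -> A).
Hypothesis haar_mu : left_haar mu.
Hypothesis dyn : dynamical_system alpha.

(** The convergence is clear on vectors [pi a y] and on their span, which is
    dense; boundedness does the rest. *)
Lemma approximate_identity_representation (X : pBanachType R) (pi : A -> X -> X)
  (C : R) (I : Type) (F : set_system I) (u : I -> A) (M : R) :
  representation pi -> 0 <= C -> (forall a x, `|pi a x| <= C * `|a| * `|x|) ->
  nondegenerate_representation pi -> ProperFilter F ->
  (forall i, `|u i| <= M) -> (forall a, amul (u i) a @[i --> F] --> a) ->
  forall x, pi (u i) x @[i --> F] --> x.
Proof.
move=> [bpi lpi covariant_piM] C0 hC nd FF uM ua x.
have M0 : 0 <= M by have [i _] := filter_ex (@filterT _ F _); exact: le_trans (uM i).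
have lpix y : linear (pi^~ y) by move=> l a b; rewrite lpi.
pose good := [set y | pi (u i) y @[i --> F] --> y].
have good_span : linear_span [set y | exists a x, y = pi a x] `<=` good.
  apply: linear_span_sub.
  - rewrite /good/= (_ : (fun i => _) = fun=> 0); first exact: cvg_cst.
    by apply/funext => i; rewrite (lin0 (bpi _).1).
  - move=> l y z gy gz; rewrite /good/=.
    rewrite (_ : (fun i => _) = fun i => l *: pi (u i) y + pi (u i) z).
      by apply: cvgD; [apply: cvgZl_tmp; exact: gy|exact: gz].
    by apply/funext => i; rewrite (bpi _).1.
  - move=> _ [a [z ->]]; rewrite /good/=.
    rewrite (_ : (fun i => _) = fun i => pi (amul (u i) a) z); last first.
      by apply/funext => i; rewrite covariant_piM.
    have cz : continuous (pi^~ z).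
      apply: bounded_operator_continuous; split=> //; exists (C * `|z|) => b.
      by rewrite mulrAC.
    exact: cvg_comp (ua a) (cz a).
have : closure (linear_span [set y | exists a x, y = pi a x]) x by rewrite nd.
move=> xcl; apply/cvgrPdist_le => e e0.
have e3 : 0 < e / 3 by rewrite divr_gt0.
have c1 : 0 < C * M + 1 by rewrite ltr_wpDl// mulr_ge0.
pose d := Num.min (e / 3) (e / 3 / (C * M + 1)).
have d0 : 0 < d by rewrite lt_min e3 divr_gt0.
have [y [/good_span gy]] := xcl _ (nbhsx_ballx x d d0).
rewrite -ball_normE/= lt_min => /andP[xy1 xy2].
apply: filterS (iffLR (cvgrPdist_le _ _) gy _ e3) => i yi.
have -> : x - pi (u i) x = (x - y) - (pi (u i) (x - y) - (y - pi (u i) y)).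
  rewrite (linB (bpi (u i)).1) (opprB y) [X in _ = _ - X]addrA subrK.
  by rewrite opprB addrA subrK.
apply: le_trans (ler_normB _ _) _.
have -> : e = e / 3 + (e / 3 + e / 3) by lra.
apply: lerD; first exact: ltW.
apply: le_trans (ler_normB _ _) _; apply: lerD => //.
apply: le_trans (hC _ _) _.
apply: (@le_trans _ _ ((C * M + 1) * `|x - y|)); last first.
  by rewrite mulrC -ler_pdivlMr// ltW.
rewrite ler_wpM2r//; apply: (@le_trans _ _ (C * M)); last by rewrite lerDl.
by rewrite ler_wpM2l.
Qed.

Context (Rcl : representation_class A G).
Hypothesis Rcl_nonempty : exists (X : pBanachType R) pi U, @Rcl X pi U.
Hypothesis Rcl_cov : forall (X : pBanachType R) pi U, @Rcl X pi U ->
  continuous_covariant alpha pi U.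
Hypothesis Rcl_nondegenerate : forall (X : pBanachType R) pi U, @Rcl X pi U ->
  nondegenerate_representation pi.
Hypothesis Rcl_bounded : uniformly_bounded Rcl.
Hypothesis bai_A : positive_bounded_approximate_left_identity A.
Local Notation sigma := (class_seminorm mu Rcl).

(** The functions [phi (r) u_i], with [phi] a bump of integral one near the
    unit, form a bounded approximate left identity of the crossed product in
    the strong operator topology of every member of the class. *)
Lemma exists_approximate_unit : exists2 M, 0 <= M &
  forall X pi U (RX : @Rcl X pi U) x (e : R), 0 < e ->
  exists w : Cc A G, sigma w <= M /\ `|integrated_form mu pi U w x - x| <= e.
Proof.
have [I [F [u [FF [Mu uM] _ ua]]]] := bai_A.
have Mu0 : 0 <= Mu by have [i _] := filter_ex (@filterT _ F _); exact: le_trans (uM i).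
have [C C0 hC] := class_pi_bound Rcl_cov Rcl_bounded.
have [D [nD cD]] := compact_nbhs (1%g : G).
have [N N0 hN] := class_U_bound Rcl_cov Rcl_bounded cD.
exists (C * Mu * N); first by rewrite !mulr_ge0.
move=> X pi U RX x e e0; have cov := Rcl_cov RX.
have e2 : 0 < e / 2 by rewrite divr_gt0.
have c1 : 0 < C * Mu + 1 by rewrite ltr_wpDl// mulr_ge0.
pose d := e / 2 / (C * Mu + 1); have d0 : 0 < d by rewrite divr_gt0.
pose V := D `&` [set r | `|U r x - x| <= d].
have nV : nbhs 1%g V.
  apply: filterI => //.
  apply: filterS (iffLR (cvgrPdist_le _ _) (@cov_continuous _ _ _ _ _ _ _ cov x 1%g) _ d0).
  by move=> r /=; rewrite (covariant_U1 cov) distrC.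
have [K [phi [phiK phi0 phiV phi1]]] := exists_bump haar_mu nV.
have [i ui] : exists i, `|x - pi (u i) x| <= e / 2.
  have h : pi (u i) x @[i --> F] --> x.
    exact: (approximate_identity_representation (cov_pi cov) C0 (hC _ _ _ RX)
      (Rcl_nondegenerate RX) FF uM ua).
  exact: filter_ex (iffLR (cvgrPdist_le _ _) h _ e2).
have [cK cphi phiK0] := phiK.
have wK : cc_on K (fun r => phi r *: u i).
  split=> //; last by move=> r /phiK0 ->; rewrite scale0r.
  by move=> r; apply: cvgZr_tmp; exact: cphi.
have wE : to_Cc (fun r => phi r *: u i) = (fun r => phi r *: u i) :> (G -> A) := to_CcE wK.
pose w := to_Cc (fun r => phi r *: u i).
have wr r : w r = phi r *: u i by rewrite /w wE.
have wcc : cc_on K (w : G -> A) by rewrite /w wE.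
exists w; split.
  apply: (sigma_le_pointwise Rcl_nonempty); first by rewrite !mulr_ge0.
  move=> Y rho W RY y; have covY := Rcl_cov RY.
  have ccY := cc_on_form_integrand covY y wcc.
  pose c := C * Mu * N * `|y|.
  have phic : cc_on K (fun r => c *: (phi r : R)) by exact: cc_onZ.
  have -> : C * Mu * N * `|y| = integral_of mu (fun r => c *: (phi r : R)).
    by rewrite (integral_ofZ haar_mu c phiK) phi1 /GRing.scale/= mulr1.
  apply: (integral_norm_le_integral haar_mu ccY phic) => r.
  have [Vr|/phiV pr] := pselect (V r); last first.
    by rewrite wr pr scale0r (lin0 (covariant_linear_pi covY _)) normr0 scaler0.
  apply: le_trans (hC _ _ _ RY _ _) _.
  rewrite wr normrZ (ger0_norm (phi0 r)) /GRing.scale/= /c.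
  have -> : C * Mu * N * `|y| * phi r = C * (phi r * Mu) * (N * `|y|) by ring.
  apply: ler_pM => //; first by rewrite !mulr_ge0.
    by rewrite ler_wpM2l// ler_wpM2l.
  exact: (hN _ _ _ RY r y Vr.1).
have ccw := cc_on_form_integrand cov x wcc.
have bup : bounded_operator (fun l : R => l *: pi (u i) x).
  by split; [move=> k l m; rewrite scalerDl scalerA|exists `|pi (u i) x| => l; rewrite normrZ mulrC].
have Iu : integral_of mu (fun r => phi r *: pi (u i) x) = pi (u i) x.
  have := integral_comp haar_mu bup phiK; rewrite phi1 scale1r; exact.
have ccu : cc_on K (fun r => phi r *: pi (u i) x) by exact: (cc_on_comp bup phiK).
have first_le : `|integrated_form mu pi U w x - pi (u i) x| <= e / 2.
  rewrite -[X in _ - X]Iu /integrated_form -(integral_ofB haar_mu ccw ccu).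
  pose c := C * Mu * d.
  have phic : cc_on K (fun r => c *: (phi r : R)) by exact: cc_onZ.
  apply: (@le_trans _ _ (integral_of mu (fun r => c *: (phi r : R)))).
    apply: (integral_norm_le_integral haar_mu (cc_onB ccw ccu) phic) => r.
    have [Vr|/phiV pr] := pselect (V r); last first.
      by rewrite wr pr !scale0r (lin0 (covariant_linear_pi cov _)) subrr normr0 scaler0.
    rewrite wr (linZ (covariant_linear_pi cov _)) -scalerBr -(linB (covariant_bounded_pi cov (u i)).1).
    rewrite normrZ (ger0_norm (phi0 r)) /GRing.scale/= mulrC ler_wpM2r//.
    apply: le_trans (hC _ _ _ RX _ _) _; rewrite /c.
    by apply: ler_pM; rewrite ?mulr_ge0//; [rewrite ler_wpM2l|exact: Vr.2].
  rewrite (integral_ofZ haar_mu c phiK) phi1 /GRing.scale/= mulr1 /c /d.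
  by rewrite mulrA ler_pdivrMr// mulrC ler_pM2l// lerDl.
rewrite -(subrK (pi (u i) x) (integrated_form _ _ _ _ _)) -addrA (splitr e).
by apply: le_trans (ler_normD _ _) _; apply: lerD => //; rewrite distrC.
Qed.

Context (B : pBanachAlgType R) (q : Cc A G -> B).
Hypothesis hq : crossed_map mu alpha Rcl q.

(** With [w] an approximate unit for [x], the vector [pi >< U (f) x] is close to
    [pi >< U (f * w) x], whose norm is at most that of [amul (q f) (q w)] times
    that of [x]. *)
Lemma norm_le_regular : exists2 M, 0 <= M &
  forall f, `|q f| <= M * opnorm (amul (q f)).
Proof.
have [M M0 hM] := exists_approximate_unit; exists M => // f.
have on0 := opnorm_ge0 (bounded_amul (q f)).
rewrite (crossed_norm hq); apply: (sigma_le_pointwise Rcl_nonempty).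
  by rewrite mulr_ge0.
move=> X pi U RX x; have cov := Rcl_cov RX.
have s0 := sigma_ge0 haar_mu Rcl_nonempty Rcl_cov Rcl_bounded f.
have s1 : 0 < sigma f + 1 by rewrite ltr_wpDl.
apply/ler_addgt0Pr => e e0.
have [w [wM wx]] := hM _ _ _ RX x _ (divr_gt0 e0 s1).
rewrite -(subrK (integrated_form mu pi U f (integrated_form mu pi U w x))
  (integrated_form mu pi U f x)) [leRHS]addrC.
apply: le_trans (ler_normD _ _) _; apply: lerD.
  rewrite -(linB (linear_form haar_mu cov f)).
  apply: le_trans (form_le_sigma haar_mu Rcl_cov Rcl_bounded _ _ RX) _.
  rewrite distrC; apply: (@le_trans _ _ ((sigma f + 1) * (e / (sigma f + 1)))).
    by apply: ler_pM => //; rewrite lerDl.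
  by rewrite mulrC divfK// gt_eqF.
rewrite -(form_conv haar_mu dyn cov).
apply: le_trans (form_le_sigma haar_mu Rcl_cov Rcl_bounded _ _ RX) _.
rewrite ler_wpM2r// -(crossed_norm hq) (crossed_mul hq).
apply: le_trans (le_opnorm _ (bounded_amul (q f))) _.
by rewrite mulrC (crossed_norm hq) ler_wpM2r.
Qed.

End RegularNorm.

(** * The characterization *)

Section RegularEmbedding.
Context (R : realType) (E : pBanachAlgType R).
Hypothesis lambda_E : regular_bipositive_embedding E.

(** The inverse of the regular representation is continuous at zero, hence
    bounded, by homogeneity. *)
Lemma regular_norm_le : exists2 c, 0 <= c & forall e : E, `|e| <= c * opnorm (amul e).
Proof.
have [_ _ _ _ /(_ 0 1 ltr01)[d d0 hd]] := lambda_E.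
exists (2 / d); first by rewrite divr_ge0// ltW.
move=> e; have n0 := opnorm_ge0 (bounded_amul e).
apply/ler_addgt0Pr => eps eps0.
set n := opnorm (amul e) in n0 *.
(* The slack [eta] keeps the denominator positive when [n] is zero; it is scaled
   so that it contributes exactly [eps] in the end. *)
pose eta := eps * d / 2; have eta0 : 0 < eta by rewrite divr_gt0// mulr_gt0.
have s0 : 0 < n + eta by rewrite ltr_wpDl.
(* The vector [c *: e] is within reach of the modulus [d]: [c * n < d]. *)
pose c := d / (2 * (n + eta)); have c0 : 0 < c by rewrite divr_gt0// mulr_gt0.
have : `|0 - c *: e| < 1.
  apply: hd; apply: (@le_lt_trans _ _ (c * n)).
    apply: opnorm_le; first by rewrite mulr_ge0// ltW.
    move=> x; rewrite /= mul0a sub0r normrN amulZl normrZ (gtr0_norm c0) -mulrA.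
    by apply: ler_wpM2l; [exact: ltW|exact: (le_opnorm x (bounded_amul e))].
  rewrite /c mulrAC ltr_pdivrMr ?mulr_gt0// ltr_pM2l//.
  by lra.
rewrite sub0r normrN normrZ (gtr0_norm c0) -ltr_pdivlMl// mulr1 /c invf_div => /ltW.
suff -> : 2 / d * n + eps = 2 * (n + eta) / d by [].
by rewrite /eta; field; rewrite gt_eqF.
Qed.

End RegularEmbedding.

Section Characterization.
Context (R : realType) (A : pBanachAlgType R) (G : lcGroupType).
Context (mu : {measure set (borel G) -> \bar R}) (alpha : G -> A -> A).
Hypothesis haar_mu : left_haar mu.
Hypothesis dyn : dynamical_system alpha.
Hypothesis bai_A : positive_bounded_approximate_left_identity A.
Context (Rcl : representation_class A G).
Hypothesis Rcl_nonempty : exists (X : pBanachType R) pi U, @Rcl X pi U.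
Hypothesis Rcl_bounded : uniformly_bounded Rcl.
Hypothesis Rcl_cov : forall (X : pBanachType R) pi U, @Rcl X pi U ->
  continuous_covariant alpha pi U.
Hypothesis Rcl_nondegenerate : forall (X : pBanachType R) pi U, @Rcl X pi U ->
  nondegenerate_representation pi.
Context (E : pBanachAlgType R).
Hypothesis E_closed : closed (cone : set E).
Hypothesis lambda_E : regular_bipositive_embedding E.
Context (kA : A -> E -> E) (kG : G -> E -> E).
Hypothesis k_continuous : class_continuous mu alpha Rcl kA kG.
Hypothesis kA_positive : positive_representation kA.
Hypothesis kG_positive : positive_group_representation kG.
Hypothesis kA_centralizer : forall a, left_centralizer (kA a).
Hypothesis kG_centralizer : forall r, left_centralizer (kG r).
Local Notation kform := (integrated_form mu kA kG).
Hypothesis k_in_lambda : range kform `<=` range (@amul R E).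
Hypothesis k_dense : range (@amul R E) `<=` op_closure (range kform).
Hypothesis k_cone_dense : range (@amul R E) `&` @left_centralizer_cone R E `<=`
  op_closure (kform @` @Cc_cone R A G).
Context (B : pBanachAlgType R) (q : Cc A G -> B).
Hypothesis hq : crossed_map mu alpha Rcl q.
Context (iA : A -> B -> B) (iG : G -> B -> B).
Hypothesis biA : forall a, bounded_operator (iA a).
Hypothesis biG : forall r, bounded_operator (iG r).
Hypothesis iAq : forall a f, iA a (q f) = q (left_A a f).
Hypothesis iGq : forall r f, iG r (q f) = q (left_G alpha r f).
Context (T : E -> B -> B) (Tbar : (E -> E) -> (B -> B)).
Hypothesis T_rep : representation T.
Hypothesis T_bounded : bounded_representation T.
Hypothesis T_nondegenerate : nondegenerate_representation T.
Hypothesis T_ext : centralizer_extension T Tbar.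
Hypothesis Tbar_A : forall a, Tbar (kA a) = iA a.
Hypothesis Tbar_G : forall r, Tbar (kG r) = iG r.
Local Notation sigma := (class_seminorm mu Rcl).
Let lq := crossed_linear hq.
Let dq := crossed_dense hq.
Let k_cov : continuous_covariant alpha kA kG := k_continuous.1.
Let i_cov := iAG_covariant haar_mu dyn Rcl_nonempty Rcl_cov Rcl_bounded hq biA biG iAq iGq.
Let i_form := iAG_integrated haar_mu dyn Rcl_nonempty Rcl_cov Rcl_bounded hq biA biG iAq iGq.

Let lambda_inj (e e' : E) : (forall x, amul e x = amul e' x) -> e = e'.
Proof. by have [inj _ _ _ _] := lambda_E => ee'; apply: inj; apply/funext. Qed.

Lemma exists_lift : exists s : Cc A G -> E,
  forall f x, amul (s f) x = kform f x.
Proof.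
have h f : exists e, forall x, amul e x = kform f x.
  by have [e _ <-] := k_in_lambda (ex_intro2 _ _ f I erefl); exists e.
by have [s hs] := choice h; exists s.
Qed.

Section Lift.
Variable lift : Cc A G -> E.
Hypothesis liftE : forall f x, amul (lift f) x = kform f x.

Lemma lift_linear : linear lift.
Proof.
move=> l f g; apply: lambda_inj => x; rewrite liftE.
rewrite (integrated_formD haar_mu k_cov) (integrated_formZ haar_mu k_cov).
by rewrite amulDl amulZl !liftE.
Qed.

Lemma lift_mul f g : lift (convolution mu alpha f g) = amul (lift f) (lift g).
Proof.
apply: lambda_inj => x; rewrite liftE (form_conv haar_mu dyn k_cov) -amulA.
by rewrite !liftE.
Qed.

Lemma lift_left_A a f : kA a (lift f) = lift (left_A a f).
Proof.
apply: lambda_inj => x; have [_ <-] := kA_centralizer a.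
by rewrite !liftE (form_left_A haar_mu k_cov).
Qed.

Lemma lift_left_G r f : kG r (lift f) = lift (left_G alpha r f).
Proof.
apply: lambda_inj => x; have [_ <-] := kG_centralizer r.
by rewrite !liftE (form_left_G haar_mu dyn k_cov).
Qed.

Lemma lift_norm_le : exists2 c, 0 <= c & forall f, `|lift f| <= c * `|q f|.
Proof.
have [c c0 hc] := regular_norm_le lambda_E.
have [_ [D hD]] := k_continuous.
exists (c * `|D|); first by rewrite mulr_ge0.
move=> f; apply: le_trans (hc _) _; rewrite -mulrA ler_wpM2l//.
rewrite (_ : amul (lift f) = kform f); last by apply/funext => x; exact: liftE.
apply: le_trans (hD f) _; rewrite (crossed_norm hq) ler_wpM2r ?ler_norm//.
exact: (sigma_ge0 haar_mu Rcl_nonempty Rcl_cov Rcl_bounded).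
Qed.

(** Approximation of operators turns into approximation in [E] because the inverse
    of the regular representation is continuous. *)
Lemma lift_approx (P : set (Cc A G)) (e : E) (eps : R) : 0 < eps ->
  op_closure (kform @` P) (amul e) -> exists2 f, P f & `|e - lift f| < eps.
Proof.
move=> eps0 [_ cl].
have [_ _ _ _ /(_ e eps eps0)[d d0 hd]] := lambda_E.
have [_ [f Pf <-] fd] := cl d d0; exists f => //; apply: hd.
by rewrite (_ : amul (lift f) = kform f)//; apply/funext => x; exact: liftE.
Qed.

Lemma lift_dense : dense_range lift.
Proof.
move=> e eps eps0; have el : range (@amul R E) (amul e) by exists e.
by have [f _ ef] := lift_approx eps0 (k_dense el); exists f.
Qed.

(** Left multiplication by [lift f] is a positive operator, as an integral of
    positive ones, and the regular representation is bipositive. *)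
Lemma lift_cone f : Cc_cone f -> cone (lift f).
Proof.
move=> f0; have [_ _ h _ _] := lambda_E; apply: h; split; split.
- exact: bounded_amul.
- by move=> a b; rewrite amulA.
- exact: bounded_amul.
- by move=> x x0; rewrite liftE; exact: (form_cone haar_mu k_cov).
Qed.

Lemma lift_cone_dense e : cone e -> closure (lift @` @Cc_cone R A G) e.
Proof.
move=> e0 V /nbhs_ballP[eps /= eps0 epsV].
have el : (range (@amul R E) `&` @left_centralizer_cone R E) (amul e).
  by split; [exists e|have [_ h _ _ _] := lambda_E; exact: h].
have [f f0 ef] := lift_approx eps0 (k_cone_dense el).
by exists (lift f); split; [exists f|apply: epsV; rewrite -ball_normE].
Qed.

(** [Tbar L] acts on the vectors [T e b] as [T (L e) b], so on these vectors
    it can be exchanged with the integral although it need not be continuous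
    in [L]. *)
Lemma T_lift f b : T (lift f) b = amul (q f) b.
Proof.
have [bT lT mT] := T_rep; have [C hC] := T_bounded.
have [_ _ Tbar_mul Tbar_amul] := T_ext.
have amul_centralizer e : left_centralizer (amul e).
  by split; [exact: bounded_amul|move=> a c; rewrite amulA].
have TL L e z : left_centralizer L -> T (L e) z = Tbar L (T e z).
  move=> cL; have LE : amul (L e) = L \o amul e.
    by apply/funext => x /=; have [_ ->] := cL.
  by rewrite -!Tbar_amul LE Tbar_mul.
apply: (nondegenerate_eq T_nondegenerate) => //; first exact: bounded_amul.
move=> e z.
have bTz : bounded_operator (T^~ z).
  split; first by move=> l x y; rewrite lT.
  exists (C * `|z|) => x; apply: le_trans (le_opnorm z (bT x)) _.
  by rewrite mulrAC ler_wpM2r.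
rewrite -[LHS]/((T (lift f) \o T e) z) -mT liftE -i_form /integrated_form.
have cc := cc_on_form_integrand k_cov e (Cc_on_tsupport f).
rewrite -(integral_comp haar_mu bTz cc); congr integral_of; apply/funext => r /=.
by rewrite !TL// Tbar_A Tbar_G.
Qed.

(** Left multiplication by [q f] is [T (lift f)], whose norm is controlled by that
    of [lift f], and it controls the norm of [q f] in turn. *)
Lemma q_norm_le : exists2 c, 0 <= c & forall f, `|q f| <= c * `|lift f|.
Proof.
have [M M0 hM] := norm_le_regular haar_mu dyn Rcl_nonempty Rcl_cov Rcl_nondegenerate
  Rcl_bounded bai_A hq.
have [C hC] := T_bounded; have [bT _ _] := T_rep.
exists (M * `|C|); first by rewrite mulr_ge0.
move=> f; apply: le_trans (hM f) _; rewrite -mulrA ler_wpM2l//.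
apply: opnorm_le; first by rewrite mulr_ge0.
move=> b; rewrite -T_lift; apply: le_trans (le_opnorm b (bT _)) _.
rewrite ler_wpM2r//; apply: le_trans (hC _) _.
by rewrite ler_wpM2r// ler_norm.
Qed.

(** An intertwining isomorphism maps [q f] to [lift f]: both act in the same way
    on the range of [psi], since left multiplication by [q f] is the
    integrated form of [(iA, iG)] and [psi] commutes with the integral. *)
Lemma intertwiner_q (psi : B -> E) : topological_isomorphism psi ->
  (forall a b, kA a (psi b) = psi (iA a b)) ->
  (forall r b, kG r (psi b) = psi (iG r b)) -> forall f, psi (q f) = lift f.
Proof.
move=> [lpsi mpsi cpsi [phi [_ phiK _]]] psiA psiG f.
apply: lambda_inj => x; rewrite -(phiK x) -mpsi liftE -i_form.
have bpsi := continuous_linear_bounded_operator lpsi cpsi.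
have cc := cc_on_form_integrand i_cov (phi x) (Cc_on_tsupport f).
rewrite /integrated_form -(integral_comp haar_mu bpsi cc).
by congr integral_of; apply/funext => r /=; rewrite psiG psiA.
Qed.

(** The maps [q f |-> lift f] and [lift f |-> q f] are both bounded and densely
    defined; their extensions are inverse to each other. *)
Lemma exists_intertwiner : exists psi : B -> E,
  [/\ topological_isomorphism psi, bipositive psi,
      forall a b, kA a (psi b) = psi (iA a b),
      forall r b, kG r (psi b) = psi (iG r b) & forall f, psi (q f) = lift f].
Proof.
have [c c0 sc] := lift_norm_le; have [c' c'0 qc'] := q_norm_le.
have [psi [lpsi bpsi psiq]] := dense_extension dq lq lift_linear c0 sc.
have [phi [lphi bphi phis]] := dense_extension lift_dense lift_linear lq c'0 qc'.
have bo_psi : bounded_operator psi by split=> //; exists c.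
have bo_phi : bounded_operator phi by split=> //; exists c'.
have cpsi := bounded_operator_continuous bo_psi.
have cphi := bounded_operator_continuous bo_phi.
have bo_id (X : normedModType R) : bounded_operator (@id X).
  by split=> //; exists 1 => x; rewrite mul1r.
have psiK : cancel psi phi.
  move=> b; apply: (dense_range_eq dq (S := phi \o psi) (T := id)).
  - exact/bounded_operator_continuous/bounded_operator_comp.
  - exact/bounded_operator_continuous.
  - by move=> f; rewrite /= psiq phis.
have phiK : cancel phi psi.
  move=> e; apply: (dense_range_eq lift_dense (S := psi \o phi) (T := id)).
  - exact/bounded_operator_continuous/bounded_operator_comp.
  - exact/bounded_operator_continuous.
  - by move=> f; rewrite /= phis psiq.
have psiM a b : psi (amul a b) = amul (psi a) (psi b).
  have bl d := bounded_amul d; have br d := bounded_amulr d.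
  apply: (dense_range_eq dq (S := fun a => psi (amul a b))
    (T := fun a => amul (psi a) (psi b))).
  - exact/bounded_operator_continuous/(bounded_operator_comp bo_psi (br _ _ b)).
  - exact/bounded_operator_continuous/(bounded_operator_comp (br _ _ (psi b)) bo_psi).
  move=> f; apply: (dense_range_eq dq (S := fun b => psi (amul (q f) b))
    (T := fun b => amul (psi (q f)) (psi b))).
  - exact/bounded_operator_continuous/(bounded_operator_comp bo_psi (bl _ _ (q f))).
  - exact/bounded_operator_continuous/(bounded_operator_comp (bl _ _ (psi (q f))) bo_psi).
  by move=> g; rewrite -(crossed_mul hq) !psiq lift_mul.
have closure_map (X Y : normedModType R) (S : X -> Y) (P : set X) (Q : set Y) :
    continuous S -> (forall x, P x -> Q (S x)) -> forall x, closure P x -> closure Q (S x).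
  move=> cS PQ x Px V /(cS x)/Px[y [Py SV]].
  by exists (S y); split=> //; exact: PQ.
have psi0 b : cone b -> cone (psi b).
  rewrite (crossed_cone hq) => b0; rewrite (closure_id cone).1//.
  by apply: closure_map cpsi _ _ b0 => _ [f f0 <-]; rewrite psiq; exact: lift_cone.
have phi0 e : cone e -> cone (phi e).
  move=> e0; rewrite (crossed_cone hq).
  apply: closure_map cphi _ _ (lift_cone_dense e0) => _ [f f0 <-].
  by rewrite phis; exists f.
exists psi; split.
- by split=> //; exists phi.
- by split=> // [|b /phi0]; [exact: can_inj psiK|rewrite psiK].
- move=> a; apply: (dense_range_eq dq).
  + apply: bounded_operator_continuous; apply: (bounded_operator_comp _ bo_psi).
    by have [] := kA_centralizer a.
  + exact/bounded_operator_continuous/bounded_operator_comp.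
  + by move=> f; rewrite psiq iAq psiq lift_left_A.
- move=> r; apply: (dense_range_eq dq).
  + apply: bounded_operator_continuous; apply: (bounded_operator_comp _ bo_psi).
    by have [] := kG_centralizer r.
  + exact/bounded_operator_continuous/bounded_operator_comp.
  + by move=> f; rewrite psiq iGq psiq lift_left_G.
- exact: psiq.
Qed.

End Lift.

Lemma unique_intertwiner : exists psi : B -> E,
  [/\ topological_isomorphism psi, bipositive psi,
      forall a b, kA a (psi b) = psi (iA a b),
      forall r b, kG r (psi b) = psi (iG r b) &
      forall psi' : B -> E, topological_isomorphism psi' ->
        (forall a b, kA a (psi' b) = psi' (iA a b)) ->
        (forall r b, kG r (psi' b) = psi' (iG r b)) -> psi = psi'].
Proof.
have [s hs] := exists_lift.
have [psi [ipsi ppsi psiA psiG psiq]] := exists_intertwiner hs.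
exists psi; split=> // psi' ipsi' psiA' psiG'; apply/funext.
apply: (dense_range_eq dq); [by case: ipsi|by case: ipsi'|move=> f].
by rewrite psiq (intertwiner_q hs ipsi').
Qed.

End Characterization.

Lemma extended_operatorP (R : realType) (A : pBanachAlgType R) (G : lcGroupType)
  (mu : {measure set (borel G) -> \bar R}) (alpha : G -> A -> A)
  (Rcl : representation_class A G) (S : Cc A G -> Cc A G) :
  (exists L : crossed_product mu alpha Rcl -> crossed_product mu alpha Rcl,
    bounded_operator L /\
    forall f, L (quotient_map mu alpha Rcl f) = quotient_map mu alpha Rcl (S f)) ->
  bounded_operator (extended_operator mu alpha Rcl S) /\
  forall f, extended_operator mu alpha Rcl S (quotient_map mu alpha Rcl f) =
    quotient_map mu alpha Rcl (S f).
Proof.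
move=> [L hL]; exact: (@xgetPex _ (fun=> 0) [set L | bounded_operator L /\
  forall f, L (quotient_map mu alpha Rcl f) = quotient_map mu alpha Rcl (S f)]
  (ex_intro _ L hL)).
Qed.

Lemma induced_on_operatorsP (R : realType) (B E : pBanachAlgType R) (psi : B -> E)
  (L : B -> B) (K : E -> E) : topological_isomorphism psi ->
  K = induced_on_operators psi L <-> forall b, K (psi b) = psi (L b).
Proof.
move=> [_ _ _ [phi [psiK phiK _]]].
have inv b : inverse_function psi (psi b) = b.
  apply: (can_inj psiK); rewrite /inverse_function.
  exact: (@xgetPex _ 0 [set b' | psi b' = psi b] (ex_intro _ b erefl)).
split=> [-> b|KL]; first by rewrite /induced_on_operators /= inv.
by apply/funext => e; rewrite -(phiK e) KL /induced_on_operators /= inv.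
Qed.

Theorem theorem4p7 (R : realType) (A : pBanachAlgType R) (G : lcGroupType)
  (mu : {measure set (borel G) -> \bar R}) (alpha : G -> A -> A)
  (haar_mu : left_haar mu)
  (dyn_alpha : dynamical_system alpha)
  (bai_A : positive_bounded_approximate_left_identity A)
  (Rcl : representation_class A G)
  (Rcl_nonempty : exists (X : pBanachType R) pi U, Rcl X pi U)
  (Rcl_bounded : uniformly_bounded Rcl)
  (Rcl_reps : forall (X : pBanachType R) pi U, Rcl X pi U ->
     [/\ closed (cone : set X), continuous_covariant alpha pi U,
         nondegenerate_representation pi, positive_representation pi
       & positive_group_representation U])
  (E : pBanachAlgType R)
  (E_closed : closed (cone : set E))
  (bai_E : positive_bounded_approximate_left_identity E)
  (lambda_E : regular_bipositive_embedding E)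
  (kA : A -> E -> E) (kG : G -> E -> E)
  (k_continuous : class_continuous mu alpha Rcl kA kG)
  (k_nondegenerate : nondegenerate_representation kA)
  (kA_positive : positive_representation kA)
  (kG_positive : positive_group_representation kG)
  (kA_centralizer : forall a, left_centralizer (kA a))
  (kG_centralizer : forall r, left_centralizer (kG r))
  (k_in_lambda : range (integrated_form mu kA kG) `<=` range (@amul R E))
  (k_dense : range (@amul R E) `<=`
     op_closure (range (integrated_form mu kA kG)))
  (k_cone_dense : range (@amul R E) `&` @left_centralizer_cone R E `<=`
     op_closure (integrated_form mu kA kG @` @Cc_cone R A G))
  (k_universal : forall (X : pBanachType R) (pi : A -> X -> X)
     (U : G -> X -> X),
     closed (cone : set X) ->
     class_continuous mu alpha Rcl pi U ->
     nondegenerate_representation pi -> positive_representation pi ->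
     positive_group_representation U ->
     exists T : E -> X -> X,
       [/\ representation T, bounded_representation T, nondegenerate_representation T,
           positive_representation T
         & exists Tbar : (E -> E) -> (X -> X),
             [/\ centralizer_extension T Tbar,
                 forall a, Tbar (kA a) = pi a
               & forall r, Tbar (kG r) = U r]]) :
  exists psi : crossed_product mu alpha Rcl -> E,
    unique (fun psi : crossed_product mu alpha Rcl -> E =>
      [/\ topological_isomorphism psi,
          forall a, kA a = induced_on_operators psi (i_A mu alpha Rcl a)
        & forall r, kG r = induced_on_operators psi (i_G mu alpha Rcl r)]) psi
    /\ bipositive psi.
Proof.
have cov (X : pBanachType R) pi U : Rcl X pi U -> continuous_covariant alpha pi U.
  by move=> /Rcl_reps[].
have nd (X : pBanachType R) pi U : Rcl X pi U -> nondegenerate_representation pi.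
  by move=> /Rcl_reps[].
have hq := crossed_map_quotient
  (is_seminormed_algebra_Cc haar_mu dyn_alpha Rcl_nonempty cov Rcl_bounded).
have hA a := extended_operatorP
  (exists_left_A haar_mu Rcl_nonempty cov Rcl_bounded hq a).
have hG r := extended_operatorP
  (exists_left_G haar_mu dyn_alpha Rcl_nonempty cov Rcl_bounded hq r).
have biA a : bounded_operator (i_A mu alpha Rcl a) := (hA a).1.
have biG r : bounded_operator (i_G mu alpha Rcl r) := (hG r).1.
have iAq a := (hA a).2; have iGq r := (hG r).2.
have B_closed : closed (cone : set (crossed_product mu alpha Rcl)).
  by rewrite (crossed_cone hq); exact: closed_closure.
have [T [rT bT nT _ [Tbar [TE TA TG]]]] := k_universal
  (crossed_product mu alpha Rcl) (i_A mu alpha Rcl) (i_G mu alpha Rcl) B_closed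
  (iAG_class_continuous haar_mu dyn_alpha Rcl_nonempty cov Rcl_bounded hq biA biG iAq iGq)
  (iA_nondegenerate haar_mu Rcl_nonempty cov Rcl_bounded hq iAq bai_A)
  (iA_positive hq biA iAq)
  (iG_positive dyn_alpha hq biG iGq).
have [psi [ipsi ppsi psiA psiG psiU]] := unique_intertwiner haar_mu dyn_alpha bai_A
  Rcl_nonempty Rcl_bounded cov nd E_closed lambda_E k_continuous kA_positive
  kG_positive kA_centralizer kG_centralizer k_in_lambda k_dense k_cone_dense hq
  biA biG iAq iGq rT bT nT TE TA TG.
exists psi; split=> //; split.
  by split=> // [a|r]; apply/(induced_on_operatorsP _ _ ipsi).
move=> psi' [ipsi' psiA' psiG']; apply: psiU => //.
- by move=> a; apply/(induced_on_operatorsP _ _ ipsi').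
- by move=> r; apply/(induced_on_operatorsP _ _ ipsi').
Qed.
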